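(* Let $T$ be a closed and semiregular operator in the Hilbert $C^*$-module $E$ over the $C^*$-algebra $\mathcal{A}$, and let $\mathcal{E}\subset\mathrm{dom}(T)$ be an $\mathcal{A}$-submodule of the domain of $T$. The following statements are equivalent: (1) $\mathcal{E}$ is a core for $T$. (2) For every representation $(\pi,H_\pi)$ of $\mathcal{A}$ the subspace $\mathcal{E}\otimes_{\mathcal{A}}H_\pi$ is a core for $T^\pi$. (3) For every state $\omega$ on $\mathcal{A}$ the subspace $\iota_\omega(\mathcal{E})\subset\mathrm{dom}(T^\omega)$ is a core for the localization $T^\omega$.
   Context: $C^*$-algebras are not assumed unital. A Hilbert $C^*$-module $E$ over $\mathcal{A}$ is a right $\mathcal{A}$-module with an $\mathcal{A}$-valued inner product $\langle\cdot,\cdot\rangle$ (conjugate linear in the first, linear in the second variable), complete in the norm $\|x\|=\|\langle x,x\rangle\|^{1/2}$. A semiregular operator in $E$ is an operator $T:\mathrm{dom}(T)\to E$ defined on a dense $\mathcal{A}$-submodule $\mathrm{dom}(T)\subset E$ whose adjoint $T^*$ is densely defined; here $y\in\mathrm{dom}(T^* )$ iff there is $z=T^*y\in E$ with $\langle Tx,y\rangle=\langle x,z\rangle$ for all $x\in\mathrm{dom}(T)$. Such a $T$ is automatically $\mathcal{A}$-linear and closable. A subspace of the domain of a closed operator is a core if it is dense in the domain with respect to the graph norm. For a semiregular $T$ the graph inner product is $\langle x,y\rangle_T=\langle x,y\rangle+\langle Tx,Ty\rangle$. For a representation $\pi$ of $\mathcal{A}$ on a Hilbert space $H_\pi$, $E\hat\otimes_{\mathcal{A}}H_\pi$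 denotes the interior tensor product: the Hilbert space completion of the algebraic tensor product $E\otimes_{\mathcal{A}}H_\pi$ for $\langle x\otimes h,x'\otimes h'\rangle=\langle h,\pi(\langle x,x'\rangle)h'\rangle$. The localization $T^\pi$ is the closure of the (well-defined, densely defined, closable) operator $T_0^\pi$ in $E\hat\otimes_{\mathcal{A}}H_\pi$ with domain $\mathrm{dom}(T)\otimes_{\mathcal{A}}H_\pi$ and $T_0^\pi(x\otimes h)=(Tx)\otimes h$. Here $\mathcal{E}\otimes_{\mathcal{A}}H_\pi$ is understood as the span of the vectors $x\otimes h$, $x\in\mathcal{E}$, $h\in H_\pi$, in $\mathrm{dom}(T^\pi)$. For a state $\omega$ on $\mathcal{A}$, put $\langle x,y\rangle_\omega=\omega(\langle x,y\rangle)$ on $E$ and $\mathcal{N}_\omega=\{x\in E:\langle x,x\rangle_\omega=0\}$; $E^\omega$ is the Hilbert space completion of $E/\mathcal{N}_\omega$ and $\iota_\omega:E\to E^\omega$ is the natural map. The localization $T^\omega$ is the closure of the operator $T^\omega_0$ in $E^\omega$ with $\mathrm{dom}(T_0^\omega)=\iota_\omega(\mathrm{dom}(T))$ and $T^\omega_0\iota_\omega(x)=\iota_\omega(Tx)$. *)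

(* Defs.v *)
From HB Require Import structures.
From mathcomp Require Import all_boot all_order all_algebra.
From mathcomp Require Import complex.
From mathcomp Require Import all_classical all_reals all_analysis.
Import Order.TTheory GRing.Theory Num.Theory.
Import numFieldNormedType.Exports.

Set Implicit Arguments.
Unset Strict Implicit.
Unset Printing Implicit Defensive.

Local Open Scope classical_set_scope.
Local Open Scope ring_scope.

(* The complex numbers are R[i] for an arbitrary R : realType.  Norms of complex
   normed spaces take values in R[i]; since 0 <= z in R[i] forces z to be real,
   norms and the radii e with 0 < e are nonnegative reals. *)

(* Not assumed unital, which is why the multiplication is not that of a
   MathComp ring. *)
Record cstarAlg (R : realType) := CStarAlg {
  cstar_sort :> completeNormedModType R[i];
  amul : cstar_sort -> cstar_sort -> cstar_sort;
  astar : cstar_sort -> cstar_sort;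
  amulA : forall a b c, amul a (amul b c) = amul (amul a b) c;
  amulDl : forall a b c, amul (a + b) c = amul a c + amul b c;
  amulDr : forall a b c, amul a (b + c) = amul a b + amul a c;
  amulZl : forall (k : R[i]) a b, amul (k *: a) b = k *: amul a b;
  amulZr : forall (k : R[i]) a b, amul a (k *: b) = k *: amul a b;
  astarK : forall a, astar (astar a) = a;
  astarD : forall a b, astar (a + b) = astar a + astar b;
  astarZ : forall (k : R[i]) a, astar (k *: a) = k^*%R *: astar a;
  astarM : forall a b, astar (amul a b) = amul (astar b) (astar a);
  norm_amul : forall a b, `|amul a b| <= `|a| * `|b|;
  cstar_id : forall a, `|amul (astar a) a| = `|a| ^+ 2
}.

Definition apos (R : realType) (A : cstarAlg R) (a : A) : Prop :=
  exists b : A, a = amul (astar b) b.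

Record hilbertMod (R : realType) (A : cstarAlg R) := HilbertMod {
  hmod_sort :> completeNormedModType R[i];
  act : hmod_sort -> A -> hmod_sort;
  inner : hmod_sort -> hmod_sort -> A;
  actA : forall x a b, act x (amul a b) = act (act x a) b;
  actDl : forall x y a, act (x + y) a = act x a + act y a;
  actDr : forall x a b, act x (a + b) = act x a + act x b;
  actZl : forall (k : R[i]) x a, act (k *: x) a = k *: act x a;
  actZr : forall (k : R[i]) x a, act x (k *: a) = k *: act x a;
  innerDr : forall x y z, inner x (y + z) = inner x y + inner x z;
  innerZr : forall (k : R[i]) x y, inner x (k *: y) = k *: inner x y;
  inner_act : forall x y a, inner x (act y a) = amul (inner x y) a;
  inner_star : forall x y, astar (inner x y) = inner y x;
  inner_pos : forall x, apos (inner x x);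
  norm_inner : forall x, `|x| = sqrtC `|inner x x|
}.

Record hilbert (R : realType) := Hilbert {
  hilb_sort :> completeNormedModType R[i];
  dotp : hilb_sort -> hilb_sort -> R[i];
  dotpDr : forall x y z, dotp x (y + z) = dotp x y + dotp x z;
  dotpZr : forall (k : R[i]) x y, dotp x (k *: y) = k * dotp x y;
  dotp_conj : forall x y, (dotp x y)^*%R = dotp y x;
  dotp_pos : forall x, 0 <= dotp x x;
  norm_dotp : forall x, `|x| = sqrtC (dotp x x)
}.

Section Operators.
Context {R : realType}.

(* Only the values of oper on dom are meaningful. *)
Record operator (V : Type) := Operator { dom : set V; oper : V -> V }.

Definition graph (V : Type) (T : operator V) : set (V * V) :=
  [set p | dom T p.1 /\ p.2 = oper T p.1].

(* The operator with a given graph; the default value 0 and the choice made by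
   xget are irrelevant when G is single-valued. *)
Definition of_graph (V : completeNormedModType R[i]) (G : set (V * V)) :
    operator V :=
  Operator [set u | exists v, G (u, v)] (fun u => xget 0 [set v | G (u, v)]).

Definition closed_op (V : completeNormedModType R[i]) (T : operator V) : Prop :=
  closed (graph T).

Definition op_closure (V : completeNormedModType R[i]) (T : operator V) :
    operator V :=
  of_graph (closure (graph T)).

(* For a Hilbert module, W is the C*-algebra; for a Hilbert space, W is R[i]. *)
Definition graph_inner (V : Type) (W : zmodType) (ip : V -> V -> W)
    (T : operator V) (x y : V) : W :=
  ip x y + ip (oper T x) (oper T y).

Definition graph_norm (V : Type) (W : normedModType R[i]) (ip : V -> V -> W)
    (T : operator V) (x : V) : R[i] :=
  sqrtC `|graph_inner ip T x x|.

Definition core (V : zmodType) (W : normedModType R[i]) (ip : V -> V -> W)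
    (T : operator V) (D : set V) : Prop :=
  D `<=` dom T /\
  forall x, dom T x -> forall e : R[i], 0 < e ->
    exists2 y, D y & graph_norm ip T (x - y) < e.

Definition adj_dom (V W : Type) (ip : V -> V -> W) (T : operator V) : set V :=
  [set y | exists z, forall x, dom T x -> ip (oper T x) y = ip x z].

Definition lspan (V : lmodType R[i]) (B : set V) : set V :=
  [set v | exists2 s : seq (R[i] * V),
     (forall p, p \in s -> B p.2) & v = \sum_(p <- s) p.1 *: p.2].

End Operators.

Section Modules.
Context {R : realType} {A : cstarAlg R}.

Definition submodule (E : hilbertMod A) (D : set E) : Prop :=
  [/\ D 0, forall x y, D x -> D y -> D (x + y),
      forall (k : R[i]) x, D x -> D (k *: x)
    & forall x a, D x -> D (act x a)].

(* A-linearity of T is not assumed: it follows from the last condition. *)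
Definition semiregular (E : hilbertMod A) (T : operator E) : Prop :=
  [/\ submodule (dom T), dense (dom T) & dense (adj_dom (@inner R A E) T)].

Definition bounded_linear (H : hilbert R) (f : H -> H) : Prop :=
  [/\ forall h k, f (h + k) = f h + f k,
      forall (c : R[i]) h, f (c *: h) = c *: f h
    & exists M : R[i], forall h, `|f h| <= M * `|h|].

(* A *-homomorphism from A to the bounded operators on H; it may be
   degenerate. *)
Record representation (H : hilbert R) := Representation {
  rep :> A -> H -> H;
  rep_bounded : forall a, bounded_linear (rep a);
  repD : forall a b h, rep (a + b) h = rep a h + rep b h;
  repZ : forall (k : R[i]) a h, rep (k *: a) h = k *: rep a h;
  repM : forall a b h, rep (amul a b) h = rep a (rep b h);
  rep_star : forall a h k, dotp (rep (astar a) h) k = dotp h (rep a k)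
}.

(* The last condition says that the operator norm of w is at least 1. *)
Definition state (w : A -> R[i]) : Prop :=
  [/\ forall a b, w (a + b) = w a + w b,
      forall (k : R[i]) a, w (k *: a) = k * w a,
      forall a, 0 <= w (amul (astar a) a),
      forall a, `|w a| <= `|a|
    & forall M : R[i], 0 <= M -> (forall a, `|w a| <= M * `|a|) -> 1 <= M].

Section Localizations.
Variable E : hilbertMod A.

Definition elem_tensors (H K : hilbert R) (t : E -> H -> K) (D : set E) :
    set K :=
  [set k | exists x h, D x /\ k = t x h].

(* K is the Hilbert space completion of the algebraic tensor product of E and H
   over A, and t x h is the image of the elementary tensor of x and h.  A
   completion of a space with a semi-inner product is a Hilbert space together
   with a linear map into it that preserves the form and has dense range; it is
   unique up to a unique unitary commuting with these maps.  The linear map on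
   the tensor product is given by the A-balanced bilinear map t. *)
Record interior_tensor (H : hilbert R) (pi : representation H)
    (K : hilbert R) (t : E -> H -> K) : Prop := InteriorTensor {
  tensorDl : forall x y h, t (x + y) h = t x h + t y h;
  tensorDr : forall x h k, t x (h + k) = t x h + t x k;
  tensorZl : forall (c : R[i]) x h, t (c *: x) h = c *: t x h;
  tensorZr : forall (c : R[i]) x h, t x (c *: h) = c *: t x h;
  tensor_act : forall x a h, t (act x a) h = t x (pi a h);
  dotp_tensor : forall x h x' h',
    dotp (t x h) (t x' h') = dotp h (pi (inner x x') h');
  tensor_dense : dense (lspan (elem_tensors t setT))
}.

Definition tensor_span (H K : hilbert R) (t : E -> H -> K) (D : set E) :
    set K :=
  lspan (elem_tensors t D).

Definition rep_localization0 (H K : hilbert R) (t : E -> H -> K)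
    (T : operator E) : operator K :=
  of_graph (lspan (V := (K * K)%type)
    [set p | exists x h, dom T x /\ p = (t x h, t (oper T x) h)]).

Definition rep_localization (H K : hilbert R) (t : E -> H -> K)
    (T : operator E) : operator K :=
  op_closure (rep_localization0 t T).

(* K is the Hilbert space completion of the quotient of E by the null space of
   the form w <x, y>, and iota is the natural map from E; by iota_dotp the
   kernel of iota is that null space. *)
Record state_completion (w : A -> R[i]) (K : hilbert R) (iota : E -> K) :
    Prop := StateCompletion {
  iotaD : forall x y, iota (x + y) = iota x + iota y;
  iotaZ : forall (c : R[i]) x, iota (c *: x) = c *: iota x;
  iota_dotp : forall x y, dotp (iota x) (iota y) = w (inner x y);
  iota_dense : dense (range iota)
}.

Definition state_localization0 (K : hilbert R) (iota : E -> K)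
    (T : operator E) : operator K :=
  of_graph [set p | exists x, dom T x /\ p = (iota x, iota (oper T x))].

Definition state_localization (K : hilbert R) (iota : E -> K)
    (T : operator E) : operator K :=
  op_closure (state_localization0 iota T).

End Localizations.

Definition module_core (E : hilbertMod A) (T : operator E) (D : set E) : Prop :=
  core (@inner R A E) T D.

Definition hilbert_core (K : hilbert R) (T : operator K) (D : set K) : Prop :=
  core (W := R[i]^o) (@dotp R K) T D.

End Modules.

(* Main.v *)
(* (1) => (2): elementary tensors of dom T are approximated in graph norm by
   elementary tensors of D; this uses that *-representations are contractive.

   (2) => (3): apply (2) to the GNS representation of the state w.  Its space H
   is the completion of A for <a, b> = w (a^* b), and the completion K of E for w
   serves as the interior tensor product: the class of b in H corresponds to
   t x b = iota (x b).  Approximate units show that the graphs of the two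
   localizations have the same closure.

   (3) => (1): if D is not a core, some x0 in dom T stays at positive distance
   from D for the graph norm.  For y in D put
   b_y = <x0 - y, x0 - y> + <T (x0 - y), T (x0 - y)>.  The set of the b_y is convex
   up to positive elements and bounded below in norm, so a sublinear functional
   built from the order of the unitization of A and a Hahn-Banach argument give a
   state w with w b_y >= d > 0 for all y in D, which contradicts (3) for w.

   Behind the states lies the positivity of a^* a in a C*-algebra.  It is proved
   in unital *-algebras with a C*-seminorm, without spectral theory, by
   comparing norms of powers. *)
Require Import Defs.
From HB Require Import structures.
From mathcomp Require Import all_boot all_order all_algebra.
From mathcomp Require Import complex.
From mathcomp Require Import all_classical all_reals all_analysis.
From mathcomp Require Import ring lra.
Import Order.TTheory GRing.Theory Num.Theory.
Import numFieldNormedType.Exports.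

Set Implicit Arguments.
Unset Strict Implicit.
Unset Printing Implicit Defensive.

Local Open Scope classical_set_scope.
Local Open Scope ring_scope.

(** * Linear identities in abelian groups *)

(** Two obstacles shape the proof. The first is the missing unit: [iota x] need not be an elementary
    tensor over the GNS space, and A has no order unit. So x is replaced by x b, with one b in A
    serving x and T x at once, since pairs in a graph have to be approximated; and order arguments
    move to the unitization. Its norm is that of left multiplication on A, which vanishes on (e, -1)
    if A already has a unit e; hence seminorms. The second is that distances bound norms from below,
    while states see the order. The link is that 0 <= h <= k implies |h| <= |k|. Without functional
    calculus, h >= 0 is taken to mean that h is self-adjoint and |s - h| <= s for some s >= 0: sums
    are then immediate, and products go through approximate square roots obtained from a contracting
    iteration. For the localizations, a formal adjoint with dense domain makes closures of graphs
    single-valued, so that every core condition on a Hilbert space becomes an inclusion between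
    closures of graphs. *)

Inductive zexp := ZVar of nat | Zero | ZAdd of zexp & zexp | ZOpp of zexp.

Fixpoint zeval (V : zmodType) (s : seq V) (e : zexp) : V :=
  match e with
  | ZVar i => s`_i
  | Zero => 0
  | ZAdd a b => zeval s a + zeval s b
  | ZOpp a => - zeval s a
  end.

(* zcount true counts the positive occurrences of a variable, zcount false the
   negative ones. *)
Fixpoint zcount (b : bool) (e : zexp) (i : nat) : nat :=
  match e with
  | ZVar j => if b && (i == j) then 1 else 0
  | Zero => 0
  | ZAdd x y => zcount b x i + zcount b y i
  | ZOpp x => zcount (~~ b) x i
  end.

Fixpoint zbounded (n : nat) (e : zexp) : bool :=
  match e with
  | ZVar j => j < n
  | Zero => true
  | ZAdd x y => zbounded n x && zbounded n y
  | ZOpp x => zbounded n x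
  end%N.

Lemma zevalE (V : zmodType) (s : seq V) e : zbounded (size s) e ->
  zeval s e = \sum_(i < size s) s`_i *+ zcount true e i
              - \sum_(i < size s) s`_i *+ zcount false e i.
Proof.
elim: e => /= [j js||a IHa b IHb /andP[/IHa-> /IHb->]|a IHa /IHa->].
- rewrite [X in _ - X]big1 ?subr0; last by move=> i _; rewrite mulr0n.
  rewrite (bigD1 (Ordinal js))//= eqxx mulr1n big1 ?addr0// => i /negPf.
  by rewrite -val_eqE/= => ->; rewrite mulr0n.
- by rewrite !big1 ?subr0// => i _; rewrite mulr0n.
- rewrite addrACA -opprD -!big_split/=.
  by congr (_ - _); apply: eq_bigr => i _; rewrite mulrnDr.
- by rewrite opprB.
Qed.

(** Negative counts are moved across the equation, so the test is an identity in nat that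
    [vm_compute] decides. *)
Lemma zeval_eq (V : zmodType) (s : seq V) n e1 e2 : size s = n ->
  [&& zbounded n e1, zbounded n e2 &
   all (fun i => (zcount true e1 i + zcount false e2 i
                 == zcount true e2 i + zcount false e1 i)%N) (iota 0 n)] ->
  zeval s e1 = zeval s e2.
Proof.
move=> <- /and3P[b1 b2 /allP H]; rewrite !zevalE//.
apply/eqP; rewrite subr_eq addrAC eq_sym subr_eq eq_sym -!big_split/=; apply/eqP.
apply: eq_bigr => i _; rewrite -!mulrnDr; congr (_ *+ _); apply/eqP.
by apply: H; rewrite mem_iota/=.
Qed.

(* Atoms are compared up to unification because the same term may mention
   different paths in the hierarchy of algebraic structures. *)
Ltac zmod_index s x :=
  match s with
  | x :: _ => constr:(0%N)
  | ?y :: _ => let _ := match tt with _ => unify x y end in constr:(0%N)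
  | _ :: ?t => let n := zmod_index t x in constr:(S n)
  end.
Ltac zmod_insert s x :=
  match tt with
  | _ => let _ := zmod_index s x in s
  | _ => constr:(x :: s)
  end.
Ltac zmod_atoms s e :=
  lazymatch e with
  | ?a + ?b => let s' := zmod_atoms s a in zmod_atoms s' b
  | - ?a => zmod_atoms s a
  | 0 => s
  | _ => zmod_insert s e
  end.
Ltac zmod_reify s e :=
  lazymatch e with
  | ?a + ?b => let x := zmod_reify s a in let y := zmod_reify s b in
               constr:(ZAdd x y)
  | - ?a => let x := zmod_reify s a in constr:(ZOpp x)
  | 0 => constr:(Zero)
  | _ => let n := zmod_index s e in constr:(ZVar n)
  end.
Ltac zmod :=
  rewrite ?mulr2n ?opprD ?opprB;
  lazymatch goal with
  | |- ?l = ?r :> ?T =>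
    let s := zmod_atoms (@nil T) l in
    let s := zmod_atoms s r in
    let e1 := zmod_reify s l in
    let e2 := zmod_reify s r in
    apply: (@zeval_eq _ s _ e1 e2 erefl); vm_compute; reflexivity
  end.

(** * Growth of real sequences *)

Lemma expr_lt_eps (R : realType) (q e : R) :
  0 <= q -> q < 1 -> 0 < e -> exists n, q ^+ n < e.
Proof.
move=> q0 q1 e0.
have /cvgrPdist_lt /(_ e e0) [n _ Hn] : (fun n => q ^+ n) @ \oo --> (0 : R).
  by apply: cvg_expr; rewrite ger0_norm.
exists n; have := Hn n (leqnn _); rewrite sub0r normrN ger0_norm//.
exact: exprn_ge0.
Qed.

Lemma le_of_le_eps (R : realType) (c x y : R) :
  0 <= c -> (forall e, 0 < e -> e <= 1 -> x <= y + c * e) -> x <= y.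
Proof.
move=> c0 H; apply/ler_addgt0Pr => e e0.
have c1 : 0 < c + 1 by lra.
pose d := Num.min 1 (e / (c + 1)).
have d0 : 0 < d by rewrite lt_min ltr01 divr_gt0.
apply: (le_trans (H d d0 _)); first by rewrite ge_min lexx.
rewrite lerD2l; apply: (@le_trans _ _ ((c + 1) * d)).
  by rewrite ler_wpM2r ?ltW//; lra.
by rewrite -ler_pdivlMl// mulrC ge_min lexx orbT.
Qed.

(** If x = 1 + d with d > 0, Bernoulli's bound on x^(2^m), squared by passing from [m] to [m.+1], is
    quadratic in 2^m and beats the linear upper bound. *)
Lemma pow2_growth_le1 (R : realType) (x a b : R) :
  0 <= x -> 0 <= a -> 0 <= b ->
  (forall m, x ^+ (2 ^ m) <= a + b * (2 ^ m)%:R) -> x <= 1.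
Proof.
move=> x0 a0 b0 H; rewrite leNgt; apply/negP => x1.
pose d := x - 1; have d0 : 0 < d by rewrite /d; lra.
have bern n : 1 + n%:R * d <= x ^+ n.
  elim: n => [|n IH]; first by rewrite mul0r addr0 expr0.
  rewrite exprS (_ : x = 1 + d); last by rewrite /d; ring.
  rewrite {1}(_ : x = 1 + d) in IH; last by rewrite /d; ring.
  have n0 : 0 <= n%:R * d by rewrite mulr_ge0 ?ler0n// ltW.
  have : (1 + d) * (1 + n%:R * d) <= (1 + d) * (1 + d) ^+ n by rewrite ler_wpM2l//; lra.
  by rewrite -natr1; nra.
have key m : (1 + (2 ^ m)%:R * d) ^+ 2 <= a + b * 2 * (2 ^ m)%:R.
  have := H m.+1; rewrite expnSr exprM natrM => H'.
  apply: le_trans (_ : (x ^+ (2 ^ m)) ^+ 2 <= _).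
    rewrite ler_pXn2r ?nnegrE ?exprn_ge0//.
    by rewrite addr_ge0// mulr_ge0 ?ler0n// ltW.
  by rewrite -[b * 2 * _]mulrA [2 * _]mulrC.
have big (M : R) : exists m, M <= (2 ^ m)%:R.
  exists (Num.bound `|M|).
  apply: (le_trans (ler_norm M)); apply: (le_trans (ltW (archi_boundP (normr_ge0 M)))).
  by rewrite ler_nat ltnW// ltn_expl.
(* With Y = 2^m this gives d^2 Y >= a + 2 b + 1, hence d^2 Y^2 > a + 2 b Y because Y >= 1. *)
have [m Hm] := big ((a + 2 * b + 1) / d ^+ 2 + 1).
have : 1 <= (2 ^ m)%:R :> R by rewrite ler1n expn_gt0.
move: (key m) Hm; move: (2 ^ m)%:R => Y kk Hm Y1.
have d2 : 0 < d ^+ 2 by rewrite exprn_gt0.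
have hY : a + 2 * b + 1 <= d ^+ 2 * Y.
  by rewrite [leRHS]mulrC -ler_pdivrMr// (le_trans _ Hm)// lerDl.
have : (a + 2 * b + 1) * Y <= d ^+ 2 * Y * Y by rewrite ler_wpM2r//; lra.
have : 0 <= Y * d by rewrite mulr_ge0 ?ltW//; lra.
nra.
Qed.

(** * Unital *-algebras with a C*-seminorm *)

(* Scalars are real; J is the imaginary unit of the algebra. *)
Record cstar_seminorm (R : realType) (B : algType R) (star : B -> B) (J : B)
    (N : B -> R) : Prop := CstarSeminorm {
  csn_starK : forall x, star (star x) = x;
  csn_starD : forall x y, star (x + y) = star x + star y;
  csn_starZ : forall r x, star (r *: x) = r *: star x;
  csn_starM : forall x y, star (x * y) = star y * star x;
  csn_Jcomm : forall x, J * x = x * J;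
  csn_JJ : J * J = -1;
  csn_starJ : star J = - J;
  csn_ge0 : forall x, 0 <= N x;
  csn_D : forall x y, N (x + y) <= N x + N y;
  csn_Z : forall r x, N (r *: x) = `|r| * N x;
  csn_M : forall x y, N (x * y) <= N x * N y;
  csn_C : forall x, N (star x * x) = N x ^+ 2;
  csn_1 : N 1 <= 1
}.

Section SquareRoots.
Context (R : realType) (B : algType R) (star : B -> B) (J : B) (N : B -> R).
Hypothesis HN : cstar_seminorm star J N.

Let starK := csn_starK HN.
Let starD := csn_starD HN.
Let starZ := csn_starZ HN.
Let starM := csn_starM HN.
Let N_ge0 := csn_ge0 HN.
Let ND := csn_D HN.
Let NZ := csn_Z HN.
Let NM := csn_M HN.
Let NC := csn_C HN.
Let N1 := csn_1 HN.

Lemma csn_star1 : star 1 = 1.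
Proof. by rewrite -[LHS]mulr1 -[X in _ * X](starK 1) -starM mulr1 starK. Qed.

Lemma csn_starN x : star (- x) = - star x.
Proof. by rewrite -scaleN1r starZ scaleN1r. Qed.

Lemma csn_starB x y : star (x - y) = star x - star y.
Proof. by rewrite starD csn_starN. Qed.

Lemma csn_starX x n : star (x ^+ n) = star x ^+ n.
Proof.
by elim: n => [|n IH]; rewrite ?expr0 ?csn_star1// exprS exprSr starM IH.
Qed.

Lemma csn_N x : N (- x) = N x.
Proof. by rewrite -scaleN1r NZ normrN1 mul1r. Qed.

Lemma csn_0 : N 0 = 0.
Proof. by rewrite -(scale0r (0 : B)) NZ normr0 mul0r. Qed.

Lemma csn_B x y : N (x - y) <= N x + N y.
Proof. by rewrite (le_trans (ND _ _))// csn_N. Qed.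

Lemma csn_A r : N r%:A <= `|r|.
Proof. by rewrite NZ ler_piMr. Qed.

Lemma csn_star x : N (star x) = N x.
Proof.
have le y : N y <= N (star y).
  have := N_ge0 y; rewrite le_eqVlt => /predU1P[<-//|y0].
  have := NM (star y) y; rewrite NC expr2.
  by rewrite ler_pM2r.
by apply/eqP; rewrite eq_le le andbT -{2}(starK x) le.
Qed.

Lemma csn_X x n : N (x ^+ n) <= N x ^+ n.
Proof.
elim: n => [|n IH]; first by rewrite !expr0.
by rewrite !exprS (le_trans (NM _ _))// ler_wpM2l.
Qed.

Definition csn_sa x := star x = x.

Lemma csn_sq x : csn_sa x -> N (x ^+ 2) = N x ^+ 2.
Proof. by move=> sx; rewrite -NC sx expr2. Qed.

Lemma csn_saX x n : csn_sa x -> csn_sa (x ^+ n).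
Proof. by move=> sx; rewrite /csn_sa csn_starX sx. Qed.

Lemma csn_saD x y : csn_sa x -> csn_sa y -> csn_sa (x + y).
Proof. by move=> sx sy; rewrite /csn_sa starD sx sy. Qed.

Lemma csn_saB x y : csn_sa x -> csn_sa y -> csn_sa (x - y).
Proof. by move=> sx sy; rewrite /csn_sa csn_starB sx sy. Qed.

Lemma csn_saZ r x : csn_sa x -> csn_sa (r *: x).
Proof. by move=> sx; rewrite /csn_sa starZ sx. Qed.

Lemma csn_sa1 : csn_sa 1. Proof. exact: csn_star1. Qed.

Lemma csn_saA r : csn_sa r%:A. Proof. exact/csn_saZ/csn_sa1. Qed.

Lemma csn_saM x y : csn_sa x -> csn_sa y -> GRing.comm x y -> csn_sa (x * y).
Proof. by move=> sx sy c; rewrite /csn_sa starM sx sy. Qed.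

Lemma csn_X2 x m : csn_sa x -> N (x ^+ (2 ^ m)) = N x ^+ (2 ^ m).
Proof.
move=> sx; elim: m => [|m IH]; first by rewrite expn0 !expr1.
by rewrite expnSr !exprM csn_sq ?IH//; exact: csn_saX.
Qed.

(** The equality N (x^(2^m)) = (N x)^(2^m) for self-adjoint x takes the place of the spectral radius
    formula. *)
Lemma csn_le1_of_growth x (a b : R) : csn_sa x -> 0 <= a -> 0 <= b ->
  (forall n, N (x ^+ n) <= a + b * n%:R) -> N x <= 1.
Proof.
move=> sx a0 b0 H; apply: (pow2_growth_le1 (a := a) (b := b)) => // m.
by rewrite -csn_X2//; exact: H.
Qed.

(** A norm form of having spectrum in [0, 2 s]; by [csn_shift_le] a witness s may be enlarged. *)
Definition csn_pos h := csn_sa h /\ exists2 s : R, 0 <= s & N (s%:A - h) <= s.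

Lemma csn_shift_le (s t : R) h : s <= t -> N (s%:A - h) <= s -> N (t%:A - h) <= t.
Proof.
move=> st H; rewrite (_ : t%:A - h = (t - s)%:A + (s%:A - h)).
  apply: (le_trans (ND _ _)); have := csn_A (t - s).
  by rewrite ger0_norm ?subr_ge0// => H'; lra.
by rewrite scalerBl addrA subrK.
Qed.

Lemma csn_pos_sa h : csn_pos h -> csn_sa h. Proof. by case. Qed.

Lemma csn_posD h k : csn_pos h -> csn_pos k -> csn_pos (h + k).
Proof.
move=> [sh [s s0 Hs]] [sk [t t0 Ht]]; split; first exact: csn_saD.
exists (s + t); first exact: addr_ge0.
rewrite scalerDl opprD addrACA (le_trans (ND _ _))//; exact: lerD.
Qed.

Lemma csn_posZ r h : 0 <= r -> csn_pos h -> csn_pos (r *: h).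
Proof.
move=> r0 [sh [s s0 Hs]]; split; first exact: csn_saZ.
exists (r * s); first exact: mulr_ge0.
by rewrite -scalerA -scalerBr NZ ger0_norm// ler_wpM2l.
Qed.

Lemma csn_pos1 : csn_pos 1.
Proof. split; first exact: csn_sa1.
by exists 1 => //; rewrite scale1r subrr csn_0. Qed.

Lemma csn_posA r : 0 <= r -> csn_pos r%:A.
Proof. by move=> r0; apply/csn_posZ/csn_pos1. Qed.

Lemma csn_pos0 : csn_pos 0.
Proof. by have := csn_posA (lexx 0); rewrite scale0r. Qed.

Lemma csn_pos_sum n (F : nat -> B) :
  (forall i, csn_pos (F i)) -> csn_pos (\sum_(i < n) F i).
Proof.
move=> H; elim: n => [|n IH]; first by rewrite big_ord0; exact: csn_pos0.
by rewrite big_ord_recr/=; exact: csn_posD.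
Qed.

Fixpoint sqrt_iter (u : B) n : B :=
  if n is m.+1 then (2^-1 : R) *: (u + sqrt_iter u m ^+ 2) else 0.

(* The iterates converge to a solution of 2 z = u + z^2, that is of
   (1 - z)^2 = 1 - u. *)
Lemma sqrt_iterP u (r : R) : csn_sa u -> N u <= r -> r < 1 ->
  exists q : R, [/\ 0 <= q, q < 1 & forall n, let z := sqrt_iter u n in
    [/\ csn_sa z, forall g, GRing.comm g u -> GRing.comm g z, N z <= q
      & N (sqrt_iter u n.+1 - z) <= 2 * q ^+ n]].
Proof.
move=> su ur r1; have r0 : 0 <= r by apply: le_trans ur.
(* With this q the map F below preserves the ball of radius q. As z and F z commute, F (F z) - F z
   factors as a difference of squares, so consecutive increments shrink by the factor q. *)
pose q := (1 + r) / 2.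
have [q0 q1] : 0 <= q /\ q < 1 by rewrite /q; split; lra.
exists q; split => //.
have qq : (r + q ^+ 2) / 2 <= q by rewrite /q; nra.
pose F z : B := (2^-1 : R) *: (u + z ^+ 2).
have saF z : csn_sa z -> csn_sa (F z).
  by move=> sz; apply/csn_saZ/csn_saD => //; exact: csn_saX.
have commF z : (forall g, GRing.comm g u -> GRing.comm g z) ->
    forall g, GRing.comm g u -> GRing.comm g (F z).
  move=> cz g cg; rewrite /F /GRing.comm -scalerAr -scalerAl; congr (_ *: _).
  by apply: commrD => //; apply: commrX; exact: cz.
have bF z : N z <= q -> N (F z) <= q.
  move=> zq; rewrite /F NZ ger0_norm ?invr_ge0//.
  have h1 := ND u (z ^+ 2); have h2 := csn_X z 2.
  have h3 : N z ^+ 2 <= q ^+ 2 by rewrite ler_pXn2r ?nnegrE.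
  by rewrite mulrC; apply: le_trans qq; rewrite ler_wpM2r ?invr_ge0//; lra.
elim=> [|n [sz cz zq dz]] /=.
  split => //; first by rewrite /csn_sa -(scale0r 0) starZ !scale0r.
  - by move=> g _; exact: commr0.
  - by rewrite csn_0.
  - by rewrite subr0 expr0 mulr1; have := bF 0; rewrite csn_0 => /(_ q0); rewrite /F; lra.
rewrite -/(F (sqrt_iter u n)) -/(F (F (sqrt_iter u n))).
have {}dz : N (F (sqrt_iter u n) - sqrt_iter u n) <= 2 * q ^+ n by exact: dz.
move: (sqrt_iter u n) sz cz zq dz => z sz cz zq dz.
split; [exact: saF|exact: commF|exact: bF|].
have cFz : GRing.comm z (F z) by apply: commF => //; apply/commr_sym/cz.
have -> : F (F z) - F z = (2^-1 : R) *: ((F z - z) * (F z + z)).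
  rewrite {1 3}/F -scalerBr opprD addrACA subrr add0r; congr (_ *: _).
  rewrite mulrBl !mulrDr -!expr2 opprD addrA.
  by rewrite -cFz addrK.
rewrite NZ ger0_norm ?invr_ge0// exprS.
have h1 := NM (F z - z) (F z + z).
have h2 : N (F z + z) <= 2 * q by have := ND (F z) z; have := bF z zq; lra.
have h3 : N (F z - z) * N (F z + z) <= (2 * q ^+ n) * (2 * q).
  by apply: ler_pM.
by have : 0 <= q ^+ n; [exact: exprn_ge0 | lra].
Qed.

(** B is not assumed complete, so the root is only approximate. Commuting with all that commutes
    with u replaces membership in the closed algebra generated by u. *)
Lemma csn_sqrt_1B u (r e : R) : csn_sa u -> N u <= r -> r < 1 -> 0 < e ->
  exists w, [/\ csn_sa w, forall g, GRing.comm g u -> GRing.comm g w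
    & N (1 - u - w ^+ 2) <= e].
Proof.
move=> su ur r1 e0; have [q [q0 q1 key]] := sqrt_iterP su ur r1.
(* The error 1 - u - (1 - z)^2 is -2 times the next increment of the iteration, whose norm is at
   most 2 q^n; hence the 4. *)
have [n Hn] := expr_lt_eps q0 q1 (divr_gt0 e0 (ltr0n _ 4)).
have [sz cz zq] := key n; rewrite /=; move: (sqrt_iter u n) sz cz zq => z sz cz zq dz.
exists (1 - z); split.
- by apply: csn_saB => //; exact: csn_sa1.
- by move=> g cg; apply: commrB; [exact: commr1|exact: cz].
- have -> : 1 - u - (1 - z) ^+ 2 = - ((2 : R) *: ((2^-1 : R) *: (u + z ^+ 2) - z)).
    rewrite scalerBr scalerA divff ?pnatr_eq0// scale1r scaler_nat.
    by rewrite -[(1 - z) ^+ 2]sqrrN opprB sqrrB1; zmod.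
  by rewrite csn_N NZ ger0_norm//; lra.
Qed.

(* k^2 + v^2 close to 1 makes U = k + J v nearly unitary, so that its imaginary
   part v satisfies N v <= 1 up to an error. *)
Lemma csn_sq_le w (s : R) : csn_sa w -> N w ^+ 2 <= s -> N (s%:A - w ^+ 2) <= s.
Proof.
move=> sw ws; have s0 : 0 <= s by apply: le_trans ws; exact: exprn_ge0.
apply: (@le_of_le_eps _ 2 _ _) => // d d0 _.
(* Enlarging s to t gives N (k^2) <= s / t < 1 for k = w / sqrt t, the strict bound that
   [csn_sqrt_1B] requires. *)
pose t := s + d; have t0 : 0 < t by rewrite /t; lra.
suff : N (t%:A - w ^+ 2) <= t.
  move=> H; rewrite (_ : s%:A - w ^+ 2 = (t%:A - w ^+ 2) - d%:A).
    have := csn_B (t%:A - w ^+ 2) d%:A; have := csn_A d.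
    by rewrite gtr0_norm// => Hd; rewrite {2}/t in H; lra.
  by rewrite /t scalerDl; zmod.
pose c := (Num.sqrt t)^-1; have c0 : 0 < c by rewrite invr_gt0 sqrtr_gt0.
have cc : c ^+ 2 = t^-1 by rewrite exprVn sqr_sqrtr ?ltW.
pose k := c *: w; have sk : csn_sa k by exact: csn_saZ.
have k2 : N (k ^+ 2) <= s / t.
  rewrite exprZn NZ ger0_norm ?exprn_ge0 ?(ltW c0)// cc [leLHS]mulrC ler_pM2r ?invr_gt0//.
  exact: le_trans (csn_X _ _) ws.
have st : s / t < 1 by rewrite ltr_pdivrMr ?mul1r// /t; lra.
have k2B : w ^+ 2 = t *: k ^+ 2.
  by rewrite exprZn cc scalerA divff ?scale1r// gt_eqF.
rewrite k2B -scalerBr NZ gtr0_norm// ler_piMr ?(ltW t0)//.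
apply: (@le_of_le_eps _ 2 _ _) => // e e0 e1.
have [v [sv cv Hv]] := csn_sqrt_1B (csn_saX 2 sk) k2 st e0.
have kv : GRing.comm k v by apply: cv; apply: commrX.
pose U := k + J * v.
have JC := csn_Jcomm HN.
have sU : star U = k - J * v.
  by rewrite /U starD starM sk sv (csn_starJ HN) mulrN -JC.
have JvJv : J * v * (J * v) = - (v ^+ 2).
  by rewrite -mulrA [v * _]mulrA -[v * J]JC -mulrA mulrA (csn_JJ HN) mulN1r expr2.
have UU : star U * U = k ^+ 2 + v ^+ 2.
  rewrite sU mulrBl !mulrDr JvJv -expr2.
  rewrite [k * (J * v)]mulrA -[k * J]JC -mulrA kv mulrA.
  by zmod.
have NU : N U ^+ 2 <= 1 + e.
  rewrite -NC UU (_ : _ + _ = 1 - (1 - k ^+ 2 - v ^+ 2)).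
    by rewrite (le_trans (csn_B _ _))// lerD.
  by zmod.
have JvU : 2 * N v <= 2 * N U.
  have -> : 2 * N v = N ((2 : R) *: v) by rewrite NZ ger0_norm.
  have -> : (2 : R) *: v = - (J * (U - star U)).
    have -> : U - star U = J * v + J * v by rewrite sU /U; zmod.
    by rewrite mulrDr mulrA (csn_JJ HN) mulN1r scaler_nat; zmod.
  rewrite csn_N (le_trans (NM _ _))//.
  have NJ : N J <= 1.
    rewrite -(expr_le1 (n := 2))// -NC (csn_starJ HN) mulNr (csn_JJ HN).
    by rewrite opprK.
  apply: (le_trans (ler_wpM2r (N_ge0 _) NJ)); rewrite mul1r.
  have := csn_B U (star U); rewrite csn_star; lra.
have : N (1 - k ^+ 2) <= N (1 - k ^+ 2 - v ^+ 2) + N (v ^+ 2).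
  by have := ND (1 - k ^+ 2 - v ^+ 2) (v ^+ 2); rewrite subrK.
rewrite csn_sq// => h1.
have : N v ^+ 2 <= N U ^+ 2 by rewrite ler_pXn2r ?nnegrE//; lra.
lra.
Qed.

Lemma csn_pos_sqrt h (e : R) : csn_pos h -> 0 < e -> exists w,
  [/\ csn_sa w, forall g, GRing.comm g h -> GRing.comm g w & N (h - w ^+ 2) <= e].
Proof.
move=> [sh [s s0 Hs]] e0.
(* d is spent twice: on t = s + d, which makes N u < 1 but shifts h by d, and on the error of the
   root. *)
have [d d0 dd] : exists2 d, 0 < d & d + d = e by exists (e / 2); lra.
pose t := s + d; have t0 : 0 < t by rewrite /t; lra.
pose u := t^-1 *: (s%:A - h).
have su : csn_sa u by apply/csn_saZ/csn_saB => //; exact: csn_saA.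
have Nu : N u <= s / t.
  by rewrite NZ gtr0_norm ?invr_gt0// mulrC ler_pM2r ?invr_gt0.
have st : s / t < 1 by rewrite ltr_pdivrMr ?mul1r// /t; lra.
have [v [sv cv Hv]] := csn_sqrt_1B su Nu st (divr_gt0 d0 t0).
exists (Num.sqrt t *: v); split; first exact: csn_saZ.
  move=> g gh; rewrite /GRing.comm -scalerAr -scalerAl; congr (_ *: _).
  apply: cv; rewrite /u /GRing.comm -scalerAr -scalerAl; congr (_ *: _).
  apply: commrB => //; rewrite /GRing.comm -scalerAr -scalerAl.
  by rewrite mulr1 mul1r.
rewrite exprZn sqr_sqrtr ?(ltW t0)//.
rewrite (_ : h - _ = t *: (1 - u - v ^+ 2) - d%:A).
  have := csn_B (t *: (1 - u - v ^+ 2)) d%:A; rewrite NZ gtr0_norm//.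
  have := csn_A d; rewrite gtr0_norm//.
  have : t * N (1 - u - v ^+ 2) <= d by rewrite mulrC -ler_pdivlMr.
  move=> h1 h2 h3; apply: (le_trans h3); rewrite -dd; exact: lerD.
rewrite 2!scalerBr /u scalerA divff ?gt_eqF// scale1r.
by rewrite (scalerDl 1 s d : t%:A = _); zmod.
Qed.

Lemma csn_pos_sq w : csn_sa w -> csn_pos (w ^+ 2).
Proof.
move=> sw; split; first exact: csn_saX.
by exists (N w ^+ 2); [exact: exprn_ge0|exact: csn_sq_le].
Qed.

(** Through h close to w^2 and [csn_sq_le], the witness of positivity can be taken to be any bound
    for the norm, however large the given witness was. *)
Lemma csn_pos_le h (t : R) : csn_pos h -> N h <= t -> N (t%:A - h) <= t.
Proof.
move=> ph ht; apply: (@le_of_le_eps _ 3 _ _) => // e e0 _.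
have [w [sw _ Hw]] := csn_pos_sqrt ph e0.
have : N w ^+ 2 <= t + e.
  rewrite -csn_sq// (_ : w ^+ 2 = h - (h - w ^+ 2)); last by zmod.
  by have := csn_B h (h - w ^+ 2); lra.
move=> /(csn_sq_le sw) H.
rewrite (_ : t%:A - h = ((t + e)%:A - w ^+ 2) - (h - w ^+ 2) - e%:A).
  have := csn_A e; rewrite gtr0_norm//.
  have := csn_B ((t + e)%:A - w ^+ 2 - (h - w ^+ 2)) e%:A.
  have := csn_B ((t + e)%:A - w ^+ 2) (h - w ^+ 2); lra.
by rewrite scalerDl; zmod.
Qed.

(** The witnesses of the approximants k could be unbounded; [csn_pos_le] allows N h + e for all of
    them. *)
Lemma csn_pos_lim h : csn_sa h ->
  (forall e : R, 0 < e -> exists2 k, csn_pos k & N (h - k) <= e) -> csn_pos h.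
Proof.
move=> sh H; split=> //; exists (N h) => //.
apply: (@le_of_le_eps _ 3 _ _) => // e e0 _.
have [k pk hk] := H e e0.
have Nk : N k <= N h + e.
  rewrite (_ : k = h - (h - k)); last by zmod.
  by have := csn_B h (h - k); lra.
have := csn_pos_le pk Nk => H1.
rewrite (_ : (N h)%:A - h = ((N h + e)%:A - k) - (h - k) - e%:A).
  have := csn_A e; rewrite gtr0_norm//.
  have := csn_B ((N h + e)%:A - k - (h - k)) e%:A.
  have := csn_B ((N h + e)%:A - k) (h - k); lra.
by rewrite scalerDl; zmod.
Qed.

End SquareRoots.

(** * Products, norms and order; positivity of [star a * a] *)

Section Positivity.
Context (R : realType) (B : algType R) (star : B -> B) (J : B) (N : B -> R).
Hypothesis HN : cstar_seminorm star J N.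

Let starK := csn_starK HN.
Let starD := csn_starD HN.
Let starZ := csn_starZ HN.
Let starM := csn_starM HN.
Let N_ge0 := csn_ge0 HN.
Let ND := csn_D HN.
Let NZ := csn_Z HN.
Let NM := csn_M HN.
Let NC := csn_C HN.
Let N1 := csn_1 HN.


Local Notation sa := (csn_sa star).
Local Notation pos := (csn_pos star N).

(** Approximate roots w of h and v of k inherit commutation, so w v is self-adjoint and its square
    approximates h k. *)
Lemma csn_posM h k : pos h -> pos k -> GRing.comm h k -> pos (h * k).
Proof.
move=> ph pk hk; apply: (csn_pos_lim HN).
  by apply: (csn_saM HN) => //; [case: ph|case: pk].
move=> e e0.
pose M := 1 + N h + N k.
have Nh0 := N_ge0 h; have Nk0 := N_ge0 k.
have M0 : 0 < M by rewrite /M; lra.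
pose d := Num.min 1 (e / (M + M)); have d0 : 0 < d by rewrite lt_min ltr01 divr_gt0//; lra.
have d1 : d <= 1 by rewrite ge_min lexx.
have dM : d * (M + M) <= e by rewrite -ler_pdivlMr ?ge_min ?lexx ?orbT//; lra.
have [w [sw cw Hw]] := csn_pos_sqrt HN ph d0.
have [v [sv cv Hv]] := csn_pos_sqrt HN pk d0.
have wv : GRing.comm w v by apply: cv; apply/commr_sym/cw/commr_sym.
exists ((w * v) ^+ 2); first by apply: (csn_pos_sq HN); exact: (csn_saM HN).
have -> : (w * v) ^+ 2 = w ^+ 2 * v ^+ 2 by rewrite exprMn_comm.
have -> : h * k - w ^+ 2 * v ^+ 2 = (h - w ^+ 2) * k + w ^+ 2 * (k - v ^+ 2).
  by rewrite mulrBl mulrBr; zmod.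
apply: (le_trans (ND _ _)).
have w2 : N (w ^+ 2) <= N h + 1.
  have -> : w ^+ 2 = h - (h - w ^+ 2) by zmod.
  by apply: (le_trans (csn_B HN _ _)); lra.
have h1 : N ((h - w ^+ 2) * k) <= d * M.
  by apply: (le_trans (NM _ _)); apply: ler_pM => //; rewrite /M; lra.
have h2 : N (w ^+ 2 * (k - v ^+ 2)) <= M * d.
  by apply: (le_trans (NM _ _)); apply: ler_pM => //; rewrite /M; lra.
by apply: le_trans dM; rewrite [d * _]mulrDr; apply: lerD => //; rewrite [d * _]mulrC.
Qed.

Lemma csn_posX x n : pos x -> pos (x ^+ n).
Proof.
move=> px; elim: n => [|n IH]; first by rewrite expr0; exact: (csn_pos1 HN).
by rewrite exprS; apply: csn_posM => //; apply: commrX.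
Qed.

(* Expand (r + J w)^2 - (r - J w)^2 = 4 r J w. *)
Lemma csn_norm_add_sq (r : R) w : sa w -> 0 <= r ->
  2 * r * N w <= N ((r ^+ 2)%:A + w ^+ 2).
Proof.
move=> sw r0.
have JC := csn_Jcomm HN.
have JJ := csn_JJ HN.
pose Y := r%:A + J * w.
have sY : star Y = r%:A - J * w.
  by rewrite /Y starD starM sw (csn_starJ HN) mulrN -JC (csn_saA HN).
have YY : star Y * Y = (r ^+ 2)%:A + w ^+ 2.
  rewrite sY /Y mulrBl !mulrDr.
  have -> : J * w * (J * w) = - w ^+ 2.
    by rewrite -mulrA [w * _]mulrA -[w * J]JC -mulrA mulrA JJ mulN1r expr2.
  have -> : r%:A * r%:A = (r ^+ 2)%:A :> B by rewrite -scalerAl mul1r scalerA expr2.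
  have -> : r%:A * (J * w) = J * w * r%:A by rewrite -scalerAl -scalerAr mul1r mulr1.
  by zmod.
have D : J * (star Y ^+ 2 - Y ^+ 2) = (4 * r) *: w.
  have -> : star Y ^+ 2 - Y ^+ 2 = - ((4 * r) *: (J * w)).
    have -> : 4 * r = r + r + (r + r) by lra.
    rewrite !scalerDl sY /Y; move: (J * w) => p.
    rewrite !expr2 !mulrDr !mulrDl !mulrN !mulNr.
    by rewrite -!scalerAl -!scalerAr !mul1r !mulr1; zmod.
  by rewrite mulrN -scalerAr mulrA JJ mulN1r scalerN opprK.
have NJ : N J <= 1.
  rewrite -(expr_le1 (n := 2))// -NC (csn_starJ HN) mulNr JJ.
  by rewrite opprK.
have h0 : 4 * r * N w <= N (star Y ^+ 2 - Y ^+ 2).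
  rewrite -[4 * r]ger0_norm ?mulr_ge0// -NZ -D (le_trans (NM _ _))//.
  by rewrite -[leRHS]mul1r ler_wpM2r.
have h1 := csn_B HN (star Y ^+ 2) (Y ^+ 2).
have h2 := csn_X HN Y 2; have h3 := csn_X HN (star Y) 2.
rewrite (csn_star HN) in h3; rewrite -YY NC.
by rewrite -mulrA; move: h0; rewrite -mulrA; lra.
Qed.

(** [csn_norm_add_sq] at r = N w for w^2 close to h; it stands in for the fact that the norm of a
    positive element lies in its spectrum. *)
Lemma csn_pos_norm_dbl h : pos h -> 2 * N h <= N ((N h)%:A + h).
Proof.
move=> ph; apply: (@le_of_le_eps _ 4) => // e e0 _.
have [w [sw _ Hw]] := csn_pos_sqrt HN ph e0.
have := csn_norm_add_sq sw (N_ge0 w); rewrite -(csn_sq HN sw) => H.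
have h1 : N h <= N (w ^+ 2) + e.
  by have := ND (w ^+ 2) (h - w ^+ 2); rewrite addrC subrK; lra.
have h2 : N (w ^+ 2) <= N h + e.
  by have := csn_B HN h (h - w ^+ 2); rewrite [h - (_ - _)](_ : _ = w ^+ 2); [lra|zmod].
have h3 : 2 * N (w ^+ 2) = 2 * N w * N w by rewrite (csn_sq HN sw) expr2 mulrA.
have : N ((N (w ^+ 2))%:A + w ^+ 2) <= N ((N h)%:A + h) + 2 * e.
  have -> : (N (w ^+ 2))%:A + w ^+ 2 = ((N h)%:A + h) + ((N (w ^+ 2) - N h)%:A - (h - w ^+ 2)).
    by rewrite scalerBl; zmod.
  apply: (le_trans (ND _ _)); rewrite lerD2l (le_trans (csn_B HN _ _))//.
  have := csn_A HN (N (w ^+ 2) - N h).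
  have : `|N (w ^+ 2) - N h| <= e by rewrite ler_norml; apply/andP; split; lra.
  lra.
lra.
Qed.

(** [csn_pos_le] for t - h with the bound N h + t reads N (N h + h) <= N h + t, and the left side is
    at least 2 N h. *)
Lemma csn_pos_norm_le h (t : R) : pos h -> pos (t%:A - h) -> 0 <= t -> N h <= t.
Proof.
move=> ph pt t0.
have Nt : N (t%:A - h) <= N h + t.
  by have := csn_B HN t%:A h; have := csn_A HN t; rewrite ger0_norm//; lra.
have := csn_pos_le HN pt Nt.
have -> : (N h + t)%:A - (t%:A - h) = (N h)%:A + h by rewrite scalerDl; zmod.
by have := csn_pos_norm_dbl ph; lra.
Qed.

Lemma csn_pos_norm_mono h k : pos h -> pos (k - h) -> N h <= N k.
Proof.
move=> ph pk.
have pk' : pos k by rewrite -(subrK h k); exact: (csn_posD HN).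
apply: csn_pos_norm_le => //.
have -> : (N k)%:A - h = ((N k)%:A - k) + (k - h) by zmod.
apply: (csn_posD HN) => //; split.
  by apply: (csn_saB HN); [exact: (csn_saA HN)|case: pk'].
exists (N k) => //.
by have -> : (N k)%:A - ((N k)%:A - k) = k by zmod.
Qed.

(* (1 + s c c^* )^n = 1 + s c (\sum_(j < n) (1 + s c^* c)^j) c^* grows at most
   like n M^n. *)
Lemma csn_swap_le (s M : R) c : 1 <= M -> N (1 + s *: (star c * c)) <= M ->
  N (1 + s *: (c * star c)) <= M.
Proof.
move=> M1 H; have M0 : 0 < M by lra.
pose h := 1 + s *: (star c * c); pose k := 1 + s *: (c * star c).
have sk : sa k.
  by apply: (csn_saD HN); [exact: (csn_sa1 HN)|apply: (csn_saZ HN)];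
    rewrite /csn_sa starM starK.
have ck j : k ^+ j * c = c * h ^+ j.
  elim: j => [|j IH]; first by rewrite !expr0 mulr1 mul1r.
  rewrite exprSr -mulrA exprSr [in RHS]mulrA -IH -mulrA; congr (_ * _).
  by rewrite /k /h mulrDl mulrDr mul1r mulr1 -scalerAl -scalerAr mulrA.
have E n : k ^+ n = 1 + s *: (c * (\sum_(j < n) h ^+ j) * star c).
  elim: n => [|n IH]; first by rewrite big_ord0 mulr0 mul0r scaler0 addr0.
  rewrite exprSr {2}/k mulrDr mulr1 -scalerAr mulrA ck IH big_ord_recr/=.
  by rewrite mulrDr mulrDl scalerDr addrA.
have hM j : N (h ^+ j) <= M ^+ j.
  by apply: (le_trans (csn_X HN _ _)); apply: lerXn2r; rewrite ?nnegrE ?(ltW M0)//.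
rewrite -/k -[leRHS]mulr1 -ler_pdivrMl//.
have -> : M^-1 * N k = N (M^-1 *: k) by rewrite NZ gtr0_norm ?invr_gt0.
apply: (csn_le1_of_growth HN (a := 1) (b := `|s| * N c ^+ 2)) => //.
- exact: (csn_saZ HN).
- by rewrite mulr_ge0 ?exprn_ge0.
move=> n; rewrite exprZn NZ ger0_norm ?exprn_ge0 ?invr_ge0 ?(ltW M0)//.
rewrite exprVn ler_pdivrMl ?exprn_gt0// E.
apply: (le_trans (ND _ _)); rewrite mulrDr mulr1; apply: lerD.
  by apply: (le_trans N1); exact: exprn_ege1.
have -> : M ^+ n * (`|s| * N c ^+ 2 * n%:R) = `|s| * (N c * (M ^+ n * n%:R) * N c).
  by ring.
rewrite NZ ler_wpM2l// (le_trans (NM _ _))// (csn_star HN).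
rewrite ler_wpM2r// (le_trans (NM _ _))// ler_wpM2l//.
have : N (\sum_(j < n) h ^+ j) <= \sum_(j < n) M ^+ n.
  elim/big_ind2 : _ => [|x y x' y' h1 h2|j _].
  - by rewrite (csn_0 HN).
  - by apply: (le_trans (ND _ _)); exact: lerD.
  - by apply: (le_trans (hM _)); rewrite ler_weXn2l// ltnW.
by rewrite sumr_const card_ord mulr_natr.
Qed.

(** Replaces the coincidence of the nonzero spectra of the two products. Since s - (C - x) = (s - C)
    (1 + x / (s - C)), the norm condition for s > C is the hypothesis of [csn_swap_le] with M = s /
    (s - C). *)
Lemma csn_swap_pos (C : R) c : 0 <= C -> pos (C%:A - star c * c) ->
  pos (C%:A - c * star c).
Proof.
move=> C0 [_ [s0 s00 Hs0]].
have [s s1 sC] : exists2 s, s0 <= s & C < s by exists (s0 + C + 1); lra.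
have := csn_shift_le HN s1 Hs0.
have shiftE x : s%:A - (C%:A - x) = (s - C) *: (1 + (s - C)^-1 *: x).
  by rewrite scalerDr scalerA divff ?scale1r ?gt_eqF ?subr_gt0// scalerBl; zmod.
have d0 : 0 < s - C by lra.
rewrite shiftE NZ gtr0_norm// mulrC -ler_pdivlMr// => H.
split.
  by apply: (csn_saB HN); [exact: (csn_saA HN)|rewrite /csn_sa starM starK].
exists s; first lra.
rewrite shiftE NZ gtr0_norm// mulrC -ler_pdivlMr//.
by apply: csn_swap_le => //; rewrite ler_pdivlMr//; lra.
Qed.

(* Twice the sum is (c + c^* )^2 + (J (c - c^* ))^2. *)
Lemma csn_pos_sum_swap c : pos (star c * c + c * star c).
Proof.
have JC := csn_Jcomm HN.
pose p := c + star c; pose q := J * (c - star c).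
have sp : sa p by rewrite /csn_sa /p starD starK addrC.
have sq : sa q.
  by rewrite /csn_sa /q starM (csn_starJ HN) (csn_starB HN) starK mulrN -JC -mulrN opprB.
have pp : p ^+ 2 + q ^+ 2 = (2 : R) *: (star c * c + c * star c).
  have -> : q ^+ 2 = - (c - star c) ^+ 2.
    rewrite /q expr2 -mulrA [(c - _) * (J * _)]mulrA -[(c - _) * J]JC.
    by rewrite -mulrA mulrA (csn_JJ HN) mulN1r expr2.
  rewrite scaler_nat /p !expr2 !mulrDr !mulrDl !mulrN !mulNr.
  by zmod.
have -> : star c * c + c * star c = (2^-1 : R) *: (p ^+ 2 + q ^+ 2).
  by rewrite pp scalerA mulVf ?scale1r.
by apply: (csn_posZ HN) => //; apply: (csn_posD HN); exact: (csn_pos_sq HN).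
Qed.

Lemma csn_pos_1BX x n : pos (1 - x) -> pos x -> pos (1 - x ^+ n).
Proof.
move=> pu px; elim: n => [|n IH].
  by rewrite expr0 subrr; exact: (csn_pos0 HN).
have -> : 1 - x ^+ n.+1 = (1 - x ^+ n) + (1 - x) * x ^+ n.
  by rewrite mulrBl mul1r -exprS; zmod.
apply: (csn_posD HN) => //; apply: csn_posM => //; first exact: csn_posX.
by apply: commrX; apply/commr_sym/commrB; [exact: commr1|].
Qed.

(* For b = a^* a and x = 1 - t b with t small, c = sqrt t a x^k satisfies
   c^* c = t b x^(2k) <= 1.  Hence c c^* <= 1, so that c^* c >= - c c^* >= -1 and
   t b x^(2k) is bounded in k.  As t b x^k = x^k - x^(k+1), the powers of x grow
   at most linearly, whence N x <= 1. *)
Lemma csn_pos_mul_star a : pos (star a * a).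
Proof.
pose b := star a * a.
have sb : sa b by rewrite /csn_sa starM starK.
have Nb0 := N_ge0 b.
pose t := (2 * (N b + 1))^-1.
have t0 : 0 < t by rewrite invr_gt0; lra.
pose u := t *: b; have su : sa u by exact: (csn_saZ HN).
have Nu : N u <= 2^-1.
  rewrite NZ gtr0_norm// /t invfM -mulrA ler_piMr ?invr_ge0//.
  by rewrite mulrC ler_pdivrMr ?mul1r; lra.
pose x := 1 - u.
have sx : sa x by apply: (csn_saB HN) => //; exact: (csn_sa1 HN).
have px : pos x.
  split => //; exists 1 => //; rewrite scale1r /x.
  have -> : 1 - (1 - u) = u by zmod.
  by lra.
have uE : 1 - x = u by rewrite /x; zmod.
have xu : GRing.comm u x by apply: commrB; [exact: commr1|].
have xb : GRing.comm b x.
  apply: commrB; first exact: commr1.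
  by rewrite /u /GRing.comm -scalerAl -scalerAr.
have bnd n : N (u * x ^+ n.*2) <= 3.
  pose c := Num.sqrt t *: (a * x ^+ n).
  have cc : star c * c = u * x ^+ n.*2.
    rewrite /c starZ starM (csn_starX HN) sx -scalerAl -scalerAr scalerA.
    rewrite -expr2 sqr_sqrtr ?(ltW t0)// -mulrA [star a * _]mulrA -/b.
    have -> : b * x ^+ n = x ^+ n * b by exact: commrX.
    rewrite mulrA -exprD addnn -scalerAl; congr (_ *: _).
    by apply/esym; exact: commrX.
  have p1 : pos (1%:A - star c * c).
    rewrite scale1r cc.
    have -> : 1 - u * x ^+ n.*2 = x + u ^+ 2 * \sum_(j < n.*2) x ^+ j.
      have E : 1 - x ^+ n.*2 = u * \sum_(j < n.*2) x ^+ j.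
        have := subrXX_comm n.*2 (commr_sym (commr1 x)); rewrite expr1n => ->.
        by rewrite uE; congr (_ * _); apply: eq_bigr => i _; rewrite expr1n mul1r.
      rewrite expr2 -mulrA -E mulrBr mulr1 /x; zmod.
    apply: (csn_posD HN) => //; apply: csn_posM.
    - exact: (csn_pos_sq HN).
    - by apply: (csn_pos_sum HN) => i; exact: csn_posX.
    - apply: commr_sum => i _; apply: commrX; apply/commr_sym/commrX.
      exact: commr_sym.
  have p2 := csn_swap_pos ler01 p1.
  have p3 : pos (1 + star c * c).
    have -> : 1 + star c * c = (1%:A - c * star c) + (star c * c + c * star c).
      by rewrite scale1r; zmod.
    apply: (csn_posD HN) => //; exact: csn_pos_sum_swap.
  have : N (1 + star c * c) <= 2.
    apply: csn_pos_norm_le => //.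
    have -> : (2 : R)%:A - (1 + star c * c) = 1%:A - star c * c.
      by rewrite scaler_nat scale1r; zmod.
    by [].
  rewrite -cc => h1; have -> : star c * c = (1 + star c * c) - 1 by zmod.
  by have := csn_B HN (1 + star c * c) 1; have := N1; lra.
have Nx : N x <= 2 by have := csn_B HN 1 u; have := N1; rewrite -/x; lra.
(* An odd exponent costs one more factor N x <= 2. *)
have bnd' n : N (u * x ^+ n) <= 6.
  rewrite -(odd_double_half n) addnC; case: (odd n); last first.
    by rewrite addn0; have := bnd n./2; lra.
  rewrite addn1 exprSr mulrA; apply: (le_trans (NM _ _)).
  have : N (u * x ^+ n./2.*2) * N x <= 3 * 2 by exact: ler_pM.
  by lra.
have Nx1 : N x <= 1.
  apply: (csn_le1_of_growth HN (a := 1) (b := 6)) => //.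
  elim=> [|n IH]; first by rewrite expr0 mulr0 addr0 N1.
  have -> : x ^+ n.+1 = x ^+ n - u * x ^+ n by rewrite exprS {1}/x mulrBl mul1r.
  have := csn_B HN (x ^+ n) (u * x ^+ n); have := bnd' n.
  by rewrite -natr1; lra.
(* As x = 1 - u, the bound N x <= 1 is the norm condition for u with witness 1. *)
have pu : pos u by split => //; exists 1 => //; rewrite scale1r.
rewrite (_ : star a * a = t^-1 *: u).
  by apply: (csn_posZ HN) => //; rewrite invr_ge0 ltW.
by rewrite /u scalerA mulVf ?scale1r ?gt_eqF.
Qed.

Lemma csn_pos_conj h b : pos h -> pos (star b * h * b).
Proof.
move=> ph; apply: (csn_pos_lim HN).
  by rewrite /csn_sa !starM starK (csn_pos_sa ph) mulrA.
move=> e e0; have b0 : 0 < N b ^+ 2 + 1 by rewrite ltr_wpDl ?exprn_ge0.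
have [w [sw _ Hw]] := csn_pos_sqrt HN ph (divr_gt0 e0 b0).
exists (star (w * b) * (w * b)); first exact: csn_pos_mul_star.
rewrite starM sw -mulrA -mulrA -mulrBr [w * (_ * _)]mulrA -expr2 -mulrBl.
apply: (le_trans (NM _ _)); rewrite (csn_star HN).
apply: (@le_trans _ _ (N b * (N (h - w ^+ 2) * N b))).
  by rewrite ler_wpM2l// NM.
rewrite mulrCA -expr2.
apply: (@le_trans _ _ (e / (N b ^+ 2 + 1) * (N b ^+ 2 + 1))); last by rewrite mulfVK ?gt_eqF.
by apply: ler_pM => //; rewrite ?exprn_ge0// lerDl.
Qed.

(* If 0 <= u <= 1 then (m+1) u (1-u)^m <= u (1 + ... + (1-u)^m) <= 1. *)
Lemma csn_decay u m : pos u -> pos (1 - u) -> N (u * (1 - u) ^+ m) <= (m.+1%:R)^-1.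
Proof.
move=> pu px; pose x := 1 - u.
have uE : 1 - x = u by rewrite /x; zmod.
have xu : GRing.comm u x by apply: commrB; [exact: commr1|].
have xu' : GRing.comm x u by exact: commr_sym.
have p1 : pos (1 - (m.+1%:R : R) *: (u * x ^+ m)).
  elim: m => [|m IH]; first by rewrite scale1r expr0 mulr1.
  have -> : 1 - (m.+2%:R : R) *: (u * x ^+ m.+1) =
      x * (1 - (m.+1%:R : R) *: (u * x ^+ m)) + u * (1 - x ^+ m.+1).
    rewrite !mulrBr !mulr1 -scalerAr [x * (_ * _)]mulrA -xu -[u * x * _]mulrA -exprS.
    by rewrite -[in LHS](natr1 m.+1) scalerDl scale1r /x; zmod.
  apply: (csn_posD HN); apply: csn_posM => //.
  - apply: commrB; first exact: commr1.
    rewrite /GRing.comm -scalerAr -scalerAl; congr (_ *: _).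
    by apply: commrM => //; exact: commrX.
  - by apply: csn_pos_1BX => //; rewrite uE.
  - by apply: commrB; [exact: commr1|exact: commrX].
have p2 : pos (u * x ^+ m).
  by apply: csn_posM => //; [exact: csn_posX|exact: commrX].
have m0 : 0 < m.+1%:R :> R by rewrite ltr0n.
have : N ((m.+1%:R : R) *: (u * x ^+ m)) <= 1.
  apply: csn_pos_norm_le => //; last by rewrite scale1r.
  by apply: (csn_posZ HN).
by rewrite NZ gtr0_norm// -ler_pdivlMl// mulr1.
Qed.

End Positivity.

(** * Real-valued norms and the unitization *)

Local Notation toC r := (real_complex _ r).

(** The order of R[i] is partial; the real part carries norms to R, where suprema and [lra] are
    available. *)
Definition rnorm (R : realType) (V : normedZmodType R[i]) (x : V) : R :=
  complex.Re `|x|.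

Section RealNorm.
Context (R : realType).
Implicit Types (V : normedZmodType R[i]) (W : normedModType R[i]).

Lemma rnormE V (x : V) : `|x| = toC (rnorm x).
Proof. by rewrite /rnorm RRe_real// normr_real. Qed.

Lemma rnorm_ge0 V (x : V) : 0 <= rnorm x.
Proof. by rewrite -lecR -rnormE normr_ge0. Qed.

Lemma rnormD V (x y : V) : rnorm (x + y) <= rnorm x + rnorm y.
Proof. by rewrite -lecR rmorphD/= -!rnormE ler_normD. Qed.

Lemma rnormN V (x : V) : rnorm (- x) = rnorm x.
Proof. by rewrite /rnorm normrN. Qed.

Lemma rnorm_BC V (x y : V) : rnorm (x - y) = rnorm (y - x).
Proof. by rewrite -rnormN opprB. Qed.

Lemma rnormB V (x y : V) : rnorm (x - y) <= rnorm x + rnorm y.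
Proof. by rewrite -(rnormN y) rnormD. Qed.

Lemma rnorm0 V : rnorm (0 : V) = 0.
Proof. by rewrite /rnorm normr0. Qed.

Lemma rnorm_eq0 V (x : V) : rnorm x = 0 -> x = 0.
Proof. by move=> h; apply/normr0_eq0; rewrite rnormE h. Qed.

Lemma rnormZ W (k : R[i]) (x : W) : rnorm (k *: x) = rnorm k * rnorm x.
Proof. by apply: complexI; rewrite rmorphM/= -!rnormE normrZ. Qed.

Lemma rnormM (k l : R[i]) : rnorm (k * l) = rnorm k * rnorm l.
Proof. by apply: complexI; rewrite rmorphM/= -!rnormE normrM. Qed.

Lemma rnormC (r : R) : rnorm (toC r) = `|r|.
Proof.
rewrite /rnorm; case: (leP 0 r) => r0.
  by rewrite ger0_norm ?ler0c//= ger0_norm.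
by rewrite ltr0_norm ?ltcR//= ltr0_norm.
Qed.

Lemma conjC_toC (r : R) : (toC r)^*%R = toC r.
Proof. by apply/CrealP; rewrite complex_real. Qed.

Lemma rnorm_conj (k : R[i]) : rnorm (k^*%R) = rnorm k.
Proof. by rewrite /rnorm norm_conjC. Qed.

Lemma rnorm_i : rnorm ('i%R : R[i]) = 1.
Proof. by rewrite /rnorm normCi. Qed.

Lemma scale_half_dbl (W : lmodType R[i]) (x : W) : toC 2^-1 *: (x + x) = x.
Proof.
rewrite -mulr2n -[x *+ 2]scaler_nat scalerA -(rmorph_nat (real_complex R)) -rmorphM.
by rewrite mulVf ?pnatr_eq0// rmorph1 scale1r.
Qed.

Lemma Im_le_rnorm (x : R[i]) : `|complex.Im x| <= rnorm x.
Proof.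
rewrite /rnorm normc_def/=.
by rewrite -sqrtr_sqr ler_wsqrtr// lerDr sqr_ge0.
Qed.

Lemma Re_le_rnorm (x : R[i]) : `|complex.Re x| <= rnorm x.
Proof. by have := normc_ge_Re x; rewrite rnormE lecR. Qed.

End RealNorm.

Definition unitization (R : realType) (A : cstarAlg R) := (A * R[i])%type.

Section Unitization.
Context (R : realType) (A : cstarAlg R).
Local Notation B := (unitization A).

HB.instance Definition _ := GRing.Zmodule.copy B (A * R[i])%type.

Definition umul (x y : B) : B :=
  (amul x.1 y.1 + y.2 *: x.1 + x.2 *: y.1, x.2 * y.2).
Definition uone : B := (0, 1).
Definition uscale (r : R) (x : B) : B := (toC r *: x.1, toC r * x.2).
Definition ustar (x : B) : B := (astar x.1, (x.2)^*%R).
Definition uJ : B := (0, 'i%R).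

Lemma amul0l (a : A) : amul 0 a = 0.
Proof. by rewrite -(scale0r (0 : A)) amulZl !scale0r. Qed.
Lemma amul0r (a : A) : amul a 0 = 0.
Proof. by rewrite -(scale0r (0 : A)) amulZr !scale0r. Qed.
Lemma astar0 : astar (0 : A) = 0.
Proof. by rewrite -(scale0r (0 : A)) astarZ conjC0 !scale0r. Qed.

Lemma uaddE (x y : B) : x + y = (x.1 + y.1, x.2 + y.2). Proof. by []. Qed.

Let umulA : associative umul.
Proof.
move=> x y z; rewrite /umul/=; congr (_, _); last by rewrite mulrA.
rewrite !(amulDl, amulDr, amulZl, amulZr, scalerDr, scalerA, amulA).
by rewrite [z.2 * y.2]mulrC [z.2 * x.2]mulrC; zmod.
Qed.
Let umul1r : left_id uone umul.
Proof.
by move=> [a k]; rewrite /umul/= amul0l scaler0 scale1r !add0r mul1r.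
Qed.
Let umulr1 : right_id uone umul.
Proof.
by move=> [a k]; rewrite /umul/= amul0r scaler0 scale1r add0r addr0 mulr1.
Qed.
Let umulDl : left_distributive umul +%R.
Proof.
move=> x y z; rewrite /umul !uaddE/= mulrDl; congr (_, _).
by rewrite !(amulDl, scalerDr, scalerDl); zmod.
Qed.
Let umulDr : right_distributive umul +%R.
Proof.
move=> x y z; rewrite /umul !uaddE/= mulrDr; congr (_, _).
by rewrite !(amulDr, scalerDr, scalerDl); zmod.
Qed.
Let uone_neq0 : uone != 0 :> B.
Proof. by apply/eqP => /(congr1 snd)/= /eqP; rewrite oner_eq0. Qed.

HB.instance Definition _ := GRing.Zmodule_isNzRing.Build B
  umulA umul1r umulr1 umulDl umulDr uone_neq0.

Let uscaleA a b v : uscale a (uscale b v) = uscale (a * b) v.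
Proof. by rewrite /uscale/= scalerA mulrA rmorphM. Qed.
Let uscale1 : left_id 1 uscale.
Proof. by move=> [a k]; rewrite /uscale/= scale1r mul1r. Qed.
Let uscaleDr : right_distributive uscale +%R.
Proof. by move=> r x y; rewrite /uscale !uaddE/= scalerDr mulrDr. Qed.
Let uscaleDl v : {morph uscale^~ v : a b / a + b}.
Proof. by move=> a b; rewrite /uscale !uaddE/= rmorphD/= scalerDl mulrDl. Qed.

HB.instance Definition _ := GRing.Zmodule_isLmodule.Build R B
  uscaleA uscale1 uscaleDr uscaleDl.

Lemma uscaleE (r : R) (x : B) : r *: x = uscale r x. Proof. by []. Qed.
Lemma umulE (x y : B) : x * y = umul x y. Proof. by []. Qed.

Let uscaleAl (r : R) (x y : B) : r *: (x * y) = r *: x * y.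
Proof.
rewrite !uscaleE !umulE /uscale /umul/=; congr (_, _); last by rewrite mulrA.
by rewrite !(scalerDr, amulZl, scalerA); congr (_ + _ *: _ + _); rewrite mulrC.
Qed.

HB.instance Definition _ := GRing.Lmodule_isLalgebra.Build R B uscaleAl.

Let uscaleAr (r : R) (x y : B) : r *: (x * y) = x * (r *: y).
Proof.
rewrite !uscaleE !umulE /uscale /umul/=; congr (_, _); last by rewrite mulrCA.
by rewrite !(scalerDr, amulZr, scalerA); congr (_ + _ + _ *: _); rewrite mulrC.
Qed.

HB.instance Definition _ := GRing.Lalgebra_isAlgebra.Build R B uscaleAr.

Definition uact (x : B) (y : A) : A := amul x.1 y + x.2 *: y.

Lemma uact_mul x x' y : uact (x * x') y = uact x (uact x' y).
Proof.
rewrite /uact umulE /umul/= !(amulDl, amulDr, amulZl, amulZr, scalerDr, scalerA).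
by rewrite amulA; zmod.
Qed.

Lemma uact_star x y z : amul (astar (uact x y)) z = amul (astar y) (uact (ustar x) z).
Proof.
by rewrite /uact/= astarD astarM astarZ amulDl amulDr amulZl amulZr amulA.
Qed.

Lemma uactD x x' y : uact (x + x') y = uact x y + uact x' y.
Proof. by rewrite /uact amulDl scalerDl; zmod. Qed.

Lemma uactZl r x y : uact (r *: x) y = toC r *: uact x y.
Proof. by rewrite /uact/= amulZl scalerDr scalerA. Qed.

Lemma uactZr x k y : uact x (k *: y) = k *: uact x y.
Proof. by rewrite /uact amulZr scalerDr !scalerA mulrC. Qed.

Lemma rnorm_amul (a b : A) : rnorm (amul a b) <= rnorm a * rnorm b.
Proof. by rewrite -lecR rmorphM/= -!rnormE norm_amul. Qed.

Lemma rnorm_cstar (a : A) : rnorm (amul (astar a) a) = rnorm a ^+ 2.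
Proof. by apply: complexI; rewrite rmorphXn/= -!rnormE cstar_id. Qed.

Lemma rnorm_astar (a : A) : rnorm (astar a) = rnorm a.
Proof.
have le (b : A) : rnorm b <= rnorm (astar b).
  have := rnorm_ge0 b; rewrite le_eqVlt => /predU1P[<-|b0]; first exact: rnorm_ge0.
  by have := rnorm_amul (astar b) b; rewrite rnorm_cstar expr2 ler_pM2r.
by apply/eqP; rewrite eq_le le andbT -{2}(astarK a) le.
Qed.

(** The norm of x as a left multiplier of A. If A has a unit e, then (e, -1) acts as 0, so this is
    in general only a seminorm. *)
Definition unorm (x : B) : R := sup [set rnorm (uact x y) | y in [set y | rnorm y <= 1]].

Lemma unorm_has_sup x : has_sup [set rnorm (uact x y) | y in [set y | rnorm y <= 1]].
Proof.
split; first by exists (rnorm (uact x 0)), 0 => //=; rewrite rnorm0.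
exists (rnorm x.1 + rnorm x.2) => _ [y /= y1 <-].
apply: (le_trans (rnormD _ _)); apply: lerD.
  by apply: (le_trans (rnorm_amul _ _)); rewrite ler_piMr// rnorm_ge0.
by rewrite rnormZ ler_piMr// rnorm_ge0.
Qed.

Lemma uact_le x y : rnorm (uact x y) <= unorm x * rnorm y.
Proof.
have := rnorm_ge0 y; rewrite le_eqVlt => /predU1P[/esym y0|y0].
  by rewrite (rnorm_eq0 y0) /uact amul0r scaler0 addr0 !rnorm0 mulr0.
rewrite -ler_pdivrMr//.
have -> : rnorm (uact x y) / rnorm y = rnorm (uact x (toC (rnorm y)^-1 *: y)).
  by rewrite uactZr rnormZ rnormC ger0_norm ?invr_ge0 ?(ltW y0)// mulrC.
apply: ub_le_sup; first by case: (unorm_has_sup x).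
exists (toC (rnorm y)^-1 *: y) => //=.
by rewrite rnormZ rnormC ger0_norm ?invr_ge0 ?(ltW y0)// mulVf ?gt_eqF.
Qed.

Lemma unorm_le x M : 0 <= M -> (forall y, rnorm (uact x y) <= M * rnorm y) ->
  unorm x <= M.
Proof.
move=> M0 H; apply: ge_sup; first by case: (unorm_has_sup x).
by move=> _ [y /= y1 <-]; apply: (le_trans (H y)); rewrite ler_piMr.
Qed.

Lemma unorm_ge0 x : 0 <= unorm x.
Proof.
apply: (@le_trans _ _ (rnorm (uact x 0))); first exact: rnorm_ge0.
apply: ub_le_sup; first by case: (unorm_has_sup x).
by exists 0 => //=; rewrite rnorm0.
Qed.

Lemma ustarK x : ustar (ustar x) = x.
Proof. by case: x => a k; rewrite /ustar/= astarK conjCK. Qed.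

Lemma ustarM x y : ustar (x * y) = ustar y * ustar x.
Proof.
rewrite !umulE /umul /ustar/= !(astarD, astarM, astarZ) rmorphM mulrC.
by congr (_, _); zmod.
Qed.

Lemma unormM x y : unorm (x * y) <= unorm x * unorm y.
Proof.
apply: unorm_le => [|z]; first by rewrite mulr_ge0 ?unorm_ge0.
rewrite uact_mul; apply: (le_trans (uact_le _ _)).
by rewrite -mulrA ler_wpM2l ?unorm_ge0// uact_le.
Qed.

(** From (x y)^* (x y) = y^* (x^* x y) and the C*-identity of A. *)
Lemma unorm_sq_le x : unorm x ^+ 2 <= unorm (ustar x * x).
Proof.
have q0 := unorm_ge0 (ustar x * x).
rewrite -(@sqr_sqrtr _ (unorm (ustar x * x)))//.
apply: lerXn2r; rewrite ?nnegrE ?unorm_ge0 ?sqrtr_ge0//.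
apply: unorm_le => [|y]; first exact: sqrtr_ge0.
rewrite -(ler_pXn2r (n := 2)) ?nnegrE ?mulr_ge0 ?rnorm_ge0 ?sqrtr_ge0//.
rewrite exprMn sqr_sqrtr// -rnorm_cstar uact_star -uact_mul.
apply: (le_trans (rnorm_amul _ _)); rewrite rnorm_astar expr2 mulrCA.
by rewrite ler_wpM2l ?rnorm_ge0// uact_le.
Qed.

Lemma unorm_star x : unorm (ustar x) = unorm x.
Proof.
have le (y : B) : unorm y <= unorm (ustar y).
  have := unorm_ge0 y; rewrite le_eqVlt => /predU1P[<-|y0]; first exact: unorm_ge0.
  by have := le_trans (unorm_sq_le y) (unormM _ _); rewrite expr2 ler_pM2r.
by apply/eqP; rewrite eq_le le andbT -{2}(ustarK x) le.
Qed.

Lemma unorm_cstar : cstar_seminorm ustar uJ unorm.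
Proof.
split.
- exact: ustarK.
- by move=> x y; rewrite /ustar !uaddE/= astarD rmorphD.
- by move=> r x; rewrite !uscaleE /ustar /uscale/= astarZ rmorphM/= conjC_toC.
- exact: ustarM.
- move=> [a k]; rewrite !umulE /umul/= amul0l amul0r !scaler0 [k * _]mulrC.
  by rewrite !add0r addr0.
- rewrite umulE /umul/= amul0l scaler0 !addr0 -expr2 sqrCi.
  by rewrite -[RHS]/(- (0 : A), - 1) oppr0.
- by rewrite /ustar/= astar0 conjCi -[RHS]/(- (0 : A), _) oppr0.
- exact: unorm_ge0.
- move=> x y; apply: unorm_le => [|z]; first by rewrite addr_ge0 ?unorm_ge0.
  by rewrite uactD mulrDl (le_trans (rnormD _ _))// lerD// uact_le.
- have le (r : R) (x : B) : unorm (r *: x) <= `|r| * unorm x.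
    apply: unorm_le => [|z]; first by rewrite mulr_ge0 ?unorm_ge0.
    by rewrite uactZl rnormZ rnormC -mulrA ler_wpM2l// uact_le.
  move=> r x; apply/eqP; rewrite eq_le le/=.
  have [->|r0] := eqVneq r 0; first by rewrite normr0 mul0r unorm_ge0.
  rewrite -ler_pdivlMl ?normr_gt0// -normfV.
  by have := le r^-1 (r *: x); rewrite scalerA mulVf// scale1r.
- exact: unormM.
- move=> x; apply/eqP; rewrite eq_le unorm_sq_le andbT.
  by rewrite (le_trans (unormM _ _))// unorm_star expr2.
- apply: unorm_le => // y.
  by rewrite -[1]/uone /uact/= amul0l add0r scale1r mul1r.
Qed.

Lemma unorm_emb (a : A) : unorm (a, 0) = rnorm a.
Proof.
apply/eqP; rewrite eq_le; apply/andP; split.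
  apply: unorm_le => [|y]; first exact: rnorm_ge0.
  by rewrite /uact/= scale0r addr0 rnorm_amul.
have [->|a0] := eqVneq (rnorm a) 0; first exact: unorm_ge0.
have {}a0 : 0 < rnorm a by rewrite lt_neqAle eq_sym a0 rnorm_ge0.
(* Evaluating the multiplier at a^* attains the norm of a, by the C*-identity. *)
have := uact_le (a, 0) (astar a); rewrite /uact/= scale0r addr0.
rewrite -{1}(astarK a) rnorm_cstar rnorm_astar expr2.
by rewrite ler_pM2r.
Qed.

End Unitization.

(** * Linear functionals below a sublinear functional *)

Section HahnBanach.
Context (R : realType) (V : lmodType R[i]).

Definition sublinear (q : V -> R) :=
  (forall x y, q (x + y) <= q x + q y) /\
  (forall r x, 0 < r -> q (toC r *: x) <= r * q x).

Lemma sublinearZ q r x : sublinear q -> 0 < r -> q (toC r *: x) = r * q x.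
Proof.
move=> [_ qZ] r0; apply/eqP; rewrite eq_le qZ//= -ler_pdivlMl//.
have := qZ r^-1 (toC r *: x); rewrite invr_gt0 => /(_ r0).
by rewrite scalerA -rmorphM mulVf ?gt_eqF// rmorph1 scale1r.
Qed.

Lemma sublinear0 q : sublinear q -> q 0 = 0.
Proof.
by move=> sq; have := sublinearZ 0 sq (ltr0n _ 2); rewrite scaler0; lra.
Qed.

Lemma sublinearN q x : sublinear q -> - q (- x) <= q x.
Proof.
by move=> sq; have := sq.1 x (- x); rewrite subrr sublinear0//; lra.
Qed.

(* A minimal sublinear functional q is additive: for each a the functional
   x |-> inf_(t >= 0) (q (x + t a) - t q a) is sublinear and below q. *)
Lemma sublinear_dominates_linear (p : V -> R) : sublinear p -> exists f : V -> R,
  [/\ forall x y, f (x + y) = f x + f y, forall r x, f (toC r *: x) = r * f x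
    & forall x, f x <= p x].
Proof.
move=> sp.
pose T := {q : V -> R | sublinear q /\ forall x, q x <= p x}.
(* The order is reversed, so that Zorn's maximal elements are the minimal functionals. *)
pose below (s t : T) : bool := `[< forall x, sval t x <= sval s x >].
have [||||q minq] := @Zorn T below.
- by move=> s; apply/asboolP.
- move=> s t u /asboolP st /asboolP tu; apply/asboolP => x.
  exact: le_trans (tu x) (st x).
- move=> [s Hs] [t Ht] /asboolP/= st /asboolP/= ts; apply: eq_exist.
  by apply/funext => x; apply/eqP; rewrite eq_le st ts.
- move=> F totF.
  have [[s0 Fs0]|noF] := pselect (exists s, F s); last first.
    exists (exist _ p (conj sp (fun x => lexx _))) => s Fs.
    by case: noF; exists s.
  pose S x := [set sval s x | s in F].
  have infS x : has_inf (S x).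
    split; first by exists (sval s0 x), s0.
    exists (- p (- x)) => _ [[s [sS sp']] _ <-]/=.
    by apply: le_trans (sublinearN x sS); rewrite lerN2.
  pose q x := inf (S x).
  have q_le s x : F s -> q x <= sval s x.
    by move=> Fs; apply: ge_inf; [case: (infS x)|exists s].
  have q_ge x c : (forall s, F s -> c <= sval s x) -> c <= q x.
    move=> H; apply: lb_le_inf; first by case: (infS x).
    by move=> _ [s Fs <-]; exact: H.
  have sq : sublinear q.
    split=> [x y|r x r0].
      rewrite -lerBlDr; apply: (q_ge) => s Fs.
      rewrite lerBlDr -lerBlDl; apply: (q_ge) => t Ft; rewrite lerBlDl.
      have [/asboolP st|/asboolP ts] := totF _ _ Fs Ft.
        apply: (le_trans (q_le t _ Ft)); apply: (le_trans ((svalP t).1.1 x y)).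
        exact: lerD.
      apply: (le_trans (q_le s _ Fs)); apply: (le_trans ((svalP s).1.1 x y)).
      exact: lerD.
    rewrite -ler_pdivrMl//; apply: (q_ge) => s Fs; rewrite ler_pdivrMl//.
    by apply: (le_trans (q_le s _ Fs)); apply: (svalP s).1.2.
  have qp x : q x <= p x by apply: (le_trans (q_le s0 x Fs0)); apply: (svalP s0).2.
  by exists (exist _ q (conj sq qp)) => s Fs; apply/asboolP => x /=; exact: q_le.
case: q minq => q [sq qp] minq; have [qD qZ] := sq.
have add x a : q (x + a) = q x + q a.
  pose S x := [set q (x + toC t *: a) - t * q a | t in [set t | 0 <= t]].
  have qta t : 0 <= t -> q (toC t *: a) = t * q a.
    rewrite le_eqVlt => /predU1P[<-|t0]; last exact: sublinearZ.
    by rewrite rmorph0 scale0r mul0r sublinear0.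
  have infS y : has_inf (S y).
    split; first by exists (q (y + toC 0 *: a) - 0 * q a), 0 => /=.
    exists (- q (- y)) => _ [t /= t0 <-].
    have := qD (y + toC t *: a) (- y).
    by rewrite addrAC subrr add0r qta//; lra.
  pose q' y := inf (S y).
  have q'_le y t : 0 <= t -> q' y <= q (y + toC t *: a) - t * q a.
    by move=> t0; apply: ge_inf; [case: (infS y)|exists t].
  have q'_ge y c : (forall t, 0 <= t -> c <= q (y + toC t *: a) - t * q a) -> c <= q' y.
    move=> H; apply: lb_le_inf; first by case: (infS y).
    by move=> _ [t /= t0 <-]; exact: H.
  have sq' : sublinear q'.
    split=> [y z|r y r0].
      rewrite -lerBlDr; apply: (q'_ge) => s s0.
      rewrite lerBlDr -lerBlDl; apply: (q'_ge) => t t0; rewrite lerBlDl.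
      apply: (le_trans (q'_le _ _ (addr_ge0 s0 t0))).
      have := qD (y + toC s *: a) (z + toC t *: a).
      have -> : y + toC s *: a + (z + toC t *: a) = y + z + toC (s + t) *: a.
        by rewrite rmorphD scalerDl; zmod.
      lra.
    rewrite -ler_pdivrMl//; apply: (q'_ge) => s s0; rewrite ler_pdivrMl//.
    apply: (le_trans (q'_le _ _ (mulr_ge0 (ltW r0) s0))).
    have := qZ r (y + toC s *: a) r0; rewrite scalerDr scalerA -rmorphM.
    by rewrite mulrBr mulrA lerD2r.
  have q'q y : q' y <= q y.
    by have := q'_le y 0 (lexx 0); rewrite rmorph0 scale0r addr0 mul0r subr0.
  have q'p y : q' y <= p y by apply: le_trans (q'q y) (qp y).
  have E : q' = q.
    by apply: (congr1 sval (minq (exist _ q' (conj sq' q'p)) _)); apply/asboolP.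
  (* The term t = 1 of the infimum gives q x <= q (x + a) - q a, the missing half of additivity. *)
  have := q'_le x 1 ler01; rewrite E rmorph1 scale1r mul1r => h.
  by apply/eqP; rewrite eq_le qD; lra.
exists q; split => // r x.
have opp y : q (- y) = - q y.
  by have := add y (- y); rewrite subrr sublinear0//; lra.
have [r0|r0|->] := ltrgtP r 0.
- rewrite -[r]opprK rmorphN scaleNr opp sublinearZ ?oppr_gt0//.
  by rewrite !mulNr.
- exact: sublinearZ.
- by rewrite rmorph0 scale0r mul0r sublinear0.
Qed.

End HahnBanach.

(** * Existence of states *)

Section Cpos.
Context (R : realType) (A : cstarAlg R).
Local Notation B := (unitization A).
Let HN := unorm_cstar A.

Definition emb (a : A) : B := (a, 0).
Definition upos (x : B) := csn_pos (@ustar R A) (@unorm R A) x.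
Definition cpos (a : A) := upos (emb a).

Lemma embD a b : emb (a + b) = emb a + emb b.
Proof. by rewrite /emb uaddE/= addr0. Qed.
Lemma embN a : emb (- a) = - emb a.
Proof. by rewrite -[RHS]/(- a, - 0) oppr0. Qed.
Lemma embB a b : emb (a - b) = emb a - emb b.
Proof. by rewrite embD embN. Qed.
Lemma embM a b : emb (amul a b) = emb a * emb b.
Proof. by rewrite umulE /umul/= mulr0 !scale0r !addr0. Qed.
Lemma emb_star a : emb (astar a) = ustar (emb a).
Proof. by rewrite /emb /ustar/= conjC0. Qed.
Lemma embZ r a : emb (toC r *: a) = r *: emb a.
Proof. by rewrite uscaleE /uscale/= mulr0. Qed.
Lemma emb0 : emb 0 = 0. Proof. by []. Qed.
Lemma mul_emb x a : x * emb a = emb (uact x a).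
Proof. by rewrite umulE /umul/= mulr0 scale0r addr0. Qed.
Lemma unormE a : unorm (emb a) = rnorm a. Proof. exact: unorm_emb. Qed.

Lemma amulNr (a b : A) : amul a (- b) = - amul a b.
Proof. by rewrite -scaleN1r amulZr scaleN1r. Qed.
Lemma amulNl (a b : A) : amul (- a) b = - amul a b.
Proof. by rewrite -scaleN1r amulZl scaleN1r. Qed.
Lemma uactN (x : B) a : uact (- x) a = - uact x a.
Proof. by rewrite /uact/= amulNl scaleNr opprD. Qed.

Lemma cpos_mul_star a : cpos (amul (astar a) a).
Proof. by rewrite /cpos embM emb_star; exact: (csn_pos_mul_star HN). Qed.
Lemma cpos_apos a : apos a -> cpos a.
Proof. by move=> [b ->]; exact: cpos_mul_star. Qed.
Lemma cposD a b : cpos a -> cpos b -> cpos (a + b).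
Proof. by move=> pa pb; rewrite /cpos embD; exact: (csn_posD HN). Qed.
Lemma cposZ r a : 0 <= r -> cpos a -> cpos (toC r *: a).
Proof. by move=> r0 pa; rewrite /cpos embZ; exact: (csn_posZ HN). Qed.
Lemma cpos_sa a : cpos a -> astar a = a.
Proof. by move=> [+ _]; rewrite /csn_sa -emb_star => -[]. Qed.

(** A nonzero element is needed: over A = 0 the unit acts as 0. *)
Lemma unit_norm1 (a : A) : 0 < rnorm a -> unorm (1 : B) = 1.
Proof.
move=> a0; apply/eqP; rewrite eq_le (csn_1 HN) /=.
have := csn_M HN (emb a) 1; rewrite mulr1 unormE.
by rewrite -{1}[rnorm a]mulr1 ler_pM2l.
Qed.

Lemma rnorm_sup_has_sup (f : A -> R[i]) : (forall a, rnorm (f a) <= rnorm a) ->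
  has_sup ((fun a : A => rnorm (f a)) @` [set a : A | rnorm a <= 1]).
Proof.
move=> H; split; first by exists (rnorm (f 0)), 0 => //=; rewrite rnorm0.
by exists 1 => _ [a /= a1 <-]; apply: le_trans a1.
Qed.

(** M is the norm of [f]. Because M <= 1, the normalization can only raise a positive lower bound
    for the values. *)
Lemma state_of_positive (f : A -> R[i]) (b : A) :
  (forall x y, f (x + y) = f x + f y) -> (forall k x, f (k *: x) = k * f x) ->
  (forall a, 0 <= f (amul (astar a) a)) -> (forall a, rnorm (f a) <= rnorm a) ->
  0 < rnorm (f b) ->
  exists2 M : R, 0 < M <= 1 & state (fun a => toC M^-1 * f a).
Proof.
move=> fD fZ fpos fle fb.
have hs := rnorm_sup_has_sup fle.
pose M := sup ((fun a : A => rnorm (f a)) @` [set a : A | rnorm a <= 1]).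
have M1 : M <= 1.
  by apply: ge_sup; [case: hs|move=> _ [a /= a1 <-]; exact: le_trans (fle a) a1].
have leM a : rnorm (f a) <= M * rnorm a.
  have [a0|a0] := eqVneq (rnorm a) 0; first by rewrite a0 mulr0 -a0.
  have {}a0 : 0 < rnorm a by rewrite lt_neqAle eq_sym a0 rnorm_ge0.
  rewrite -ler_pdivrMr//.
  have -> : rnorm (f a) / rnorm a = rnorm (f (toC (rnorm a)^-1 *: a)).
    by rewrite fZ rnormM rnormC ger0_norm ?invr_ge0 ?(ltW a0)// mulrC.
  apply: ub_le_sup; first by case: hs.
  exists (toC (rnorm a)^-1 *: a) => //=.
  by rewrite rnormZ rnormC ger0_norm ?invr_ge0 ?(ltW a0)// mulVf ?gt_eqF.
have M0 : 0 < M.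
  have := lt_le_trans fb (leM b); rewrite ltNge => /negP H.
  rewrite ltNge; apply/negP => H'; apply: H.
  by rewrite mulr_le0_ge0// rnorm_ge0.
exists M; first by rewrite M0.
split.
- by move=> x y; rewrite fD mulrDr.
- by move=> k x; rewrite fZ mulrCA.
- by move=> a; rewrite mulr_ge0// ler0c invr_ge0 ltW.
- move=> a; rewrite !rnormE lecR rnormM rnormC ger0_norm ?invr_ge0 ?(ltW M0)//.
  by rewrite ler_pdivrMl.
- move=> m m0 H.
  have mE : m = toC (rnorm m) by rewrite -rnormE ger0_norm.
  rewrite mE -(rmorph1 (real_complex R)) lecR.
  have m0' := rnorm_ge0 m.
  have : M <= M * rnorm m.
    apply: ge_sup; first by case: hs.
    move=> _ [a /= a1 <-].
    have := H a; rewrite !rnormE mE -rmorphM lecR rnormM [rnorm (toC _)]rnormC.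
    rewrite ger0_norm ?invr_ge0 ?(ltW M0)// ler_pdivrMl// => /le_trans; apply.
    by rewrite ler_wpM2l ?(ltW M0)// rnormC ger0_norm// ler_piMr.
  by rewrite -ler_pdivrMl// mulVf ?gt_eqF.
Qed.

(** One sublinear functional encodes both the order and the lower bound on F, so that positivity of
    w and the bound come out of a single domination. The defect of convexity is absorbed by the
    positivity in its definition. *)
Lemma exists_state (F : set A) (d : R) (b0 : A) : 0 < d -> F b0 ->
  (forall b, F b -> cpos b) -> (forall b, F b -> d <= rnorm b) ->
  (forall b1 b2 s t, F b1 -> F b2 -> 0 <= s -> 0 <= t -> exists2 b3, F b3 &
     cpos (toC s *: b1 + toC t *: b2 - toC (s + t) *: b3)) ->
  exists2 w : A -> R[i], state w & forall b, F b -> d <= complex.Re (w b).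
Proof.
move=> d0 Fb0 Fpos Fd Fconv.
have N1 : unorm (1 : B) = 1 by apply: (@unit_norm1 b0); apply: lt_le_trans (Fd _ Fb0).
pose re (a : A) := toC 2^-1 *: (a + astar a).
have reD a b : re (a + b) = re a + re b.
  by rewrite /re astarD -scalerDr; congr (_ *: _); zmod.
have reZ r a : re (toC r *: a) = toC r *: re a.
  by rewrite /re astarZ conjC_toC -scalerDr !scalerA mulrC.
have re_sa a : astar a = a -> re a = a by move=> sa; rewrite /re sa scale_half_dbl.
have re_star a : astar (re a) = re a.
  by rewrite /re astarZ conjC_toC astarD astarK addrC.
have re_norm a : rnorm (re a) <= rnorm a.
  rewrite /re rnormZ rnormC ger0_norm ?invr_ge0// ler_pdivrMl//.
  by apply: (le_trans (rnormD _ _)); rewrite rnorm_astar; lra.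
(* p is the infimum of t - l d over Re a + l b <= t with l >= 0 and b in F, so
   that p (- b) <= - d on F and p <= 0 on negative elements. *)
pose C (a : A) (r : R) := exists t l b, [/\ 0 <= l, F b,
  upos (t%:A - emb (re a) - l *: emb b) & r = t - l * d].
(* From Re a + l b <= t and Re a >= -|a| follows 0 <= l b <= t + |a|. Monotonicity of the norm on
   positive elements then gives l d <= l |b| <= t + |a|; this is how the lower bound on the norms of
   F enters. *)
have C_ge a r : C a r -> - rnorm a <= r.
  move=> [t [l [b [l0 Fb P ->]]]].
  have Pb := Fpos _ Fb.
  have Plb : upos (l *: emb b) by apply: (csn_posZ HN).
  have Pa : upos ((rnorm a)%:A + emb (re a)).
    split.
      by apply: (csn_saD HN); [exact: (csn_saA HN)|rewrite /csn_sa -emb_star re_star].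
    exists (rnorm a); first exact: rnorm_ge0.
    have -> : (rnorm a)%:A - ((rnorm a)%:A + emb (re a)) = emb (- re a).
      by rewrite embN; zmod.
    by rewrite unormE rnormN.
  pose t' := t + rnorm a.
  have P' : upos (t'%:A - l *: emb b).
    have -> : t'%:A - l *: emb b = (t%:A - emb (re a) - l *: emb b) + ((rnorm a)%:A + emb (re a)).
      by rewrite scalerDl; zmod.
    exact: (csn_posD HN).
  (* [t'%:A] is a sum of positive elements; as the unit has norm 1, some s satisfies |s - t'| <= s,
     which forces t' >= 0. *)
  have t'0 : 0 <= t'.
    have : upos t'%:A by rewrite -(subrK (l *: emb b) t'%:A); exact: (csn_posD HN).
    move=> [_ [s s0]]; rewrite -scalerBl (csn_Z HN) N1 mulr1.
    by have := ler_norm (s - t'); lra.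
  have := csn_pos_norm_le HN Plb P' t'0.
  rewrite (csn_Z HN) ger0_norm// unormE => H.
  have : l * d <= l * rnorm b by rewrite ler_wpM2l// Fd.
  by rewrite /t' in H *; lra.
have C_norm a : C a (rnorm a).
  exists (rnorm a), 0, b0; split => //; last by rewrite mul0r subr0.
  rewrite scale0r subr0; split.
    by apply: (csn_saB HN); [exact: (csn_saA HN)|rewrite /csn_sa -emb_star re_star].
  exists (rnorm a); first exact: rnorm_ge0.
  by have -> : (rnorm a)%:A - ((rnorm a)%:A - emb (re a)) = emb (re a);
     [zmod|rewrite unormE].
have CD a b r s : C a r -> C b s -> C (a + b) (r + s).
  move=> [t [l [x [l0 Fx P ->]]]] [t' [l' [x' [l'0 Fx' P' ->]]]].
  have [x3 Fx3 P3] := Fconv _ _ _ _ Fx Fx' l0 l'0.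
  exists (t + t'), (l + l'), x3; split; rewrite ?addr_ge0//; last by ring.
  rewrite /cpos embB embD !embZ in P3.
  have -> : (t + t')%:A - emb (re (a + b)) - (l + l') *: emb x3 =
     (t%:A - emb (re a) - l *: emb x) + (t'%:A - emb (re b) - l' *: emb x') +
     (l *: emb x + l' *: emb x' - (l + l') *: emb x3).
    by rewrite reD embD scalerDl; zmod.
  by apply: (csn_posD HN) => //; exact: (csn_posD HN).
have CZ a r s : 0 < s -> C a r -> C (toC s *: a) (s * r).
  move=> s0 [t [l [x [l0 Fx P ->]]]].
  exists (s * t), (s * l), x; split; rewrite ?mulr_ge0 ?(ltW s0)//; last by ring.
  have -> : (s * t)%:A - emb (re (toC s *: a)) - (s * l) *: emb x =
    s *: (t%:A - emb (re a) - l *: emb x) by rewrite reZ embZ !scalerBr !scalerA.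
  by apply: (csn_posZ HN); rewrite ?ltW.
have hasC a : has_inf (C a).
  split; first by exists (rnorm a).
  by exists (- rnorm a) => r /C_ge.
pose p a := inf (C a).
have p_le a r : C a r -> p a <= r by move=> Cr; apply: ge_inf => //; case: (hasC a).
have p_ge a c : (forall r, C a r -> c <= r) -> c <= p a.
  by move=> H; apply: lb_le_inf => //; case: (hasC a).
have sp : sublinear p.
  split=> [x y|r x r0].
    rewrite -lerBlDr; apply: (p_ge) => s Cs; rewrite lerBlDr -lerBlDl.
    by apply: (p_ge) => t Ct; rewrite lerBlDl; apply: (p_le); exact: CD.
  rewrite -ler_pdivrMl//; apply: (p_ge) => s Cs; rewrite ler_pdivrMl//.
  by apply: (p_le); exact: CZ.
have [f [fD fZ fp]] := sublinear_dominates_linear sp.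
have fN a : f (- a) = - f a by rewrite -scaleN1r -(rmorph1 (real_complex R)) -rmorphN fZ mulN1r.
have f_norm a : f a <= rnorm a by apply: le_trans (fp a) _; exact: p_le.
(* p depends only on the self-adjoint part, so f vanishes on skew-adjoint elements; this makes w0
   real on the elements a^* a. *)
have f_re0 a : re a = 0 -> f a = 0.
  have le x : re x = 0 -> f x <= 0.
    move=> x0; apply: le_trans (fp x) _; apply: p_le.
    exists 0, 0, b0; split => //; last by rewrite mul0r subr0.
    by rewrite x0 emb0 !scale0r !subr0; exact: (csn_pos0 HN).
  move=> a0; apply/eqP; rewrite eq_le le//=.
  have := le (- a); rewrite fN oppr_le0; apply.
  by rewrite -scaleN1r -(rmorph1 (real_complex R)) -rmorphN reZ a0 scaler0.
have f_pos a : 0 <= f (amul (astar a) a).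
  rewrite -oppr_le0 -fN; apply: le_trans (fp _) _; apply: p_le.
  exists 0, 0, b0; split => //; last by rewrite mul0r subr0.
  rewrite !scale0r subr0 sub0r re_sa.
    by rewrite embN opprK -/(cpos _); exact: cpos_mul_star.
  by rewrite -scaleN1r astarZ rmorphN rmorph1 astarM astarK.
have f_F b : F b -> d <= f b.
  move=> Fb; rewrite -lerN2 -fN; apply: le_trans (fp _) _; apply: p_le.
  exists 0, 1, b; split => //; last by rewrite mul1r sub0r.
  rewrite scale0r sub0r scale1r re_sa.
    by rewrite embN opprK subrr; exact: (csn_pos0 HN).
  by rewrite -scaleN1r astarZ rmorphN rmorph1 (cpos_sa (Fpos _ Fb)).
pose w0 (a : A) : R[i] := Complex (f a) (- f ('i%R *: a)).
have w0D x y : w0 (x + y) = w0 x + w0 y.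
  by rewrite /w0 scalerDr !fD opprD.
have w0Z k x : w0 (k *: x) = k * w0 x.
  case: k => u v.
  have E : Complex u v = toC u + 'i%R * toC v by rewrite [LHS]complexE/= complexiE.
  have E1 : Complex u v *: x = toC u *: x + toC v *: ('i%R *: x).
    by rewrite E scalerDl scalerA [toC v * _]mulrC.
  have E2 : 'i%R *: (Complex u v *: x) = toC u *: ('i%R *: x) - toC v *: x.
    rewrite E1 scalerDr !scalerA.
    have -> : 'i%R * toC v * 'i%R = - toC v by rewrite mulrAC -expr2 sqrCi mulN1r.
    by rewrite scaleNr ['i%R * _]mulrC.
  rewrite /w0 E2 E1 !fD fN !fZ.
  by apply/eqP; rewrite eq_complex/=; apply/andP; split; apply/eqP; ring.
have w0pos a : 0 <= w0 (amul (astar a) a).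
  rewrite lecE/= f_pos andbT; apply/eqP.
  rewrite f_re0 ?oppr0// /re astarZ conjCi astarM astarK scaleNr subrr scaler0//.
have w0le a : rnorm (w0 a) <= rnorm a.
  have [->|z0] := eqVneq (rnorm (w0 a)) 0; first exact: rnorm_ge0.
  pose k := (w0 a)^*%R / toC (rnorm (w0 a)).
  have k1 : rnorm k = 1.
    by rewrite rnormM -fmorphV rnormC rnorm_conj ger0_norm ?invr_ge0 ?rnorm_ge0// mulfV.
  have : complex.Re (w0 (k *: a)) <= rnorm (k *: a) by exact: f_norm.
  rewrite rnormZ k1 mul1r w0Z mulrAC [_ * w0 a]mulrC -normCK rnormE expr2 -mulrA.
  by rewrite -fmorphV -rmorphM mulfV// mulr1.
have w0b : 0 < rnorm (w0 b0).
  have := le_trans (ler_norm _) (Re_le_rnorm (w0 b0)); apply: lt_le_trans.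
  exact: lt_le_trans (f_F _ Fb0).
have [M /andP[M0 M1] sM] := state_of_positive w0D w0Z w0pos w0le w0b.
exists (fun a => toC M^-1 * w0 a) => // b Fb.
have -> : complex.Re (toC M^-1 * w0 b) = M^-1 * f b by rewrite /w0/= mul0r subr0.
rewrite ler_pdivlMl//; apply: le_trans (f_F _ Fb).
by rewrite ler_piMl// ltW.
Qed.

(** * Positivity of states *)

Lemma ge0_of_approx (z : R[i]) :
  (forall e : R, 0 < e -> exists2 p : R[i], 0 <= p & rnorm (z - p) <= e) -> 0 <= z.
Proof.
move=> H; rewrite lecE/=; apply/andP; split.
  rewrite -normr_le0; apply/ler_addgt0Pr => e e0; rewrite add0r.
  have [p p0 hp] := H e e0.
  have := Im_le_rnorm (z - p); rewrite raddfB/= (ger0_Im p0) subr0 => /le_trans; apply.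
  exact: hp.
apply/ler_addgt0Pr => e e0; have [p p0 hp] := H e e0.
have := Re_le_rnorm (z - p); rewrite raddfB/= ler_norml => /andP[h _].
move: p0; rewrite lecE/= => /andP[_ p0].
by lra.
Qed.

Section State.
Context (w : A -> R[i]) (sw : state w).

Lemma stateD x y : w (x + y) = w x + w y. Proof. by case: sw. Qed.
Lemma stateZ k x : w (k *: x) = k * w x. Proof. by case: sw. Qed.
Lemma state_pos a : 0 <= w (amul (astar a) a). Proof. by case: sw. Qed.
Lemma state_le a : rnorm (w a) <= rnorm a.
Proof. by case: sw => _ _ _ h _; have := h a; rewrite !rnormE lecR. Qed.
Lemma stateN x : w (- x) = - w x.
Proof. by rewrite -scaleN1r stateZ mulN1r. Qed.
Lemma stateB x y : w (x - y) = w x - w y.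
Proof. by rewrite stateD stateN. Qed.

(** The approximate root v of x lies in the unitization, but v b lies in A, so w need not be
    extended to the unit. *)
Lemma state_conj_ge0 x b : upos x -> 0 <= w (amul (astar b) (uact x b)).
Proof.
move=> px; apply: ge0_of_approx => e e0.
have b0 : 0 < rnorm b ^+ 2 + 1 by rewrite ltr_wpDl ?exprn_ge0 ?rnorm_ge0.
have [v [sv _ Hv]] := csn_pos_sqrt HN px (divr_gt0 e0 b0).
exists (w (amul (astar (uact v b)) (uact v b))); first exact: state_pos.
rewrite -stateB; apply: (le_trans (state_le _)).
rewrite uact_star sv -uact_mul.
have -> : amul (astar b) (uact x b) - amul (astar b) (uact (v * v) b) =
          amul (astar b) (uact (x - v ^+ 2) b).
  rewrite uactD amulDr; congr (_ + _).
  by rewrite uactN amulNr expr2.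
apply: (le_trans (rnorm_amul _ _)); rewrite rnorm_astar.
apply: (@le_trans _ _ (rnorm b * (e / (rnorm b ^+ 2 + 1) * rnorm b))).
  rewrite ler_wpM2l ?rnorm_ge0//; apply: (le_trans (uact_le _ _)).
  by rewrite ler_wpM2r ?rnorm_ge0.
rewrite mulrCA -expr2 -mulrA ler_piMr ?(ltW e0)//.
by rewrite ler_pdivrMl// mulr1 lerDl.
Qed.

(** The upper bound comes from the positivity of |a| - a in the unitization; it makes the GNS
    operators and the tensor maps bounded. *)
Lemma state_conj_le a b : cpos a ->
  0 <= w (amul (astar b) (amul a b)) <= toC (rnorm a) * w (amul (astar b) b).
Proof.
move=> pa; apply/andP; split.
  by have := state_conj_ge0 b pa; rewrite /uact/= scale0r addr0.
have P : upos ((rnorm a)%:A - emb a).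
  split.
    by apply: (csn_saB HN); [exact: (csn_saA HN)|case: pa].
  exists (rnorm a); first exact: rnorm_ge0.
  have -> : (rnorm a)%:A - ((rnorm a)%:A - emb a) = emb a by zmod.
  by rewrite unormE.
have := state_conj_ge0 b P.
rewrite uactD uactZl.
have -> : uact (1 : B) b = b by rewrite /uact/= amul0l add0r scale1r.
rewrite uactN /uact/= scale0r addr0 amulDr amulNr amulZr.
by rewrite stateB stateZ subr_ge0.
Qed.

End State.
End Cpos.

(** * Hilbert modules *)

Section Module.
Context (R : realType) (A : cstarAlg R) (E : hilbertMod A).
Implicit Types (x y z : E) (a b : A).
Let HN := unorm_cstar A.

Lemma astarN a : astar (- a) = - astar a.
Proof. by rewrite -scaleN1r astarZ rmorphN rmorph1 scaleN1r. Qed.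
Lemma innerDl x y z : inner (x + y) z = inner x z + inner y z.
Proof. by rewrite -[LHS]inner_star innerDr astarD !inner_star. Qed.
Lemma innerZl k x y : inner (k *: x) y = k^*%R *: inner x y.
Proof. by rewrite -[LHS]inner_star innerZr astarZ inner_star. Qed.
Lemma innerNr x y : inner x (- y) = - inner x y.
Proof. by rewrite -scaleN1r innerZr scaleN1r. Qed.
Lemma innerNl x y : inner (- x) y = - inner x y.
Proof. by rewrite -[LHS]inner_star innerNr astarN inner_star. Qed.
Lemma innerBr x y z : inner x (y - z) = inner x y - inner x z.
Proof. by rewrite innerDr innerNr. Qed.
Lemma innerBl x y z : inner (x - y) z = inner x z - inner y z.
Proof. by rewrite innerDl innerNl. Qed.
Lemma inner_actl x y a : inner (act x a) y = amul (astar a) (inner x y).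
Proof. by rewrite -[LHS]inner_star inner_act astarM inner_star. Qed.
Lemma rnorm_inner x : rnorm x ^+ 2 = rnorm (inner x x).
Proof.
by apply: complexI; rewrite rmorphXn/= -!rnormE norm_inner sqrtCK.
Qed.

Lemma inner_cpos x : cpos (inner x x).
Proof. exact/cpos_apos/inner_pos. Qed.

Lemma cpos_norm_mono a b : cpos a -> cpos b -> rnorm a <= rnorm (a + b).
Proof.
move=> pa pb; rewrite -!unormE; apply: (csn_pos_norm_mono HN) => //.
by rewrite embD; have -> : emb a + emb b - emb a = emb b by zmod.
Qed.

(** For z in S orthogonality gives <x - z, x - z> = <x, x> + <z, z> >= <x, x>, so |x| <= |x - z|,
    which can be made small. *)
Lemma ortho_dense_eq0 (S : set E) x :
  (forall y (e : R), 0 < e -> exists2 z, S z & rnorm (y - z) < e) ->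
  (forall z, S z -> inner x z = 0) -> x = 0.
Proof.
move=> dS xS; apply: rnorm_eq0; apply/eqP; rewrite eq_le rnorm_ge0 andbT.
apply/ler_addgt0Pr => e e0; rewrite add0r.
have [z Sz xz] := dS x e e0; apply: le_trans (ltW xz).
rewrite -(ler_pXn2r (n := 2)) ?nnegrE ?rnorm_ge0// !rnorm_inner.
have xz0 := xS _ Sz.
have zx0 : inner z x = 0 by rewrite -inner_star xz0 astar0.
rewrite innerBl !innerBr xz0 zx0 subr0 sub0r opprK.
exact: cpos_norm_mono (inner_cpos x) (inner_cpos z).
Qed.

Lemma inner_convex x y (s t : R) : 0 <= s -> 0 <= t -> s + t = 1 ->
  toC s *: inner x x + toC t *: inner y y
   - inner (toC s *: x + toC t *: y) (toC s *: x + toC t *: y)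
  = toC (s * t) *: inner (x - y) (x - y).
Proof.
move=> s0 t0 st.
rewrite !(innerDl, innerDr, innerNl, innerNr, innerZl, innerZr) !conjC_toC.
rewrite !scalerDr !scalerN !scalerA -!rmorphM/=.
have E1 : toC s = toC (s * s) + toC (s * t) by rewrite -rmorphD -mulrDr st mulr1.
have E2 : toC t = toC (t * t) + toC (s * t).
  by rewrite -rmorphD -mulrDl [t + s]addrC st mul1r.
rewrite {1}E1 {1}E2 !scalerDl [t * s]mulrC; zmod.
Qed.

(** With h = <x, x> + <y, y> and u = h / s take 1 - b = (1 - u)^n: the constant term cancels, so b
    lies in A. Both |x - x b|^2 and |y - y b|^2 are at most |(1 - b) h (1 - b)| = s |u (1 - u)^(2n)|
    <= s / (2n + 1) by [csn_decay]. *)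
Lemma act_approx x y (e : R) : 0 < e ->
  exists b, rnorm (x - act x b) < e /\ rnorm (y - act y b) < e.
Proof.
move=> e0; pose h := inner x x + inner y y.
have ph : cpos h by apply: cposD; exact: inner_cpos.
pose s := rnorm h + 1; have s0 : 0 < s by rewrite ltr_wpDl// rnorm_ge0.
pose u : unitization A := s^-1 *: emb h.
have pu : upos u by apply: (csn_posZ HN) => //; rewrite invr_ge0 ltW.
have Nu : unorm u <= 1.
  rewrite (csn_Z HN) unormE gtr0_norm ?invr_gt0// ler_pdivrMl// mulr1.
  by rewrite /s lerDl.
have px : upos (1 - u).
  split; first by apply: (csn_saB HN); [exact: (csn_sa1 HN)|case: pu].
  by exists 1 => //; rewrite scale1r; have -> : 1 - (1 - u) = u by zmod.
have powE n : exists b, (1 - u) ^+ n = 1 - emb b.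
  elim: n => [|n [b Hb]]; first by exists 0; rewrite emb0 subr0.
  exists (toC s^-1 *: h + b - uact u b).
  rewrite exprS Hb mulrBr mulr1 mulrBl mul1r mul_emb embB [emb (_ + b)]embD embZ; zmod.
pose n := Num.bound (s / e ^+ 2).
have e2 : 0 < e ^+ 2 by rewrite exprn_gt0.
have nE : s / (n + n).+1%:R < e ^+ 2.
  rewrite ltr_pdivrMr// mulrC -ltr_pdivrMr//.
  have : s / e ^+ 2 < n%:R by rewrite archi_boundP// divr_ge0 ?ltW.
  by move=> /lt_le_trans; apply; rewrite ler_nat -addnS leq_addr.
have [b Hb] := powE n; exists b.
have comm : GRing.comm u ((1 - u) ^+ n).
  by apply: commrX; apply: commrB; [exact: commr1|].
have bound p : cpos p -> upos (emb h - emb p) ->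
    unorm (ustar (1 - emb b) * emb p * (1 - emb b)) < e ^+ 2.
  move=> pp hp; apply: le_lt_trans nE.
  have sx : ustar (1 - emb b) = 1 - emb b by rewrite -Hb; exact: (csn_saX HN n (csn_pos_sa px)).
  apply: (@le_trans _ _ (unorm (ustar (1 - emb b) * emb h * (1 - emb b)))).
    apply: (csn_pos_norm_mono HN); first exact: (csn_pos_conj HN).
    by rewrite -mulrBl -mulrBr; exact: (csn_pos_conj HN).
  rewrite sx -Hb.
  have -> : emb h = s *: u by rewrite /u scalerA divff ?gt_eqF// scale1r.
  rewrite -scalerAr -scalerAl -comm -mulrA -exprD (csn_Z HN) gtr0_norm//.
  by rewrite ler_pM2l// (csn_decay HN).
have fin z : upos (emb h - emb (inner z z)) -> rnorm (z - act z b) < e.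
  move=> hz.
  rewrite -(ltr_pXn2r (n := 2)) ?nnegrE ?rnorm_ge0 ?(ltW e0)// rnorm_inner.
  apply: le_lt_trans (bound _ (inner_cpos z) hz).
  rewrite -unormE le_eqVlt; apply/orP; left; apply/eqP; congr unorm.
  rewrite innerBl !innerBr !inner_act !inner_actl.
  rewrite (csn_starB HN) (csn_star1 HN) -emb_star mulrBl mul1r mulrBr mulr1 mulrBl.
  by rewrite -!embM -!embB; congr emb; zmod.
by split; apply: fin; rewrite /h embD;
  [have -> : emb (inner x x) + emb (inner y y) - emb (inner x x) = emb (inner y y)
     by zmod
  |have -> : emb (inner x x) + emb (inner y y) - emb (inner y y) = emb (inner x x)
     by zmod]; exact: inner_cpos.
Qed.

End Module.

(** * Sequences *)

Lemma complete_seq_cvg (K : numFieldType) (W : completeNormedModType K) (u : nat -> W) :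
  (forall e : K, 0 < e -> exists N, forall m n, (N <= m)%N -> (N <= n)%N ->
     `|u m - u n| < e) ->
  exists l, forall e : K, 0 < e -> exists N, forall n, (N <= n)%N -> `|l - u n| < e.
Proof.
move=> H.
have : cvg (u @ \oo).
  apply: cauchy_cvg; apply: cauchy_exP => e e0.
  have [N HN] := H e e0; exists (u N); exists N => // n /= Nn.
  by rewrite -ball_normE/=; exact: HN.
move=> /cvgrPdist_lt cu; exists (lim (u @ \oo)) => e e0.
by have [N _ HN] := cu e e0; exists N => n Nn; exact: HN.
Qed.

Section Sequences.
Context (R : realType).

Definition slim (V : normedZmodType R[i]) (u : nat -> V) (l : V) :=
  forall e : R, 0 < e -> exists N, forall n, (N <= n)%N -> rnorm (u n - l) < e.

Definition scauchy (V : normedZmodType R[i]) (u : nat -> V) :=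
  forall e : R, 0 < e -> exists N, forall m n, (N <= m)%N -> (N <= n)%N ->
    rnorm (u m - u n) < e.

Lemma slim_uniq (V : normedZmodType R[i]) (u : nat -> V) l m :
  slim u l -> slim u m -> l = m.
Proof.
move=> ul um; apply/eqP; rewrite -subr_eq0; apply/eqP; apply: rnorm_eq0.
apply/eqP; rewrite eq_le rnorm_ge0 andbT; apply/ler_addgt0Pr => e e0; rewrite add0r.
have e2 : 0 < e / 2 by lra.
have [N1 H1] := ul _ e2; have [N2 H2] := um _ e2.
have := H1 _ (leq_maxl N1 N2); have := H2 _ (leq_maxr N1 N2).
set n := maxn N1 N2 => h2 h1.
have -> : l - m = (u n - m) - (u n - l) by zmod.
by have := rnormB (u n - m) (u n - l); lra.
Qed.

Lemma slim_cst (V : normedZmodType R[i]) (l : V) : slim (fun=> l) l.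
Proof. by move=> e e0; exists 0%N => n _; rewrite subrr rnorm0. Qed.

Lemma slimD (V : normedZmodType R[i]) (u v : nat -> V) l m :
  slim u l -> slim v m -> slim (fun n => u n + v n) (l + m).
Proof.
move=> ul vm e e0; have e2 : 0 < e / 2 by lra.
have [N1 H1] := ul _ e2; have [N2 H2] := vm _ e2.
exists (maxn N1 N2) => n; rewrite geq_max => /andP[n1 n2].
have -> : u n + v n - (l + m) = (u n - l) + (v n - m) by zmod.
by have := rnormD (u n - l) (v n - m); have := H1 n n1; have := H2 n n2; lra.
Qed.

Lemma slimM (u : nat -> R[i]) l (k : R[i]) : slim u l -> slim (fun n => k * u n) (k * l).
Proof.
move=> ul e e0.
have k0 : 0 < rnorm k + 1 by rewrite ltr_wpDl// rnorm_ge0.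
have [N HN] := ul _ (divr_gt0 e0 k0); exists N => n Nn.
rewrite -mulrBr rnormM.
apply: (@le_lt_trans _ _ ((rnorm k + 1) * rnorm (u n - l))).
  by rewrite ler_wpM2r ?rnorm_ge0// lerDl.
by rewrite mulrC -ltr_pdivlMr//; exact: HN.
Qed.

Lemma slim_conj (u : nat -> R[i]) l : slim u l -> slim (fun n => (u n)^*%R) (l^*%R).
Proof.
move=> ul e e0; have [N HN] := ul e e0; exists N => n Nn.
by rewrite -rmorphB rnorm_conj; exact: HN.
Qed.

Lemma slim_ge0 (u : nat -> R[i]) l : slim u l -> (forall n, 0 <= u n) -> 0 <= l.
Proof.
move=> ul u0; apply: ge0_of_approx => e e0.
have [N HN] := ul e e0; exists (u N) => //; rewrite rnorm_BC; apply: ltW; exact: HN.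
Qed.

Lemma slim_le (u : nat -> R[i]) l (M : R) : slim u l ->
  (exists N, forall n, (N <= n)%N -> rnorm (u n) <= M) -> rnorm l <= M.
Proof.
move=> ul [N1 H1]; apply/ler_addgt0Pr => e e0; have [N2 H2] := ul e e0.
have := H1 _ (leq_maxl N1 N2); have := H2 _ (leq_maxr N1 N2).
set n := maxn N1 N2; have -> : l = u n - (u n - l) by zmod.
rewrite [u n - (u n - (u n - l))](_ : _ = u n - l); last by zmod.
by have := rnormB (u n) (u n - l); lra.
Qed.

Lemma rnorm_le_ReIm (x : R[i]) : rnorm x <= `|complex.Re x| + `|complex.Im x|.
Proof.
case: x => a b /=.
have -> : Complex a b = toC a + 'i%R * toC b by rewrite [LHS]complexE/= complexiE.
by rewrite (le_trans (rnormD _ _))// rnormM rnorm_i mul1r !rnormC.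
Qed.

Lemma scauchy_complex (u : nat -> R[i]) : scauchy u -> exists l, slim u l.
Proof.
move=> cu.
have part (f : R[i] -> R) : (forall x y, f (x - y) = f x - f y) ->
    (forall x, `|f x| <= rnorm x) -> exists l : R, forall e, 0 < e ->
    exists N, forall n, (N <= n)%N -> `|l - f (u n)| < e.
  move=> fB fle; apply: (@complete_seq_cvg R R^o (fun n => f (u n))) => e e0.
  have [N HN] := cu e e0; exists N => m n Nm Nn.
  by rewrite -fB; apply: le_lt_trans (fle _) _; exact: HN.
have [a Ha] := part (@complex.Re R) (raddfB _) (@Re_le_rnorm R).
have [b Hb] := part (@complex.Im R) (raddfB _) (@Im_le_rnorm R).
exists (Complex a b) => e e0; have e2 : 0 < e / 2 by lra.
have [N1 H1] := Ha _ e2; have [N2 H2] := Hb _ e2.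
exists (maxn N1 N2) => n; rewrite geq_max => /andP[n1 n2].
rewrite rnorm_BC; apply: (le_lt_trans (rnorm_le_ReIm _)).
rewrite !raddfB/=.
by have := H1 n n1; have := H2 n n2; lra.
Qed.

Lemma scauchy_complete (W : completeNormedModType R[i]) (u : nat -> W) :
  scauchy u -> exists l, slim u l.
Proof.
move=> cu.
have [e e0|l Hl] := @complete_seq_cvg _ _ u.
  have eE : e = toC (complex.Re e) by rewrite RRe_real// gtr0_real.
  have e0' : 0 < complex.Re e by rewrite -ltcR -eE.
  have [N HN] := cu _ e0'; exists N => m n Nm Nn.
  by rewrite rnormE eE ltcR; exact: HN.
exists l => e e0; have [|N HN] := Hl (toC e); first by rewrite ltcR.
exists N => n Nn; rewrite rnorm_BC; have := HN n Nn.
by rewrite rnormE ltcR.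
Qed.

End Sequences.

(** * Semi-inner products and the Cauchy-Schwarz inequality *)

Section SemiInner.
Context (R : realType) (V : lmodType R[i]).

Record semi_inner := SemiInner {
  sip :> V -> V -> R[i];
  sipDr : forall x y z, sip x (y + z) = sip x y + sip x z;
  sipZr : forall (k : R[i]) x y, sip x (k *: y) = k * sip x y;
  sip_conj : forall x y, (sip x y)^*%R = sip y x;
  sip_pos : forall x, 0 <= sip x x
}.

Variable s : semi_inner.

Lemma sipDl x y z : s (x + y) z = s x z + s y z.
Proof. by rewrite -[LHS]sip_conj sipDr rmorphD/= !sip_conj. Qed.
Lemma sipZl k x y : s (k *: x) y = k^*%R * s x y.
Proof. by rewrite -[LHS]sip_conj sipZr rmorphM/= !sip_conj. Qed.
Lemma sipNr x y : s x (- y) = - s x y.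
Proof. by rewrite -scaleN1r sipZr mulN1r. Qed.
Lemma sipNl x y : s (- x) y = - s x y.
Proof. by rewrite -[LHS]sip_conj sipNr rmorphN/= sip_conj. Qed.
Lemma sipBr x y z : s x (y - z) = s x y - s x z.
Proof. by rewrite sipDr sipNr. Qed.
Lemma sipBl x y z : s (x - y) z = s x z - s y z.
Proof. by rewrite sipDl sipNl. Qed.
Lemma sip0r x : s x 0 = 0.
Proof. by rewrite -(scale0r 0) sipZr mul0r. Qed.

Definition semin x : R := Num.sqrt (complex.Re (s x x)).

Lemma semin_ge0 x : 0 <= semin x. Proof. exact: sqrtr_ge0. Qed.

Lemma semin_sq x : s x x = toC (semin x ^+ 2).
Proof.
have := sip_pos s x; rewrite lecE/= => /andP[_ h].
by rewrite /semin sqr_sqrtr// RRe_real// ger0_real// sip_pos.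
Qed.

Lemma sip_CS x y : rnorm (s x y) <= semin x * semin y.
Proof.
rewrite -(ler_pXn2r (n := 2)) ?nnegrE ?mulr_ge0 ?rnorm_ge0 ?semin_ge0//.
rewrite exprMn; set a := semin x ^+ 2; set b := semin y ^+ 2; set c := rnorm (s x y).
have c2 : toC (c ^+ 2) = s x y * (s x y)^*%R by rewrite rmorphXn/= -rnormE normCK.
(* The conjugate of [s x y] in the multiplier absorbs the phase and leaves a real quadratic in r. *)
have key (r : R) : 0 <= a - 2 * r * c ^+ 2 + r ^+ 2 * c ^+ 2 * b.
  have := sip_pos s (x - (toC r * (s x y)^*%R) *: y).
  rewrite sipBl !sipBr !sipZl !sipZr rmorphM/= conjCK conjC_toC !semin_sq.
  rewrite -(sip_conj s x y).
  suff -> : toC (semin x ^+ 2) - toC r * (s x y)^*%R * s x y -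
      (toC r * s x y * (s x y)^*%R
       - toC r * s x y * (toC r * (s x y)^*%R * toC (semin y ^+ 2))) =
      toC (a - 2 * r * c ^+ 2 + r ^+ 2 * c ^+ 2 * b) by rewrite ler0c.
  have -> : toC (a - 2 * r * c ^+ 2 + r ^+ 2 * c ^+ 2 * b) =
     toC a - 2 * toC r * toC (c ^+ 2) + toC r * toC r * toC (c ^+ 2) * toC b.
    by rewrite -(rmorph_nat (real_complex R) 2) -!rmorphM -rmorphB -rmorphD expr2.
  rewrite c2 -/a -/b; ring.
have b0 : 0 <= b by rewrite exprn_ge0// semin_ge0.
have c20 : 0 <= c ^+ 2 by rewrite exprn_ge0// rnorm_ge0.
have a0 : 0 <= a by rewrite exprn_ge0// semin_ge0.
have [bE|bn] := eqVneq b 0.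
  rewrite bE mulr0 leNgt; apply/negP => cp.
  (* For b = 0 the quadratic degenerates to a - 2 r c^2, and this r makes it -1. *)
  have := key ((a + 1) / (2 * c ^+ 2)); rewrite bE mulr0 addr0.
  have c0 : c != 0 by apply/eqP => c0; move: cp; rewrite c0 expr0n ltxx.
  have -> : 2 * ((a + 1) / (2 * c ^+ 2)) * c ^+ 2 = a + 1.
    by move: (c) c0 => c' c0; field.
  by lra.
have := key b^-1.
have -> : a - 2 * b^-1 * c ^+ 2 + b^-1 ^+ 2 * c ^+ 2 * b = a - c ^+ 2 / b by field.
by rewrite subr_ge0 ler_pdivrMr// lt_neqAle eq_sym bn.
Qed.

Lemma seminD x y : semin (x + y) <= semin x + semin y.
Proof.
rewrite -(ler_pXn2r (n := 2)) ?nnegrE ?addr_ge0 ?semin_ge0//.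
rewrite -lecR -semin_sq sipDl !sipDr !semin_sq -(sip_conj s x y).
have E : s x y + (s x y)^*%R = toC (2 * complex.Re (s x y)).
  by rewrite -[_^*%R]/(conjc _) addcJ rmorphM/= (rmorph_nat (real_complex R) 2).
rewrite addrA -[toC _ + _ + _]addrA E -!rmorphD lecR.
have := sip_CS x y; have := Re_le_rnorm (s x y); have := ler_norm (complex.Re (s x y)).
by rewrite sqrrD -mulr_natl; lra.
Qed.

Lemma seminZ k x : semin (k *: x) = rnorm k * semin x.
Proof.
apply/eqP; rewrite -(eqrXn2 (n := 2)) ?mulr_ge0 ?rnorm_ge0 ?semin_ge0//.
apply/eqP; apply: complexI; rewrite -semin_sq sipZl sipZr exprMn rmorphM/= -semin_sq.
by rewrite rmorphXn/= -rnormE normCK mulrA [k^*%R * k]mulrC.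
Qed.

Lemma semin0 : semin 0 = 0.
Proof. by rewrite /semin sip0r sqrtr0. Qed.

End SemiInner.

(** * Completion of a semi-inner product space *)

Section Completion.
Context (R : realType) (V : lmodType R[i]) (s : semi_inner V).

Definition sem_cauchy (v : nat -> V) := forall e : R, 0 < e -> exists N, forall m n,
  (N <= m)%N -> (N <= n)%N -> semin s (v m - v n) < e.

(* A point of the completion is a functional x |-> lim s x (v n), which makes the
   quotient by null sequences automatic. *)
Definition represents (v : nat -> V) (f : V -> R[i]^o) :=
  sem_cauchy v /\ forall x, slim (fun n => s x (v n)) (f x).

Definition representable : {pred V -> R[i]^o} :=
  [pred f | `[< exists v, represents v f >]].

Lemma represents0 : represents (fun=> 0) 0.
Proof.
split=> [e e0|x]; first by exists 0%N => m n _ _; rewrite subrr semin0.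
by rewrite (_ : (fun _ => s x 0) = (fun=> 0)); [exact: slim_cst|rewrite sip0r].
Qed.

Lemma representsD v u f g : represents v f -> represents u g ->
  represents (fun n => v n + u n) (f + g).
Proof.
move=> [cv vf] [cu ug]; split=> [e e0|x].
  have e2 : 0 < e / 2 by lra.
  have [N1 H1] := cv _ e2; have [N2 H2] := cu _ e2.
  exists (maxn N1 N2) => m n; rewrite !geq_max => /andP[m1 m2] /andP[n1 n2].
  have -> : v m + u m - (v n + u n) = (v m - v n) + (u m - u n) by zmod.
  by have := seminD s (v m - v n) (u m - u n); have := H1 m n m1 n1; have := H2 m n m2 n2; lra.
rewrite (_ : (fun n => s x (v n + u n)) = (fun n => s x (v n) + s x (u n))).
  exact: slimD.
by apply/funext => n; rewrite sipDr.
Qed.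

Lemma representsZ k v f : represents v f -> represents (fun n => k *: v n) (k *: f).
Proof.
move=> [cv vf]; split=> [e e0|x].
  have k0 : 0 < rnorm k + 1 by rewrite ltr_wpDl// rnorm_ge0.
  have [N HN] := cv _ (divr_gt0 e0 k0); exists N => m n Nm Nn.
  rewrite -scalerBr seminZ.
  apply: (@le_lt_trans _ _ ((rnorm k + 1) * semin s (v m - v n))).
    by rewrite ler_wpM2r ?semin_ge0// lerDl.
  by rewrite mulrC -ltr_pdivlMr//; exact: HN.
rewrite (_ : (fun n => s x (k *: v n)) = (fun n => k * s x (v n))).
  exact: slimM.
by apply/funext => n; rewrite sipZr.
Qed.

Lemma representable_submod : submod_closed representable.
Proof.
split; first by apply/asboolP; exists (fun=> 0); exact: represents0.
move=> k f g /asboolP[v vf] /asboolP[u ug]; apply/asboolP.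
by exists (fun n => k *: v n + u n); apply: representsD => //; exact: representsZ.
Qed.

HB.instance Definition _ := GRing.isSubmodClosed.Build R[i] (V -> R[i]^o) representable
  representable_submod.

Record completion := Completion { cfun : V -> R[i]^o; _ : cfun \in representable }.

HB.instance Definition _ := [isSub for cfun].
HB.instance Definition _ := [Choice of completion by <:].
HB.instance Definition _ := [SubChoice_isSubLmodule of completion by <:].

Lemma cfun_rep (f : completion) : exists v, represents v (cfun f).
Proof. by case: f => f /= /asboolP. Qed.

Definition crep (f : completion) : nat -> V := sval (cid (cfun_rep f)).
Lemma crepP f : represents (crep f) (cfun f). Proof. exact: (svalP (cid (cfun_rep f))). Qed.

Lemma cfun_inj f g : cfun f = cfun g -> f = g. Proof. exact: val_inj. Qed.


Definition sem_null (d : nat -> V) :=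
  forall e : R, 0 < e -> exists N, forall n, (N <= n)%N -> semin s (d n) < e.

Definition sem_bounded (v : nat -> V) :=
  exists (C : R) N, 0 < C /\ forall n, (N <= n)%N -> semin s (v n) <= C.

Lemma cauchy_bounded v : sem_cauchy v -> sem_bounded v.
Proof.
move=> cv; have [N HN] := cv 1 ltr01; exists (semin s (v N) + 1), N; split.
  by rewrite ltr_wpDl// semin_ge0.
move=> n Nn; have -> : v n = v N + (v n - v N) by zmod.
by apply: (le_trans (seminD _ _ _)); rewrite lerD2l ltW//; exact: HN.
Qed.

Lemma sip_null_l d u : sem_null d -> sem_bounded u -> slim (fun n => s (d n) (u n)) 0.
Proof.
move=> nd [C [N1 [C0 H1]]] e e0; have [N2 H2] := nd _ (divr_gt0 e0 C0).
exists (maxn N1 N2) => n; rewrite geq_max => /andP[n1 n2]; rewrite subr0.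
apply: (le_lt_trans (sip_CS _ _ _)).
apply: (@le_lt_trans _ _ (semin s (d n) * C)); first by rewrite ler_wpM2l ?semin_ge0// H1.
by rewrite -ltr_pdivlMr// H2.
Qed.

Lemma sip_null_r d u : sem_null d -> sem_bounded u -> slim (fun n => s (u n) (d n)) 0.
Proof.
move=> nd bu; rewrite -conjC0.
have := slim_conj (sip_null_l nd bu); congr slim.
by apply/funext => n; rewrite sip_conj.
Qed.

(** From |d_n|^2 <= |d_n - d_N| |d_n| + |<d_N, d_n>|, where the last term tends to 0 for fixed N.
    Hence a functional determines its Cauchy sequence up to a null sequence. *)
Lemma represents0_null d : represents d 0 -> sem_null d.
Proof.
move=> [cd d0] e e0; have e2 : 0 < e / 2 by lra.
have [N1 H1] := cd _ e2.
have e4 : 0 < e ^+ 2 / 4 by rewrite divr_gt0// exprn_gt0.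
have [N2 H2] := d0 (d N1) _ e4.
exists (maxn N1 N2) => n; rewrite geq_max => /andP[n1 n2].
have h1 := H1 n N1 n1 (leqnn _); have := H2 n n2; rewrite subr0 => h2.
have E : rnorm (s (d n) (d n)) = semin s (d n) ^+ 2.
  by rewrite semin_sq rnormC ger0_norm// exprn_ge0// semin_ge0.
have : rnorm (s (d n) (d n)) <= semin s (d n - d N1) * semin s (d n) + rnorm (s (d N1) (d n)).
  have {1}-> : s (d n) (d n) = s (d n - d N1) (d n) + s (d N1) (d n) by rewrite sipBl subrK.
  by apply: (le_trans (rnormD _ _)); rewrite lerD2r sip_CS.
rewrite E; have := semin_ge0 s (d n); move: (semin s (d n)) => x x0 h3.
have : semin s (d n - d N1) * x <= e / 2 * x by rewrite ler_wpM2r// ltW.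
move=> h4; rewrite ltNge; apply/negP => ex.
have : e * x <= x ^+ 2 by rewrite expr2 ler_wpM2r.
have : e * e <= e * x by rewrite ler_wpM2l// ltW.
by rewrite expr2 in h2 *; lra.
Qed.

Lemma represents_same v u f : represents v f -> represents u f ->
  sem_null (fun n => v n - u n).
Proof.
move=> vf uf; apply: represents0_null.
have := representsD vf (representsZ (-1) uf).
rewrite scaleN1r subrr; congr represents.
by apply/funext => n; rewrite scaleN1r.
Qed.

Lemma sip_cauchy v u : sem_cauchy v -> sem_cauchy u ->
  scauchy (fun n => s (v n) (u n)).
Proof.
move=> cv cu e e0.
have [C [N1 [C0 H1]]] := cauchy_bounded cv.
have [C' [N2 [C'0 H2]]] := cauchy_bounded cu.
have [N3 H3] := cv (e / (2 * C')) ltac:(by rewrite divr_gt0// mulr_gt0).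
have [N4 H4] := cu (e / (2 * C)) ltac:(by rewrite divr_gt0// mulr_gt0).
exists (maxn (maxn N1 N2) (maxn N3 N4)) => m n.
rewrite !geq_max => /andP[/andP[m1 m2] /andP[m3 m4]] /andP[/andP[n1 n2] /andP[n3 n4]].
have -> : s (v m) (u m) - s (v n) (u n) = s (v m - v n) (u m) + s (v n) (u m - u n).
  by rewrite sipBl sipBr; zmod.
apply: (le_lt_trans (rnormD _ _)).
have h1 : rnorm (s (v m - v n) (u m)) < e / 2.
  apply: (le_lt_trans (sip_CS _ _ _)).
  apply: (@le_lt_trans _ _ (semin s (v m - v n) * C')).
    by rewrite ler_wpM2l ?semin_ge0// H2.
  by rewrite -ltr_pdivlMr// -mulrA -invfM H3.
have h2 : rnorm (s (v n) (u m - u n)) < e / 2.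
  apply: (le_lt_trans (sip_CS _ _ _)); rewrite mulrC.
  apply: (@le_lt_trans _ _ (semin s (u m - u n) * C)).
    by rewrite ler_wpM2l ?semin_ge0// H1.
  by rewrite -ltr_pdivlMr// -mulrA -invfM H4.
lra.
Qed.

Lemma cdot_ex (f g : completion) :
  exists l, slim (fun n => s (crep f n) (crep g n)) l.
Proof.
by apply/scauchy_complex/sip_cauchy; [case: (crepP f)|case: (crepP g)].
Qed.

Definition cdot f g : R[i] := sval (cid (cdot_ex f g)).

(** Independence of the chosen sequences: the difference is a sum of products of a null and a
    bounded sequence. *)
Lemma cdotP v u f g : represents v (cfun f) -> represents u (cfun g) ->
  slim (fun n => s (v n) (u n)) (cdot f g).
Proof.
move=> vf ug.
have h1 := svalP (cid (cdot_ex f g)); rewrite -/(cdot f g) in h1.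
have n1 := represents_same vf (crepP f); have n2 := represents_same ug (crepP g).
have h2 := sip_null_l n1 (cauchy_bounded (proj1 ug)).
have h3 := sip_null_r n2 (cauchy_bounded (proj1 (crepP f))).
have := slimD (slimD h2 h3) h1; rewrite !add0r; congr slim.
by apply/funext => n; rewrite sipBl sipBr; zmod.
Qed.

Lemma cdotDr f g h : cdot f (g + h) = cdot f g + cdot f h.
Proof.
have rep : represents _ (cfun (g + h)) := representsD (crepP g) (crepP h).
apply: (slim_uniq (cdotP (crepP f) rep)).
have := slimD (cdotP (crepP f) (crepP g)) (cdotP (crepP f) (crepP h)).
by congr slim; apply/funext => n; rewrite sipDr.
Qed.

Lemma cdotZr k f g : cdot f (k *: g) = k * cdot f g.
Proof.
apply: (slim_uniq (cdotP (crepP f) (representsZ k (crepP g) : represents _ (cfun (k *: g))))).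
have := slimM k (cdotP (crepP f) (crepP g)).
by congr slim; apply/funext => n; rewrite sipZr.
Qed.

Lemma cdot_conj f g : (cdot f g)^*%R = cdot g f.
Proof.
apply: (slim_uniq (slim_conj (cdotP (crepP f) (crepP g)))).
have := cdotP (crepP g) (crepP f).
by congr slim; apply/funext => n; rewrite sip_conj.
Qed.

Lemma cdot_ge0 f : 0 <= cdot f f.
Proof.
by apply: (slim_ge0 (cdotP (crepP f) (crepP f))) => n; exact: sip_pos.
Qed.

Definition csi : semi_inner completion := SemiInner cdotDr cdotZr cdot_conj cdot_ge0.

Lemma csi_eq0 f : semin csi f = 0 -> f = 0.
Proof.
move=> f0.
have nf : sem_null (crep f).
  move=> e e0; have e2 : 0 < e ^+ 2 by rewrite exprn_gt0.
  have [N HN] := cdotP (crepP f) (crepP f) e2; exists N => n Nn.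
  have := HN n Nn; have -> : cdot f f = 0.
    by rewrite -[cdot f f]/(csi f f) semin_sq f0 expr0n.
  rewrite subr0 semin_sq rnormC ger0_norm ?exprn_ge0 ?semin_ge0//.
  by rewrite ltr_pXn2r ?nnegrE ?semin_ge0// ltW.
apply: cfun_inj; apply/funext => x.
apply: (slim_uniq ((proj2 (crepP f)) x)).
have := sip_null_r nf (_ : sem_bounded (fun=> x)); apply.
by exists (semin s x + 1), 0%N; split => [|n _]; [rewrite ltr_wpDl// semin_ge0|rewrite lerDl].
Qed.

Definition cnorm (f : completion) : R[i] := toC (semin csi f).

Lemma cnormD f g : cnorm (f + g) <= cnorm f + cnorm g.
Proof. by rewrite -rmorphD lecR seminD. Qed.
Lemma cnormZ k f : cnorm (k *: f) = `|k| * cnorm f.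
Proof. by rewrite /cnorm seminZ rmorphM rnormE. Qed.
Lemma cnorm_eq0 f : cnorm f = 0 -> f = 0.
Proof. by move=> /(@complexI R) /csi_eq0. Qed.

HB.instance Definition _ :=
  Lmodule_isNormed.Build R[i] completion cnormD cnormZ cnorm_eq0.

Lemma rnorm_csi (f : completion) : rnorm f = semin csi f.
Proof. by []. Qed.

Definition cj_fun (x : V) : V -> R[i]^o := fun y => s y x.
Lemma cj_rep x : represents (fun=> x) (cj_fun x).
Proof.
split=> [e e0|y]; last exact: slim_cst.
by exists 0%N => m n _ _; rewrite subrr semin0.
Qed.
Lemma cj_mem x : cj_fun x \in representable.
Proof. by apply/asboolP; exists (fun=> x); exact: cj_rep. Qed.

Definition cj (x : V) : completion := Completion (cj_mem x).

Lemma cjD x y : cj (x + y) = cj x + cj y.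
Proof. by apply: cfun_inj; apply/funext => z; rewrite /= /cj_fun sipDr. Qed.
Lemma cjZ k x : cj (k *: x) = k *: cj x.
Proof. by apply: cfun_inj; apply/funext => z; rewrite /= /cj_fun sipZr. Qed.
Lemma cj_dot x y : cdot (cj x) (cj y) = s x y.
Proof.
have rep z : represents (fun=> z) (cfun (cj z)) by exact: cj_rep.
by apply: (slim_uniq (cdotP (rep x) (rep y))); exact: slim_cst.
Qed.
Lemma cjB x y : cj (x - y) = cj x - cj y.
Proof. by rewrite -scaleN1r cjD cjZ scaleN1r. Qed.
Lemma rnorm_cj x : rnorm (cj x) = semin s x.
Proof. by rewrite rnorm_csi /semin /= cj_dot. Qed.

Lemma cj_lim v f : represents v (cfun f) -> slim (fun n => cj (v n)) f.
Proof.
move=> vf e e0; have e2 : 0 < e / 2 by lra.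
have [N HN] := vf.1 _ e2; exists N => n Nn.
(* For fixed n the sequence v n - v m in m represents [cj (v n) - f], whose norm is therefore a
   limit of norms at most e / 2. *)
have rep : represents (fun m => v n + (-1) *: v m) (cfun (cj (v n) + (-1) *: f)).
  by apply: representsD; [exact: cj_rep|exact: representsZ].
have := slim_le (cdotP rep rep) (M := (e / 2) ^+ 2).
rewrite -[cdot _ _]/(csi _ _) semin_sq rnormC ger0_norm ?exprn_ge0 ?semin_ge0//.
rewrite scaleN1r -rnorm_csi => H.
apply: (@le_lt_trans _ _ (e / 2)); last lra.
rewrite -(ler_pXn2r (n := 2)) ?nnegrE ?rnorm_ge0 ?(ltW e2)//; apply: H.
exists N => m Nm; rewrite semin_sq rnormC ger0_norm ?exprn_ge0 ?semin_ge0//.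
rewrite scaleN1r; apply: lerXn2r; rewrite ?nnegrE ?semin_ge0 ?(ltW e2)//.
by apply: ltW; exact: HN.
Qed.

Lemma cj_dense (f : completion) (e : R) : 0 < e -> exists x, rnorm (f - cj x) < e.
Proof.
move=> e0; have [N HN] := cj_lim (crepP f) e0.
by exists (crep f N); rewrite rnorm_BC; exact: HN.
Qed.

Lemma cj_seq_cvg v : sem_cauchy v -> exists f, slim (fun n => cj (v n)) f.
Proof.
move=> cv.
have lim x : exists l, slim (fun n => s x (v n)) l.
  apply: scauchy_complex; apply: (sip_cauchy (v := fun=> x)) => // e e0.
  by exists 0%N => m n _ _; rewrite subrr semin0.
pose f : V -> R[i]^o := fun x => sval (cid (lim x)).
have vf : represents v f by split => // x; exact: (svalP (cid (lim x))).
have fm : f \in representable by apply/asboolP; exists v.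
by exists (Completion fm); exact: cj_lim.
Qed.

Lemma invS_lt (e : R) : 0 < e -> exists N, forall n, (N <= n)%N -> n.+1%:R^-1 < e.
Proof.
move=> e0; exists (Num.bound e^-1) => n Nn.
rewrite invf_plt ?posrE//.
have : e^-1 < (Num.bound e^-1)%:R by rewrite archi_boundP// invr_ge0 ltW.
by move=> /lt_le_trans; apply; rewrite ler_nat (leq_trans Nn).
Qed.

Lemma completion_complete (F : set_system completion) :
  ProperFilter F -> cauchy F -> cvg F.
Proof.
move=> FF cF.
(* The filter is traded for a sequence in V: F concentrates within 1 / (n + 1) of the image of the
   n-th point, so that sequence is Cauchy and its limit is the limit of F. *)
have ex n : exists x : V, F [set g : completion | rnorm (cj x - g) < n.+1%:R^-1].
  have n0 : 0 < (n.+1%:R : R)^-1 / 2 by rewrite divr_gt0// invr_gt0 ltr0n.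
  have /cauchyP /(_ (toC ((n.+1%:R : R)^-1 / 2))) [|f Ff] := cF; first by rewrite ltcR.
  have [x Hx] := cj_dense f n0; exists x.
  apply: filterS Ff => g; rewrite -ball_normE/= rnormE ltcR => fg.
  have -> : cj x - g = (f - g) - (f - cj x) by zmod.
  apply: (le_lt_trans (rnormB _ _)).
  by apply: lt_le_trans (ltrD fg Hx) _; rewrite -splitr.
pose v n := sval (cid (ex n)).
have Fv n : F [set g : completion | rnorm (cj (v n) - g) < n.+1%:R^-1].
  exact: (svalP (cid (ex n))).
have cv : sem_cauchy v.
  move=> e e0; have e2 : 0 < e / 2 by lra.
  have [N HN] := invS_lt e2; exists N => m n Nm Nn.
  have [g [/= gm gn]] := filter_ex (filterI (Fv m) (Fv n)).
  rewrite -rnorm_cj cjB; have -> : cj (v m) - cj (v n) = (cj (v m) - g) - (cj (v n) - g) by zmod.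
  rewrite (splitr e); apply: le_lt_trans (rnormB _ _) _; apply: ltrD.
    exact: lt_trans gm (HN m Nm).
  exact: lt_trans gn (HN n Nn).
have [f vf] := cj_seq_cvg cv.
apply/cvg_ex; exists f; apply/cvgrPdist_lt => e e0.
have eE : e = toC (complex.Re e) by rewrite RRe_real// gtr0_real.
have e0' : 0 < complex.Re e by rewrite -ltcR -eE.
have e2 : 0 < complex.Re e / 2 by lra.
have [N1 H1] := vf _ e2; have [N2 H2] := invS_lt e2.
have h1 := H1 _ (leq_maxl N1 N2); have h2 := H2 _ (leq_maxr N1 N2).
apply: filterS (Fv (maxn N1 N2)) => g /= hg.
rewrite rnormE eE ltcR.
have -> : f - g = (cj (v (maxn N1 N2)) - g) - (cj (v (maxn N1 N2)) - f) by zmod.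
rewrite [complex.Re e](splitr _); apply: le_lt_trans (rnormB _ _) _; apply: ltrD => //.
exact: lt_trans hg h2.
Qed.

HB.instance Definition _ := Uniform_isComplete.Build completion completion_complete.

Lemma cnorm_dot f : `|f| = sqrtC (cdot f f).
Proof.
rewrite rnormE rnorm_csi -[cdot f f]/(csi f f) semin_sq rmorphXn/= sqrCK//.
by rewrite ler0c semin_ge0.
Qed.

Definition completion_hilbert : hilbert R :=
  @Hilbert R completion cdot cdotDr cdotZr cdot_conj cdot_ge0 cnorm_dot.

End Completion.

(** * Square roots in A and contractivity of representations *)

Section Hilbert.
Context (R : realType) (K : hilbert R).
Implicit Types x y z : K.

Definition hsi : semi_inner K :=
  SemiInner (@dotpDr R K) (@dotpZr R K) (@dotp_conj R K) (@dotp_pos R K).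

Lemma rnorm_hsi x : rnorm x = semin hsi x.
Proof.
apply: complexI; rewrite -rnormE norm_dotp -[dotp x x]/(hsi x x) semin_sq.
by rewrite rmorphXn/= sqrCK// ler0c semin_ge0.
Qed.

Lemma dotp_CS x y : rnorm (dotp x y) <= rnorm x * rnorm y.
Proof. by rewrite !rnorm_hsi; exact: (sip_CS hsi). Qed.
Lemma dotp_sq x : dotp x x = toC (rnorm x ^+ 2).
Proof. by rewrite rnorm_hsi -(semin_sq hsi). Qed.
Lemma dotpDl x y z : dotp (x + y) z = dotp x z + dotp y z.
Proof. exact: (sipDl hsi). Qed.
Lemma dotpZl k x y : dotp (k *: x) y = k^*%R * dotp x y.
Proof. exact: (sipZl hsi). Qed.
Lemma dotpBl x y z : dotp (x - y) z = dotp x z - dotp y z.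
Proof. exact: (sipBl hsi). Qed.
Lemma dotpBr x y z : dotp x (y - z) = dotp x y - dotp x z.
Proof. exact: (sipBr hsi). Qed.
Lemma dotp0r x : dotp x 0 = 0.
Proof. exact: (sip0r hsi). Qed.

Lemma rnorm_le_sq x (c : R) : 0 <= c -> dotp x x <= toC (c ^+ 2) -> rnorm x <= c.
Proof.
by move=> c0; rewrite dotp_sq lecR ler_pXn2r ?nnegrE ?rnorm_ge0.
Qed.

End Hilbert.

Section ExactSqrt.
Context (R : realType) (A : cstarAlg R).
Let HN := unorm_cstar A.

(** The iterates stay in A, and A is complete, so here the root is exact. An exact identity is what
    a representation can be applied to before its continuity in the algebra variable is known. *)
Lemma cstar_sqrt_1B (u : A) : astar u = u -> rnorm u < 1 ->
  exists2 z, astar z = z & z + z = u + amul z z.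
Proof.
move=> su u1.
have sU : csn_sa (@ustar R A) (emb u) by rewrite /csn_sa -emb_star su.
have [|q [q0 q1 Hq]] := sqrt_iterP HN sU _ u1; first by rewrite unormE.
have ex n : exists a, sqrt_iter (emb u) n = emb a.
  elim: n => [|n [a Ha]] /=; first by exists 0.
  by exists (toC 2^-1 *: (u + amul a a)); rewrite embZ embD embM Ha expr2.
pose z n := (sqrt_iter (emb u) n).1.
have zE n : sqrt_iter (emb u) n = emb (z n).
  by rewrite /z; have [a ->] := ex n.
have zS n : z n.+1 + z n.+1 = u + amul (z n) (z n).
  have := zE n.+1; rewrite /= zE expr2 -embM -embD -embZ => -[<-].
  by rewrite -scalerDr scale_half_dbl.
have dz n : rnorm (z n.+1 - z n) <= 2 * q ^+ n.
  by have [_ _ _] := Hq n; rewrite !zE -embB unormE.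
have zq n : rnorm (z n) <= q by have [_ _ + _] := Hq n; rewrite zE unormE.
have sz n : astar (z n) = z n.
  by have [+ _ _ _] := Hq n; rewrite zE /csn_sa -emb_star => -[].
(* The sum of the bounds 2 q^n on the increments. *)
pose c := 2 / (1 - q).
have c0 : 0 <= c by rewrite divr_ge0//; lra.
have cE : c * (1 - q) = 2 by rewrite /c mulfVK// gt_eqF//; lra.
have geo n k : rnorm (z (n + k)%N - z n) <= c * (q ^+ n - q ^+ (n + k)).
  elim: k => [|k IH]; first by rewrite addn0 !subrr rnorm0 mulr0.
  rewrite addnS.
  have -> : z (n + k).+1 - z n = (z (n + k).+1 - z (n + k)%N) + (z (n + k)%N - z n) by zmod.
  apply: (le_trans (rnormD _ _)); have := dz (n + k)%N.
  rewrite exprS; move: (q ^+ (n + k)) IH => y IH h.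
  have -> : c * (q ^+ n - q * y) = c * (q ^+ n - y) + c * (1 - q) * y by ring.
  by rewrite cE; lra.
have cz : scauchy z.
  move=> e e0; have e2 : 0 < e / (2 * (c + 1)) by rewrite divr_gt0//; lra.
  have [N HNe] := expr_lt_eps q0 q1 e2; exists N => m n /subnKC Em /subnKC En.
  have bnd k : rnorm (z (N + k)%N - z N) < e / 2.
    apply: (le_lt_trans (geo N k)).
    apply: (@le_lt_trans _ _ (c * q ^+ N)).
      by rewrite ler_wpM2l// gerBl exprn_ge0.
    apply: (@le_lt_trans _ _ ((c + 1) * q ^+ N)).
      by rewrite ler_wpM2r ?exprn_ge0// lerDl.
    rewrite mulrC -ltr_pdivlMr; last by lra.
    by rewrite -mulrA -invfM.
  rewrite -Em -En; have -> : z (N + (m - N))%N - z (N + (n - N))%N =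
     (z (N + (m - N))%N - z N) - (z (N + (n - N))%N - z N) by zmod.
  by have := rnormB (z (N + (m - N))%N - z N) (z (N + (n - N))%N - z N);
    have := bnd (m - N)%N; have := bnd (n - N)%N; lra.
have [l Hl] := scauchy_complete cz.
have eq0 (x : A) : (exists2 C : R, 0 <= C & forall e, 0 < e -> rnorm x <= C * e) -> x = 0.
  move=> [C C0 H]; apply: rnorm_eq0; apply/eqP; rewrite eq_le rnorm_ge0 andbT.
  by apply: (@le_of_le_eps _ C) => // e e0 _; rewrite add0r; exact: H.
exists l.
  apply/eqP; rewrite -subr_eq0; apply/eqP; apply: eq0; exists 2 => // e e0.
  have [N HNe] := Hl e e0; have := HNe N (leqnn N).
  have -> : astar l - l = - astar (z N - l) + (z N - l).
    by rewrite astarD astarN sz; zmod.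
  move=> h; apply: (le_trans (rnormD _ _)); rewrite rnormN rnorm_astar; lra.
apply/eqP; rewrite -subr_eq0; apply/eqP; apply: eq0.
(* Two e come from 2 (z_(N+1) - l), one from (z_N - l) z_N since |z_N| <= q < 1, and |l| e from l
   (z_N - l). *)
exists (3 + rnorm l); first by rewrite addr_ge0// rnorm_ge0.
move=> e e0; have [N HNe] := Hl e e0.
have h1 := HNe N (leqnn N); have h2 := HNe N.+1 (leqnSn N).
have -> : l + l - (u + amul l l) = - (z N.+1 - l) - (z N.+1 - l) +
   (amul (z N - l) (z N) + amul l (z N - l)).
  rewrite amulDl amulDr amulNl amulNr.
  have -> : amul (z N) (z N) = z N.+1 + z N.+1 - u by rewrite zS; zmod.
  by zmod.
apply: (le_trans (rnormD _ _)); have h3 := rnormB (- (z N.+1 - l)) (z N.+1 - l).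
rewrite rnormN in h3.
have h4 := rnormD (amul (z N - l) (z N)) (amul l (z N - l)).
have h5 : rnorm (amul (z N - l) (z N)) <= e.
  apply: (le_trans (rnorm_amul _ _)); have := zq N => h.
  apply: (@le_trans _ _ (rnorm (z N - l) * 1)); last by rewrite mulr1 ltW.
  by rewrite ler_wpM2l ?rnorm_ge0//; lra.
have h6 : rnorm (amul l (z N - l)) <= rnorm l * e.
  by apply: (le_trans (rnorm_amul _ _)); rewrite ler_wpM2l ?rnorm_ge0// ltW.
by lra.
Qed.

End ExactSqrt.

Section Rep.
Context (R : realType) (A : cstarAlg R) (H : hilbert R) (pi : @representation R A H).

(* For s > |a|^2 the element u = a^* a / s satisfies 1 - u = (1 - z)^2 with z
   self-adjoint in A, so that <h, (1 - pi u) h> = |h - pi z h|^2 >= 0. *)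
Lemma rep_contractive a h : rnorm (pi a h) <= rnorm a * rnorm h.
Proof.
rewrite -(ler_pXn2r (n := 2)) ?nnegrE ?mulr_ge0 ?rnorm_ge0// exprMn.
have h0 : 0 <= rnorm h ^+ 2 by rewrite exprn_ge0// rnorm_ge0.
apply: (@le_of_le_eps _ (rnorm h ^+ 2)) => // e e0 _.
pose s := rnorm a ^+ 2 + e.
have s0 : 0 < s by rewrite ltr_wpDl// exprn_ge0// rnorm_ge0.
pose u := toC s^-1 *: amul (astar a) a.
have su : astar u = u by rewrite /u astarZ conjC_toC astarM astarK.
have u1 : rnorm u < 1.
  rewrite rnormZ rnormC gtr0_norm ?invr_gt0// rnorm_cstar ltr_pdivrMl// mulr1.
  by rewrite /s ltrDl.
have [z sz zz] := cstar_sqrt_1B su u1.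
have E : dotp (h - pi z h) (h - pi z h) = dotp h h - dotp h (pi u h).
  have S k : dotp (pi z h) k = dotp h (pi z k) by rewrite -rep_star sz.
  rewrite dotpBl !dotpBr !S -repM.
  have -> : pi u h = pi z h + pi z h - pi (amul z z) h.
    by rewrite -!repD zz repD; zmod.
  by rewrite dotpBr dotpDr; zmod.
have := dotp_pos (h - pi z h); rewrite E subr_ge0 /u repZ dotpZr repM.
rewrite -rep_star astarK !dotp_sq -rmorphM lecR ler_pdivrMl//.
by rewrite /s mulrDl [e * _]mulrC.
Qed.

End Rep.

(** * Closures, spans and extension by density *)

Section Topology.
Context (R : realType) (V : normedModType R[i]).

Lemma nbhs_rnormP (x : V) (B : set V) :
  nbhs x B <-> exists2 e : R, 0 < e & forall y, rnorm (x - y) < e -> B y.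
Proof.
split.
  move=> /nbhs_ballP[e /= e0 H].
  have eE : e = toC (complex.Re e) by rewrite RRe_real// gtr0_real.
  exists (complex.Re e); first by rewrite -ltcR -eE.
  by move=> y xy; apply: H; rewrite -ball_normE/= rnormE eE ltcR.
move=> [e e0 H]; apply/nbhs_ballP; exists (toC e) => /=; first by rewrite ltcR.
by move=> y; rewrite -ball_normE/= rnormE ltcR; exact: H.
Qed.

Lemma closureP (S : set V) x : closure S x <->
  forall e : R, 0 < e -> exists2 y, S y & rnorm (x - y) < e.
Proof.
split=> [H e e0|H B /nbhs_rnormP[e e0 HB]].
  have [|y [Sy xy]] := H [set y | rnorm (x - y) < e]; last by exists y.
  by apply/nbhs_rnormP; exists e.
by have [y Sy xy] := H e e0; exists y; split => //; exact: HB.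
Qed.

Lemma closure_pairP (S : set (V * V)) u v : closure S (u, v) <->
  forall e : R, 0 < e -> exists u' v', [/\ S (u', v'), rnorm (u - u') < e & rnorm (v - v') < e].
Proof.
split=> [H e e0|H B [[P Q] [/= /nbhs_rnormP[e1 e10 H1] /nbhs_rnormP[e2 e20 H2]] PQ]].
  have [|[u' v'] [Suv [/= h1 h2]]] :=
     H ([set y | rnorm (u - y) < e] `*` [set y | rnorm (v - y) < e]).
    exists ([set y | rnorm (u - y) < e], [set y | rnorm (v - y) < e]) => //=.
    by split; apply/nbhs_rnormP; exists e.
  by exists u', v'.
have e0 : 0 < Num.min e1 e2 by rewrite lt_min e10.
have [u' [v' [Suv h1 h2]]] := H _ e0; exists (u', v'); split => //.
move: h1 h2; rewrite !lt_min => /andP[h1 _] /andP[_ h2].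
by apply: PQ; split; [exact: H1|exact: H2].
Qed.

Lemma denseP (S : set V) : dense S <->
  forall x (e : R), 0 < e -> exists2 y, S y & rnorm (x - y) < e.
Proof.
split=> [dS x e e0|H O [x Ox] oO].
  have ob : nbhs x [set y | rnorm (x - y) < e] by apply/nbhs_rnormP; exists e.
  have [|y [/interior_subset xy Sy]] := dS _ _ (open_interior [set y | rnorm (x - y) < e]).
    by exists x.
  by exists y.
have /nbhs_rnormP[e e0 HO] : nbhs x O by exact: open_nbhs_nbhs.
by have [y Sy xy] := H x e e0; exists y; split => //; exact: HO.
Qed.

End Topology.

Section Span.
Context (R : realType).

Definition subsp (V : lmodType R[i]) (P : set V) :=
  [/\ P 0, forall x y, P x -> P y -> P (x + y) & forall (k : R[i]) x, P x -> P (k *: x)].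

Lemma lspan_incl (V : lmodType R[i]) (B : set V) x : B x -> lspan B x.
Proof.
move=> Bx; exists [:: (1, x)]; last by rewrite big_seq1 scale1r.
by move=> p; rewrite inE => /eqP ->.
Qed.

Lemma lspan_sub (V : lmodType R[i]) (B P : set V) : subsp P -> B `<=` P -> lspan B `<=` P.
Proof.
move=> [P0 PD PZ] BP _ [s Hs ->]; rewrite big_seq.
by elim/big_ind : _ => // p ps; apply/PZ/BP/Hs.
Qed.

Lemma lspan_subsp (V : lmodType R[i]) (B : set V) : subsp (lspan B).
Proof.
split; first by exists [::] => //; rewrite big_nil.
- move=> _ _ [s Hs ->] [t Ht ->]; exists (s ++ t); last by rewrite big_cat.
  by move=> p; rewrite mem_cat => /orP[]; [exact: Hs|exact: Ht].
- move=> k _ [s Hs ->]; exists [seq (k * p.1, p.2) | p <- s].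
    by move=> _ /mapP[p ps ->] /=; exact: Hs.
  by rewrite big_map scaler_sumr; apply: eq_bigr => p _; rewrite scalerA.
Qed.

Lemma lspan_mono (V : lmodType R[i]) (B C : set V) : B `<=` C -> lspan B `<=` lspan C.
Proof.
by move=> BC; apply: lspan_sub; [exact: lspan_subsp|move=> x /BC; exact: lspan_incl].
Qed.

Lemma closure_subsp (V : normedModType R[i]) (P : set V) :
  subsp P -> subsp (closure P).
Proof.
move=> [P0 PD PZ]; split; first exact: subset_closure.
- move=> u v /closureP H /closureP H'; apply/closureP => e e0.
  have e2 : 0 < e / 2 by lra.
  have [a Pa h] := H _ e2; have [b Pb h'] := H' _ e2.
  exists (a + b); first exact: PD.
  have -> : u + v - (a + b) = (u - a) + (v - b) by zmod.
  by have := rnormD (u - a) (v - b); lra.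
- move=> k u /closureP H; apply/closureP => e e0.
  have k0 : 0 < rnorm k + 1 by rewrite ltr_wpDl// rnorm_ge0.
  have [a Pa h] := H _ (divr_gt0 e0 k0).
  exists (k *: a); first exact: PZ.
  rewrite -scalerBr rnormZ.
  apply: (@le_lt_trans _ _ ((rnorm k + 1) * rnorm (u - a))).
    by rewrite ler_wpM2r ?rnorm_ge0// lerDl.
  by rewrite mulrC -ltr_pdivlMr.
Qed.

Lemma closure_min (V : normedModType R[i]) (S Q : set V) :
  S `<=` closure Q -> closure S `<=` closure Q.
Proof.
move=> SQ x /closureP H; apply/closureP => e e0; have e2 : 0 < e / 2 by lra.
have [y /SQ/closureP/(_ _ e2)[z Qz yz] xy] := H _ e2; exists z => //.
have -> : x - z = (x - y) + (y - z) by zmod.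
by have := rnormD (x - y) (y - z); lra.
Qed.

End Span.

Section Extension.
Context (R : realType).

(** Additive instead of linear, so that the conjugate-linear map h |-> <h, y> is covered too. *)
Definition badd (H : hilbert R) (W : normedZmodType R[i]) (f : H -> W) :=
  (forall x y, f (x + y) = f x + f y) /\
  exists2 M : R, 0 <= M & forall x, rnorm (f x) <= M * rnorm x.

Lemma baddB (H : hilbert R) (W : normedZmodType R[i]) (f : H -> W) x y : badd f ->
  f (x - y) = f x - f y.
Proof. by move=> [fD _]; apply/eqP; rewrite eq_sym subr_eq -fD subrK. Qed.

Lemma badd_comp (H K : hilbert R) (W : normedZmodType R[i]) (f : K -> W) (g : H -> K) :
  badd f -> badd g -> badd (fun h => f (g h)).
Proof.
move=> [fD [M M0 HM]] [gD [M' M'0 HM']]; split; first by move=> x y; rewrite gD fD.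
exists (M * M') => [|x]; first exact: mulr_ge0.
by apply: (le_trans (HM _)); rewrite -mulrA ler_wpM2l.
Qed.

Lemma badd_add (H : hilbert R) (W : normedZmodType R[i]) (f g : H -> W) :
  badd f -> badd g -> badd (fun h => f h + g h).
Proof.
move=> [fD [M M0 HM]] [gD [M' M'0 HM']]; split; first by move=> x y; rewrite gD fD; zmod.
exists (M + M') => [|x]; first exact: addr_ge0.
by apply: (le_trans (rnormD _ _)); rewrite mulrDl lerD.
Qed.

Lemma badd_scale (H K : hilbert R) (f : H -> K) (k : R[i]) :
  badd f -> badd (fun h => k *: f h).
Proof.
move=> [fD [M M0 HM]]; split; first by move=> x y; rewrite fD scalerDr.
exists (rnorm k * M) => [|x]; first by rewrite mulr_ge0// rnorm_ge0.
by rewrite rnormZ -mulrA ler_wpM2l ?rnorm_ge0.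
Qed.

Lemma badd_dotr (K : hilbert R) (y : K) : badd (fun h : K => dotp y h).
Proof.
split; first exact: dotpDr.
by exists (rnorm y) => [|x]; [exact: rnorm_ge0|exact: dotp_CS].
Qed.

Lemma badd_dotl (K : hilbert R) (y : K) : badd (fun h : K => dotp h y).
Proof.
split=> [x z|]; first by rewrite dotpDl.
by exists (rnorm y) => [|x]; [exact: rnorm_ge0|rewrite mulrC dotp_CS].
Qed.

Context (V : lmodType R[i]) (H : hilbert R) (j : V -> H).
Hypothesis jD : forall x y, j (x + y) = j x + j y.
Hypothesis jZ : forall k x, j (k *: x) = k *: j x.
Hypothesis j_dense : forall h (e : R), 0 < e -> exists v, rnorm (h - j v) < e.

Lemma badd_ext (W : normedZmodType R[i]) (f g : H -> W) : badd f -> badd g ->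
  (forall v, f (j v) = g (j v)) -> forall h, f h = g h.
Proof.
move=> bf bg fg h; have [_ [M M0 HM]] := bf; have [_ [M' M'0 HM']] := bg.
apply/eqP; rewrite -subr_eq0; apply/eqP; apply: rnorm_eq0.
apply/eqP; rewrite eq_le rnorm_ge0 andbT.
apply: (@le_of_le_eps _ (M + M')); first exact: addr_ge0.
move=> e e0 _; rewrite add0r; have [v hv] := j_dense h e0.
have -> : f h - g h = f (h - j v) - g (h - j v).
  by rewrite (baddB _ _ bf) (baddB _ _ bg) fg; zmod.
apply: (le_trans (rnormB _ _)); rewrite mulrDl.
by apply: lerD; [apply: (le_trans (HM _))|apply: (le_trans (HM' _))];
  rewrite ler_wpM2l// ltW.
Qed.

(** [j] may have a kernel, as the GNS map does; bounding L v by the norm of [j v] makes the limit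
    relation single-valued. *)
Lemma bounded_extension (K : hilbert R) (L : V -> K) (M : R) :
  (forall x y, L (x + y) = L x + L y) -> (forall k x, L (k *: x) = k *: L x) ->
  0 <= M -> (forall v, rnorm (L v) <= M * rnorm (j v)) ->
  exists F : H -> K, [/\ forall v, F (j v) = L v, forall x y, F (x + y) = F x + F y,
    forall k x, F (k *: x) = k *: F x & forall h, rnorm (F h) <= M * rnorm h].
Proof.
move=> LD LZ M0 LM.
have jB x y : j (x - y) = j x - j y by rewrite -scaleN1r jD jZ scaleN1r.
have LB x y : L (x - y) = L x - L y by rewrite -scaleN1r LD LZ scaleN1r.
pose lim_rel h k := forall e : R, 0 < e -> exists v, rnorm (h - j v) < e /\ rnorm (k - L v) < e.
have uniq h k k' : lim_rel h k -> lim_rel h k' -> k = k'.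
  move=> hk hk'; apply/eqP; rewrite -subr_eq0; apply/eqP; apply: rnorm_eq0.
  apply/eqP; rewrite eq_le rnorm_ge0 andbT.
  apply: (@le_of_le_eps _ (2 + M * 2)); first by rewrite addr_ge0// mulr_ge0.
  move=> e e0 _; rewrite add0r.
  have [v [h1 h2]] := hk e e0; have [v' [h1' h2']] := hk' e e0.
  have -> : k - k' = (k - L v) + (L (v - v') - (k' - L v')) by rewrite LB; zmod.
  have := rnormD (k - L v) (L (v - v') - (k' - L v')).
  have := rnormB (L (v - v')) (k' - L v').
  have : rnorm (L (v - v')) <= M * (2 * e).
    apply: (le_trans (LM _)); rewrite ler_wpM2l// jB.
    have -> : j v - j v' = (h - j v') - (h - j v) by zmod.
    by have := rnormB (h - j v') (h - j v); lra.
  by lra.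
have ex h : exists k, lim_rel h k.
  have exn n : exists v, rnorm (h - j v) < (n.+1%:R)^-1.
    by apply: j_dense; rewrite invr_gt0 ltr0n.
  pose v n := sval (cid (exn n)).
  have Hv n : rnorm (h - j (v n)) < (n.+1%:R)^-1 by exact: (svalP (cid (exn n))).
  have vs (e : R) : 0 < e -> exists N, forall n, (N <= n)%N -> rnorm (h - j (v n)) < e.
    move=> e0; have [N HN] := invS_lt e0; exists N => n Nn.
    exact: lt_trans (Hv n) (HN n Nn).
  have cL : scauchy (fun n => L (v n)).
    move=> e e0.
    have M1 : 0 < M + 1 by lra.
    have e2 : 0 < e / (M + 1) / 2 by rewrite !divr_gt0.
    have [N HN] := vs _ e2; exists N => m n Nm Nn.
    rewrite -LB; apply: (le_lt_trans (LM _)).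
    apply: (@le_lt_trans _ _ ((M + 1) * rnorm (j (v m - v n)))).
      by rewrite ler_wpM2r ?rnorm_ge0//; lra.
    rewrite mulrC -ltr_pdivlMr// jB.
    have -> : j (v m) - j (v n) = (h - j (v n)) - (h - j (v m)) by zmod.
    apply: (le_lt_trans (rnormB _ _)); rewrite [e / _](splitr).
    by apply: ltrD; exact: HN.
  have [k Hk] := scauchy_complete cL; exists k => e e0.
  have [N1 H1] := Hk e e0; have [N2 H2] := vs e e0.
  exists (v (maxn N1 N2)); split; first exact: H2 (leq_maxr _ _).
  by rewrite rnorm_BC; exact: H1 (leq_maxl _ _).
pose F h := sval (cid (ex h)).
have FP h : lim_rel h (F h) by exact: (svalP (cid (ex h))).
have FE h k : lim_rel h k -> F h = k by move=> hk; apply: uniq hk; exact: FP.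
exists F; split.
- by move=> v; apply: FE => e e0; exists v; rewrite !subrr !rnorm0.
- move=> x y; apply: FE => e e0; have e2 : 0 < e / 2 by lra.
  have [v [h1 h2]] := FP x _ e2; have [v' [h1' h2']] := FP y _ e2.
  exists (v + v'); rewrite jD LD; split.
    have -> : x + y - (j v + j v') = (x - j v) + (y - j v') by zmod.
    by have := rnormD (x - j v) (y - j v'); lra.
  have -> : F x + F y - (L v + L v') = (F x - L v) + (F y - L v') by zmod.
  by have := rnormD (F x - L v) (F y - L v'); lra.
- move=> k x; apply: FE => e e0.
  have k0 : 0 < rnorm k + 1 by rewrite ltr_wpDl// rnorm_ge0.
  have [v [h1 h2]] := FP x _ (divr_gt0 e0 k0).
  have sc (W : normedModType R[i]) (a b : W) :
      rnorm (a - b) < e / (rnorm k + 1) -> rnorm (k *: a - k *: b) < e.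
    move=> h; rewrite -scalerBr rnormZ.
    apply: (@le_lt_trans _ _ ((rnorm k + 1) * rnorm (a - b))).
      by rewrite ler_wpM2r ?rnorm_ge0// lerDl.
    by rewrite mulrC -ltr_pdivlMr.
  by exists (k *: v); rewrite jZ LZ; split; apply: sc.
- move=> h; apply: (@le_of_le_eps _ (1 + M)); first by rewrite addr_ge0.
  move=> e e0 _; have [v [h1 h2]] := FP h e e0.
  have := rnormD (F h - L v) (L v); rewrite subrK => h3.
  have : rnorm (L v) <= M * (rnorm h + e).
    apply: (le_trans (LM _)); rewrite ler_wpM2l//.
    have := rnormB h (h - j v); have -> : h - (h - j v) = j v by zmod.
    by lra.
  by lra.
Qed.

End Extension.

(** * Cores and closures of graphs *)

Section HilbertCore.
Context (R : realType) (K : hilbert R) (G : set (K * K)).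
Hypothesis G_sub : subsp G.
Hypothesis G_closable : forall v, closure G (0, v) -> v = 0.

Lemma closure_graph_fun u v v' : closure G (u, v) -> closure G (u, v') -> v = v'.
Proof.
move=> h h'; apply/eqP; rewrite -subr_eq0; apply/eqP/G_closable.
have [_ cD cZ] := closure_subsp G_sub.
have := cD _ _ h (cZ (-1) _ h').
rewrite (_ : (u, v) + -1 *: (u, v') = (0, v - v'))//.
by rewrite scaleN1r -[LHS]/(u - u, v - v') subrr.
Qed.

Lemma graph_of_graph : graph (of_graph G) = G.
Proof.
apply/seteqP; split=> -[u v] /=.
  by move=> [[v' Guv'] /= ->]; exact: (@xgetPex _ 0 [set v | G (u, v)] (ex_intro _ v' Guv')).
move=> Guv; split; first by exists v.
have h := @xgetPex _ 0 [set v | G (u, v)] (ex_intro _ v Guv).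
by apply: (@closure_graph_fun u) => //; apply: subset_closure.
Qed.

Lemma op_closure_oper u v : closure G (u, v) -> oper (op_closure (of_graph G)) u = v.
Proof.
move=> cuv; rewrite /op_closure graph_of_graph /=.
have h := @xgetPex _ 0 [set v | closure G (u, v)] (ex_intro _ v cuv).
exact: (@closure_graph_fun u).
Qed.

Lemma op_closure_dom u :
  dom (op_closure (of_graph G)) u <-> exists v, closure G (u, v).
Proof. by rewrite /op_closure graph_of_graph. Qed.

Lemma graph_norm_dotp (T : operator K) u :
  graph_norm (W := R[i]^o) (@dotp R K) T u =
  toC (Num.sqrt (rnorm u ^+ 2 + rnorm (oper T u) ^+ 2)).
Proof.
rewrite /graph_norm /graph_inner !dotp_sq -rmorphD.
have h : 0 <= rnorm u ^+ 2 + rnorm (oper T u) ^+ 2.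
  by rewrite addr_ge0// exprn_ge0// rnorm_ge0.
rewrite ger0_norm ?ler0c// -{1}(sqr_sqrtr h) rmorphXn/= sqrCK//.
by rewrite ler0c sqrtr_ge0.
Qed.

(** Graph-norm density becomes approximation of pairs in K x K, which removes the choice made by
    [xget] and leaves inclusions that can be chained. *)
Lemma hilbert_coreP (D : set K) :
  hilbert_core (op_closure (of_graph G)) D <->
  (forall y, D y -> exists z, closure G (y, z)) /\
  closure G `<=` closure [set p | D p.1 /\ closure G p].
Proof.
set T := op_closure (of_graph G).
have [_ cD cZ] := closure_subsp G_sub.
have cB u v u' v' : closure G (u, v) -> closure G (u', v') -> closure G (u - u', v - v').
  by move=> h h'; have := cD _ _ h (cZ (-1) _ h'); rewrite scaleN1r.
split=> [[DT dns]|[DT dns]].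
  split=> [y /DT /op_closure_dom//|[u v] cuv]; apply/closure_pairP => e e0.
  have du : dom T u by apply/op_closure_dom; exists v.
  have [|y Dy] := dns u du (toC e); first by rewrite ltcR.
  have /op_closure_dom[z cyz] := DT _ Dy.
  rewrite graph_norm_dotp (op_closure_oper (cB _ _ _ _ cuv cyz)) ltcR => h.
  exists y, z; split => //; apply: le_lt_trans h;
    rewrite -(ler_pXn2r (n := 2)) ?nnegrE ?rnorm_ge0 ?sqrtr_ge0// sqr_sqrtr.
  - by rewrite lerDl exprn_ge0// rnorm_ge0.
  - by rewrite addr_ge0// exprn_ge0// rnorm_ge0.
  - by rewrite lerDr exprn_ge0// rnorm_ge0.
  - by rewrite addr_ge0// exprn_ge0// rnorm_ge0.
split=> [y /DT /op_closure_dom//|u /op_closure_dom[v cuv] e e0].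
have eE : e = toC (complex.Re e) by rewrite RRe_real// gtr0_real.
have e0' : 0 < complex.Re e by rewrite -ltcR -eE.
have e2 : 0 < complex.Re e / 2 by lra.
have /closure_pairP/(_ _ e2)[y [z [[/= Dy cyz] h1 h2]]] := dns _ cuv.
exists y => //; rewrite graph_norm_dotp (op_closure_oper (cB _ _ _ _ cuv cyz)) eE ltcR.
rewrite -(ltr_pXn2r (n := 2)) ?nnegrE ?sqrtr_ge0 ?(ltW e0')// sqr_sqrtr; last first.
  by rewrite addr_ge0// exprn_ge0// rnorm_ge0.
have : rnorm (u - y) ^+ 2 < (complex.Re e / 2) ^+ 2.
  by rewrite ltr_pXn2r ?nnegrE ?rnorm_ge0// ltW.
have : rnorm (v - z) ^+ 2 < (complex.Re e / 2) ^+ 2.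
  by rewrite ltr_pXn2r ?nnegrE ?rnorm_ge0// ltW.
have : 0 < complex.Re e ^+ 2 by rewrite exprn_gt0.
by rewrite exprMn exprVn; lra.
Qed.

End HilbertCore.

(* A formal adjoint with a total set of vectors in its domain makes G closable. *)
Lemma closable_of_adjoint (R : realType) (K : hilbert R) (G : set (K * K)) (S : set K) :
  (forall k (e : R), 0 < e -> exists2 k', lspan S k' & rnorm (k - k') < e) ->
  (forall k, S k -> exists k', forall u v, G (u, v) -> dotp v k = dotp u k') ->
  forall v, closure G (0, v) -> v = 0.
Proof.
move=> dS adj v /closure_pairP cv.
have P : lspan S `<=` [set k | dotp v k = 0].
  apply: lspan_sub.
    split=> /=; first exact: dotp0r.
      by move=> x y hx hy; rewrite dotpDr hx hy addr0.
    by move=> c x hx; rewrite dotpZr hx mulr0.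
  move=> k /adj[k' Hk] /=; apply: rnorm_eq0; apply/eqP; rewrite eq_le rnorm_ge0 andbT.
  apply: (@le_of_le_eps _ (rnorm k + rnorm k')); first by rewrite addr_ge0// rnorm_ge0.
  move=> e e0 _; rewrite add0r; have [u' [v' [/Hk Guv h1 h2]]] := cv e e0.
  have -> : dotp v k = dotp (v - v') k - dotp (0 - u') k'.
    by rewrite sub0r (sipNl (hsi K) u' k' : dotp (- u') k' = _) opprK dotpBl /= Guv subrK.
  apply: (le_trans (rnormB _ _)); rewrite mulrDl; apply: lerD;
    by apply: (le_trans (dotp_CS _ _)); rewrite mulrC ler_wpM2l ?rnorm_ge0// ltW.
apply: rnorm_eq0; apply/eqP; rewrite eq_le rnorm_ge0 andbT.
apply/ler_addgt0Pr => e e0; rewrite add0r.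
have [k /P/= vk0 hk] := dS v e e0; apply: le_trans (ltW hk).
apply: rnorm_le_sq; first exact: rnorm_ge0.
have kv0 : dotp k v = 0 by rewrite -dotp_conj vk0 conjC0.
have := dotp_sq (v - k); rewrite dotpBl !dotpBr vk0 kv0 subr0 sub0r opprK => <-.
by rewrite lerDl dotp_pos.
Qed.

(** * Semiregular operators and their graph norm *)

Section Semiregular.
Context (R : realType) (A : cstarAlg R) (E : hilbertMod A) (T : operator E).
Hypothesis T_sr : semiregular T.
Local Notation T' := (oper T).

(** A vector is determined by testing against the dense domain of the adjoint; linearity and
    A-linearity of T follow by moving T across the inner product. *)
Lemma oper_eq (x v : E) :
  (forall z z', (forall y, dom T y -> inner (T' y) z = inner y z') ->
     inner (T' x) z = inner v z) -> T' x = v.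
Proof.
case: T_sr => _ _ /denseP dT H; apply/eqP; rewrite -subr_eq0; apply/eqP.
apply: (ortho_dense_eq0 dT) => z [z' Hz].
by rewrite innerBl (H _ _ Hz) subrr.
Qed.

Lemma operD x y : dom T x -> dom T y -> T' (x + y) = T' x + T' y.
Proof.
move=> dx dy; case: (T_sr) => -[_ dD _ _] _ _; apply: oper_eq => z z' Hz.
by rewrite innerDl !Hz// ?innerDl//; exact: dD.
Qed.

Lemma operZ k x : dom T x -> T' (k *: x) = k *: T' x.
Proof.
move=> dx; case: (T_sr) => -[_ _ dZ _] _ _; apply: oper_eq => z z' Hz.
by rewrite innerZl !Hz// ?innerZl//; exact: dZ.
Qed.

Lemma oper_act x a : dom T x -> T' (act x a) = act (T' x) a.
Proof.
move=> dx; case: (T_sr) => -[_ _ _ dA] _ _; apply: oper_eq => z z' Hz.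
by rewrite inner_actl !Hz// ?inner_actl//; exact: dA.
Qed.

Lemma domB x y : dom T x -> dom T y -> dom T (x - y).
Proof.
move=> dx dy; case: (T_sr) => -[_ dD dZ _] _ _.
by rewrite -scaleN1r; apply: dD => //; exact: dZ.
Qed.

Lemma operB x y : dom T x -> dom T y -> T' (x - y) = T' x - T' y.
Proof.
move=> dx dy; have dNy : dom T (-1 *: y) by case: (T_sr) => -[_ _ dZ _] _ _; exact: dZ.
by rewrite -scaleN1r operD// operZ// !scaleN1r.
Qed.

(** At x0 - y this is the element b_y to which states are applied. *)
Definition gram (x : E) : A := inner x x + inner (T' x) (T' x).

Lemma graph_normE x : graph_norm (@inner R A E) T x = toC (Num.sqrt (rnorm (gram x))).
Proof.
rewrite /graph_norm /graph_inner -/(gram x) rnormE.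
rewrite -{1}(sqr_sqrtr (rnorm_ge0 (gram x))) rmorphXn/= sqrCK//.
by rewrite ler0c sqrtr_ge0.
Qed.

Lemma module_core_approx (D : set E) x (e : R) : module_core T D -> dom T x -> 0 < e ->
  exists2 y, D y & rnorm (x - y) < e /\ rnorm (T' x - T' y) < e.
Proof.
move=> [DT dns] dx e0; have [|y Dy] := dns x dx (toC e); first by rewrite ltcR.
rewrite graph_normE ltcR => h; exists y => //.
have P1 := inner_cpos (x - y); have P2 := inner_cpos (T' (x - y)).
rewrite -operB//; last exact: DT.
split; apply: le_lt_trans h;
  rewrite -(ler_pXn2r (n := 2)) ?nnegrE ?rnorm_ge0 ?sqrtr_ge0// sqr_sqrtr ?rnorm_ge0// rnorm_inner.
  exact: cpos_norm_mono.
by rewrite /gram [inner _ _ + _]addrC; exact: cpos_norm_mono.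
Qed.

End Semiregular.

(** * Localizations *)

Section RepCore.
Context (R : realType) (A : cstarAlg R) (E : hilbertMod A) (T : operator E).
Hypothesis T_sr : semiregular T.
Context (H K : hilbert R) (pi : @representation R A H) (t : E -> H -> K).
Hypothesis it : interior_tensor pi t.
Local Notation T' := (oper T).

Lemma tensorBl x y h : t (x - y) h = t x h - t y h.
Proof. by rewrite -scaleN1r (tensorDl it) (tensorZl it) scaleN1r. Qed.
Lemma tensorBr x h k : t x (h - k) = t x h - t x k.
Proof. by rewrite -scaleN1r (tensorDr it) (tensorZr it) scaleN1r. Qed.

Lemma rnorm_tensor x h : rnorm (t x h) <= rnorm x * rnorm h.
Proof.
rewrite -(ler_pXn2r (n := 2)) ?nnegrE ?mulr_ge0 ?rnorm_ge0//.
have -> : rnorm (t x h) ^+ 2 = rnorm (dotp (t x h) (t x h)).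
  by rewrite dotp_sq rnormC ger0_norm// exprn_ge0// rnorm_ge0.
rewrite (dotp_tensor it); apply: (le_trans (dotp_CS _ _)).
rewrite exprMn rnorm_inner [rnorm h ^+ 2]expr2 mulrCA ler_wpM2l ?rnorm_ge0//.
exact: rep_contractive.
Qed.

(** For D = [dom T] this is the set passed to [of_graph] in [rep_localization0]. *)
Definition tensor_graph (D : set E) : set (K * K) :=
  lspan (V := (K * K)%type)
    [set p | exists x h, D x /\ p = (t x h, t (T' x) h)].

(** The formal adjoint sends the tensor of z and h to that of T^* z and h; such tensors are total
    because the domain of T^* is dense in E. *)
Lemma tensor_graph_closable v : closure (tensor_graph (dom T)) (0, v) -> v = 0.
Proof.
case: (T_sr) => _ _ /denseP dT.
pose S : set K := [set k | exists z h, adj_dom (@inner R A E) T z /\ k = t z h].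
apply: (@closable_of_adjoint _ _ _ S).
  move=> k e e0.
  suff sub : closure (lspan (elem_tensors t setT)) `<=` closure (lspan S).
    apply: (proj1 (closureP _ _) (sub k _)) => //.
    by apply/closureP; have /denseP := tensor_dense it; apply.
  apply: closure_min; apply: lspan_sub; first exact/closure_subsp/lspan_subsp.
  move=> _ [x [h [_ ->]]]; apply/closureP => d d0.
  have h0 : 0 < rnorm h + 1 by rewrite ltr_wpDl// rnorm_ge0.
  have [z Sz xz] := dT x _ (divr_gt0 d0 h0).
  exists (t z h); first by apply: lspan_incl; exists z, h.
  rewrite -tensorBl; apply: (le_lt_trans (rnorm_tensor _ _)).
  apply: (@le_lt_trans _ _ (rnorm (x - z) * (rnorm h + 1))).
    by rewrite ler_wpM2l ?rnorm_ge0// lerDl.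
  by rewrite -ltr_pdivlMr.
move=> _ [z [h [[z' Hz] ->]]]; exists (t z' h) => u v' Guv.
suff : tensor_graph (dom T) `<=` [set p | dotp p.2 (t z h) = dotp p.1 (t z' h)].
  by move=> /(_ _ Guv).
apply: lspan_sub.
  split => /=.
  - by rewrite -!(dotp_conj (t _ _)) !dotp0r.
  - by move=> x y hx hy; rewrite !dotpDl hx hy.
  - by move=> c x hx; rewrite !dotpZl hx.
move=> _ [x [g [dx ->]]] /=.
by rewrite !(dotp_tensor it) Hz.
Qed.

Lemma tensor_span_graph (D : set E) y : tensor_span t D y ->
  exists z, tensor_graph D (y, z).
Proof.
have [g0 gD gZ] := lspan_subsp
  [set p : K * K | exists x h, D x /\ p = (t x h, t (T' x) h)].
move: y; apply: (@lspan_sub _ _ _ [set y | exists z, tensor_graph D (y, z)])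
  => [|_ [x [h [Dx ->]]]]; last first.
  by exists (t (T' x) h); apply: lspan_incl; exists x, h.
split; first by exists 0.
- by move=> u v [z hz] [z' hz']; exists (z + z'); exact: (gD _ _ hz hz').
- by move=> c u [z hz]; exists (c *: z); exact: (gZ c _ hz).
Qed.

Lemma tensor_graph_span (D : set E) y z : tensor_graph D (y, z) -> tensor_span t D y.
Proof.
suff : tensor_graph D `<=` [set p | tensor_span t D p.1] by move=> h /h.
have [g0 gD gZ] := lspan_subsp (elem_tensors t D).
apply: lspan_sub => [|_ [x [h [Dx ->]]]]; last by apply: lspan_incl; exists x, h.
split; first exact: g0.
- by move=> u v; exact: gD.
- by move=> c u; exact: gZ.
Qed.

Lemma rep_coreP (D : set E) : D `<=` dom T ->
  hilbert_core (rep_localization t T) (tensor_span t D) <->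
  tensor_graph (dom T) `<=` closure (tensor_graph D).
Proof.
move=> Ddom; set G := tensor_graph (dom T).
have GD : tensor_graph D `<=` closure G.
  move=> p hp; apply: subset_closure; apply: lspan_mono hp.
  by move=> _ [x [h [/Ddom dx ->]]]; exists x, h.
have Gs : subsp G by exact: lspan_subsp.
(* Single-valuedness identifies the restriction of the closed graph to the span of D with
   [tensor_graph D]. *)
have E1 : [set p : K * K | tensor_span t D p.1 /\ closure G p] = tensor_graph D.
  apply/seteqP; split=> [[y z] /= [/tensor_span_graph[z' hz'] cz]|[y z] hp].
    by rewrite (closure_graph_fun Gs tensor_graph_closable cz (GD _ hz')).
  by split; [exact: tensor_graph_span hp|exact: GD].
apply: (iff_trans (hilbert_coreP Gs tensor_graph_closable _)); rewrite E1.
split=> [[_ h] p Gp|h]; first exact/h/subset_closure.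
split; last exact: closure_min.
by move=> y /tensor_span_graph[z hz]; exists z; exact: GD.
Qed.

Lemma rep_core_of_module_core (D : set E) : module_core T D ->
  hilbert_core (rep_localization t T) (tensor_span t D).
Proof.
move=> cD; apply/rep_coreP; first by case: cD.
apply: lspan_sub; first exact/closure_subsp/lspan_subsp.
move=> _ [x [h [dx ->]]]; apply/closure_pairP => e e0.
have h0 : 0 < rnorm h + 1 by rewrite ltr_wpDl// rnorm_ge0.
have [y Dy [xy Txy]] := module_core_approx T_sr cD dx (divr_gt0 e0 h0).
have sc u : rnorm u < e / (rnorm h + 1) -> rnorm (t u h) < e.
  move=> hu; apply: (le_lt_trans (rnorm_tensor _ _)).
  apply: (@le_lt_trans _ _ (rnorm u * (rnorm h + 1))).
    by rewrite ler_wpM2l ?rnorm_ge0// lerDl.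
  by rewrite -ltr_pdivlMr.
exists (t y h), (t (T' y) h); split.
- by apply: lspan_incl; exists y, h.
- by rewrite -tensorBl; exact: sc.
- by rewrite -tensorBl; exact: sc.
Qed.

End RepCore.

(** * Localization at a state *)

Section StateCore.
Context (R : realType) (A : cstarAlg R) (E : hilbertMod A) (T : operator E).
Hypothesis T_sr : semiregular T.
Context (w : A -> R[i]) (sw : state w) (K : hilbert R) (iota : E -> K).
Hypothesis sc : state_completion w iota.
Local Notation T' := (oper T).

Lemma iotaB x y : iota (x - y) = iota x - iota y.
Proof. by rewrite -scaleN1r (Defs.iotaD sc) (iotaZ sc) scaleN1r. Qed.

Lemma rnorm_iota_sq x : toC (rnorm (iota x) ^+ 2) = w (inner x x).
Proof. by rewrite -dotp_sq (iota_dotp sc). Qed.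

Lemma rnorm_iota x : rnorm (iota x) <= rnorm x.
Proof.
rewrite -(ler_pXn2r (n := 2)) ?nnegrE ?rnorm_ge0// rnorm_inner.
have := state_le sw (inner x x); rewrite -rnorm_iota_sq rnormC.
by rewrite ger0_norm// exprn_ge0// rnorm_ge0.
Qed.

Definition state_graph (D : set E) : set (K * K) :=
  [set p | exists x, D x /\ p = (iota x, iota (T' x))].

Lemma state_graph_subsp (D : set E) : submodule D -> D `<=` dom T ->
  subsp (state_graph D).
Proof.
move=> [D0 DD DZ _] Ddom; split.
- exists 0; split => //; have := iotaZ sc 0 0; rewrite !scale0r => ->.
  have -> : T' 0 = 0.
    by have := operZ T_sr 0 (Ddom _ D0); rewrite !scale0r.
  by have := iotaZ sc 0 0; rewrite !scale0r => ->.
- move=> _ _ [x [Dx ->]] [y [Dy ->]]; exists (x + y); split; first exact: DD.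
  by rewrite (operD T_sr) ?(Defs.iotaD sc)//; exact: Ddom.
- move=> k _ [x [Dx ->]]; exists (k *: x); split; first exact: DZ.
  by rewrite (operZ T_sr) ?(iotaZ sc)//; exact: Ddom.
Qed.

(** The formal adjoint sends [iota z] to the image of T^* z, on the dense image of the domain of
    T^*. *)
Lemma state_graph_closable v : closure (state_graph (dom T)) (0, v) -> v = 0.
Proof.
case: (T_sr) => _ _ /denseP dT.
apply: (@closable_of_adjoint _ _ _ [set k | exists z, adj_dom (@inner R A E) T z /\ k = iota z]).
  move=> k e e0; have e2 : 0 < e / 2 by lra.
  have /denseP/(_ k _ e2)[_ [x _ <-] kx] := iota_dense sc.
  have [z Sz xz] := dT x _ e2.
  exists (iota z); first by apply: lspan_incl; exists z.
  have -> : k - iota z = (k - iota x) + iota (x - z) by rewrite iotaB; zmod.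
  by have := rnormD (k - iota x) (iota (x - z)); have := rnorm_iota (x - z); lra.
move=> _ [z [[z' Hz] ->]]; exists (iota z') => _ _ [x [dx [-> ->]]].
by rewrite !(iota_dotp sc) Hz.
Qed.

Lemma state_graphE (D : set E) : D `<=` dom T ->
  [set p : K * K | (iota @` D) p.1 /\ closure (state_graph (dom T)) p] = state_graph D.
Proof.
move=> Ddom.
have Ts : subsp (state_graph (dom T)) by apply: state_graph_subsp => //; case: T_sr.
have GD : state_graph D `<=` closure (state_graph (dom T)).
  by move=> _ [x [/Ddom dx ->]]; apply: subset_closure; exists x.
apply/seteqP; split=> [[y z] /= [[x Dx <-] cz]|_ [x [Dx ->]]].
  exists x; split=> //; congr (_, _).
  apply: (closure_graph_fun Ts state_graph_closable cz).
  by apply: GD; exists x.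
by split => /=; [exists x|apply: GD; exists x].
Qed.

Lemma state_coreP (D : set E) : D `<=` dom T ->
  hilbert_core (state_localization iota T) (iota @` D) <->
  state_graph (dom T) `<=` closure (state_graph D).
Proof.
move=> Ddom.
have Ts : subsp (state_graph (dom T)) by apply: state_graph_subsp => //; case: T_sr.
apply: (iff_trans (hilbert_coreP Ts state_graph_closable _)); rewrite state_graphE//.
split=> [[_ h] p Gp|h]; first exact/h/subset_closure.
split; last exact: closure_min.
by move=> _ [x /Ddom dx <-]; exists (iota (T' x)); apply: subset_closure; exists x.
Qed.

End StateCore.

(** * Positive forms attached to a state *)

Section PositiveForms.
Context (R : realType) (A : cstarAlg R) (w : A -> R[i]) (sw : state w).

(** Polarization: the imaginary parts of s (x + y) (x + y) and s (x + i y) (x + i y) vanish. The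
    definition of a state does not list hermitian symmetry. *)
Lemma hermitian_of_pos (V : lmodType R[i]) (s : V -> V -> R[i]) :
  (forall x y z, s x (y + z) = s x y + s x z) ->
  (forall x y z, s (x + y) z = s x z + s y z) ->
  (forall k x y, s x (k *: y) = k * s x y) ->
  (forall k x y, s (k *: x) y = k^*%R * s x y) ->
  (forall x, 0 <= s x x) -> forall x y, (s x y)^*%R = s y x.
Proof.
move=> sDr sDl sZr sZl spos x y.
have h1 := ger0_Im (spos (x + y)).
have h2 := ger0_Im (spos (x + 'i%R *: y)).
have hx := ger0_Im (spos x); have hy := ger0_Im (spos y).
move: h1 h2; rewrite !sDl !sDr !sZl !sZr conjCi -complexiE.
case: (s x y) => a b; case: (s y x) => c d.
case: (s x x) hx => x1 x2 /= ->; case: (s y y) hy => y1 y2 /= ->.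
move=> h1 h2; apply/eqP; rewrite eq_complex/=; apply/andP.
by split; apply/eqP; lra.
Qed.

Lemma state_form_conj a b :
  (w (amul (astar a) b))^*%R = w (amul (astar b) a).
Proof.
apply: (hermitian_of_pos (s := fun a b => w (amul (astar a) b))).
- by move=> x y z; rewrite amulDr (stateD sw).
- by move=> x y z; rewrite astarD amulDl (stateD sw).
- by move=> k x y; rewrite amulZr (stateZ sw).
- by move=> k x y; rewrite astarZ amulZl (stateZ sw).
- exact: state_pos.
Qed.

Lemma state_formDr a b c :
  w (amul (astar a) (b + c)) = w (amul (astar a) b) + w (amul (astar a) c).
Proof. by rewrite amulDr (stateD sw). Qed.

Lemma state_formZr (k : R[i]) a b : w (amul (astar a) (k *: b)) = k * w (amul (astar a) b).
Proof. by rewrite amulZr (stateZ sw). Qed.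

Definition state_form : semi_inner A :=
  @SemiInner R A (fun a b => w (amul (astar a) b))
    state_formDr state_formZr state_form_conj (state_pos sw).

Section ModuleForm.
Variable E : hilbertMod A.
Implicit Types x y z : E.

Lemma state_inner_pos x : 0 <= w (inner x x).
Proof. by have [b ->] := inner_pos x; exact: state_pos. Qed.

Lemma state_innerDr x y z : w (inner x (y + z)) = w (inner x y) + w (inner x z).
Proof. by rewrite innerDr (stateD sw). Qed.

Lemma state_innerZr (k : R[i]) x y : w (inner x (k *: y)) = k * w (inner x y).
Proof. by rewrite innerZr (stateZ sw). Qed.

Lemma state_inner_conj x y : (w (inner x y))^*%R = w (inner y x).
Proof.
apply: (hermitian_of_pos (s := fun x y => w (inner x y))).
- exact: state_innerDr.
- by move=> a b c; rewrite innerDl (stateD sw).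
- exact: state_innerZr.
- by move=> k a b; rewrite innerZl (stateZ sw).
- exact: state_inner_pos.
Qed.

Definition state_module_form : semi_inner E :=
  @SemiInner R E (fun x y => w (inner x y))
    state_innerDr state_innerZr state_inner_conj state_inner_pos.

End ModuleForm.

Lemma state_completion_exists (E : hilbertMod A) :
  exists (K : hilbert R) (iota : E -> K), state_completion w iota.
Proof.
exists (completion_hilbert (state_module_form E)), (@cj _ _ (state_module_form E)); split.
- exact: cjD.
- exact: cjZ.
- by move=> x y; exact: (cj_dot (state_module_form E) x y).
- apply/denseP => f e e0; have [x hx] := cj_dense f e0.
  by exists (cj (state_module_form E) x) => //; exists x.
Qed.

End PositiveForms.

(** * The GNS representation and its interior tensor product *)

Section GNS.
Context (R : realType) (A : cstarAlg R) (E : hilbertMod A).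
Context (w : A -> R[i]) (sw : state w) (K : hilbert R) (iota : E -> K).
Hypothesis sc : state_completion w iota.

Let H := completion_hilbert (state_form sw).
Let j : A -> H := cj (state_form sw).

Let jD a b : j (a + b) = j a + j b. Proof. exact: cjD. Qed.
Let jZ k a : j (k *: a) = k *: j a. Proof. exact: cjZ. Qed.
Let j_dense (h : H) (e : R) : 0 < e -> exists b, rnorm (h - j b) < e.
Proof. exact: cj_dense. Qed.
Let j_dot a b : dotp (j a) (j b) = w (amul (astar a) b).
Proof. exact: (cj_dot (state_form sw) a b). Qed.

Let L_bound a b : rnorm (j (amul a b)) <= rnorm a * rnorm (j b).
Proof.
apply: rnorm_le_sq; first by rewrite mulr_ge0 ?rnorm_ge0.
have /andP[_ h] := state_conj_le sw b (cpos_mul_star a).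
rewrite j_dot exprMn rmorphM/= -(dotp_sq (j b)) j_dot astarM -amulA [amul (astar a) _]amulA.
by rewrite -rnorm_cstar.
Qed.

Let M_bound x b : rnorm (iota (act x b)) <= rnorm x * rnorm (j b).
Proof.
apply: rnorm_le_sq; first by rewrite mulr_ge0 ?rnorm_ge0.
have /andP[_ h] := state_conj_le sw b (inner_cpos x).
by rewrite exprMn rmorphM/= -(dotp_sq (j b)) j_dot (iota_dotp sc) inner_actl inner_act rnorm_inner.
Qed.

Let pi_ex a : exists F : H -> H, [/\ forall v, F (j v) = j (amul a v),
  forall x y, F (x + y) = F x + F y, forall k x, F (k *: x) = k *: F x
  & forall h, rnorm (F h) <= rnorm a * rnorm h].
Proof.
apply: (bounded_extension jD jZ j_dense) => [x y|k x||v].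
- by rewrite amulDr jD.
- by rewrite amulZr jZ.
- exact: rnorm_ge0.
- exact: L_bound.
Qed.

Let t_ex x : exists F : H -> K, [/\ forall v, F (j v) = iota (act x v),
  forall y z, F (y + z) = F y + F z, forall k y, F (k *: y) = k *: F y
  & forall h, rnorm (F h) <= rnorm x * rnorm h].
Proof.
apply: (bounded_extension jD jZ j_dense) => [a b|k a||v].
- by rewrite actDr (Defs.iotaD sc).
- by rewrite actZr (iotaZ sc).
- exact: rnorm_ge0.
- exact: M_bound.
Qed.

Let p a : H -> H := sval (cid (pi_ex a)).
Let t x : H -> K := sval (cid (t_ex x)).

Let p_j a b : p a (j b) = j (amul a b).
Proof. by rewrite /p; case: cid => F [/= FE]. Qed.
Let t_j x b : t x (j b) = iota (act x b).
Proof. by rewrite /t; case: cid => F [/= FE]. Qed.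
Let p_badd a : badd (p a).
Proof.
rewrite /p; case: cid => F [/= _ FD _ FM]; split => //.
by exists (rnorm a) => //; exact: rnorm_ge0.
Qed.
Let t_badd x : badd (t x).
Proof.
rewrite /t; case: cid => F [/= _ FD _ FM]; split => //.
by exists (rnorm x) => //; exact: rnorm_ge0.
Qed.
Let pZ a k h : p a (k *: h) = k *: p a h.
Proof. by rewrite /p; case: cid => F [/=]. Qed.
Let tZ x k h : t x (k *: h) = k *: t x h.
Proof. by rewrite /t; case: cid => F [/=]. Qed.

Let ext (W : normedZmodType R[i]) (f g : H -> W) : badd f -> badd g ->
  (forall v, f (j v) = g (j v)) -> forall h, f h = g h.
Proof. exact: (badd_ext j_dense). Qed.

Let p_bounded a : bounded_linear (p a).
Proof.
have [pD [M M0 HM]] := p_badd a; split; [by []|exact: pZ|].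
by exists (toC M) => h; rewrite !rnormE -rmorphM lecR.
Qed.

Let p_D a b h : p (a + b) h = p a h + p b h.
Proof.
move: h; apply: ext => [||v]; [exact: p_badd|exact: badd_add|].
by rewrite !p_j amulDl jD.
Qed.

Let p_Z k a h : p (k *: a) h = k *: p a h.
Proof.
move: h; apply: ext => [||v]; [exact: p_badd|exact: badd_scale|].
by rewrite !p_j amulZl jZ.
Qed.

Let p_M a b h : p (amul a b) h = p a (p b h).
Proof.
move: h; apply: ext => [||v]; [exact: p_badd|exact: badd_comp|].
by rewrite !p_j amulA.
Qed.

Let p_star a h k : dotp (p (astar a) h) k = dotp h (p a k).
Proof.
move: h; apply: ext => [||b].
- exact: (badd_comp (badd_dotl k) (p_badd _)).
- exact: badd_dotl.
move: k; apply: ext => [||c].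
- exact: badd_dotr.
- exact: (badd_comp (badd_dotr _) (p_badd _)).
by rewrite !p_j !j_dot astarM astarK amulA.
Qed.

Let pi : @representation R A H := Representation p_bounded p_D p_Z p_M p_star.

Let it : interior_tensor pi t.
Proof.
split.
- move=> x y; apply: ext => [||v]; [exact: t_badd|exact: badd_add|].
  by rewrite !t_j actDl (Defs.iotaD sc).
- by move=> x h k; have [tD _] := t_badd x; rewrite tD.
- move=> c x; apply: ext => [||v]; [exact: t_badd|exact: badd_scale|].
  by rewrite !t_j actZl (iotaZ sc).
- by move=> c x h; rewrite tZ.
- move=> x a; apply: ext => [||v]; [exact: t_badd|exact: (badd_comp (t_badd _) (p_badd _))|].
  by rewrite /= p_j !t_j actA.
- move=> x h x' h'; move: h; apply: ext => [||b].
  + exact: (badd_comp (badd_dotl _) (t_badd _)).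
  + exact: badd_dotl.
  move: h'; apply: ext => [||c].
  + exact: (badd_comp (badd_dotr _) (t_badd _)).
  + exact: (badd_comp (badd_dotr _) (p_badd _)).
  cbv beta; rewrite (p_j _ _ : pi (inner x x') (j c) = _) !t_j.
  by rewrite (iota_dotp sc) j_dot inner_act inner_actl amulA.
(* With a unit, [iota x] would be t x (j 1); in general it is only a limit of the vectors
   [iota (act x b)] = t x (j b). *)
- apply/denseP => k e e0; have e2 : 0 < e / 2 by lra.
  have /denseP/(_ k _ e2)[_ [x _ <-] kx] := iota_dense sc.
  have [b [xb _]] := act_approx x x e2.
  exists (iota (act x b)).
    by apply: lspan_incl; exists x, (j b); split => //; rewrite t_j.
  have -> : k - iota (act x b) = (k - iota x) + iota (x - act x b).
    by rewrite (iotaB sc); zmod.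
  have := rnormD (k - iota x) (iota (x - act x b)).
  by have := rnorm_iota sw sc (x - act x b); lra.
Qed.

(** [pi] can stay abstract: comparing the graphs takes only the tensor axioms, the density of the
    range of [j] and the formula for [t]. *)
Lemma gns_tensor : exists (H : hilbert R) (pi : @representation R A H)
    (t : E -> H -> K) (j : A -> H),
  [/\ interior_tensor pi t, forall (h : H) (e : R), 0 < e -> exists b, rnorm (h - j b) < e
    & forall x b, t x (j b) = iota (act x b)].
Proof. by exists H, pi, t, j; split. Qed.

End GNS.

(** * Passage between representations, states and the module *)

Section Equivalence.
Context (R : realType) (A : cstarAlg R) (E : hilbertMod A) (T : operator E) (D : set E).
Hypotheses (T_sr : semiregular T) (D_sub : submodule D) (D_dom : D `<=` dom T).
Local Notation T' := (oper T).

Lemma state_core_of_rep_core (w : A -> R[i]) (K : hilbert R) (iota : E -> K) :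
  (forall (H : hilbert R) (pi : @representation R A H) (K : hilbert R) (t : E -> H -> K),
     interior_tensor pi t ->
     hilbert_core (rep_localization t T) (tensor_span t D)) ->
  state w -> state_completion w iota ->
  hilbert_core (state_localization iota T) (iota @` D).
Proof.
move=> cores sw sc; apply/(state_coreP T_sr sw sc D_dom).
have [H [pi [t [j [it j_dense tj]]]]] := gns_tensor sw sc.
have /(rep_coreP T_sr it D_dom) cD := cores H pi K t it.
(* Approximating h by [j b] turns t x h into [iota (act x b)]; F must be an A-submodule for x b to
   stay in it, and T (x b) = (T x) b. *)
have sub1 (F : set E) : submodule F -> F `<=` dom T ->
    tensor_graph T t F `<=` closure (state_graph T iota F).
  move=> sF FT; apply: lspan_sub.
    exact/closure_subsp/(state_graph_subsp T_sr sc).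
  move=> _ [x [h [Fx ->]]]; apply/closure_pairP => e e0.
  pose M := rnorm x + rnorm (T' x) + 1.
  have M0 : 0 < M by rewrite ltr_wpDl// addr_ge0// rnorm_ge0.
  have [b hb] := j_dense h _ (divr_gt0 e0 M0).
  have bnd y : rnorm y <= M -> rnorm (t y h - iota (act y b)) < e.
    move=> yM; rewrite -tj -(tensorBr it).
    apply: (le_lt_trans (rnorm_tensor it _ _)).
    apply: (@le_lt_trans _ _ (M * rnorm (h - j b))).
      by rewrite ler_wpM2r ?rnorm_ge0.
    by rewrite mulrC -ltr_pdivlMr.
  have x0 := rnorm_ge0 x; have Tx0 := rnorm_ge0 (T' x).
  exists (iota (act x b)), (iota (act (T' x) b)); split.
  - exists (act x b); split; first by case: sF => _ _ _; exact.
    by rewrite (oper_act T_sr) //; exact: FT.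
  - by apply: bnd; rewrite /M; lra.
  - by apply: bnd; rewrite /M; lra.
(* A single b has to approximate both components of the pair, whence the two vectors in
   [act_approx]. *)
have sub2 (F : set E) : state_graph T iota F `<=` closure (tensor_graph T t F).
  move=> _ [x [Fx ->]]; apply/closure_pairP => e e0.
  have [b [h1 h2]] := act_approx x (T' x) e0.
  exists (iota (act x b)), (iota (act (T' x) b)); split.
  - by apply: lspan_incl; exists x, (j b); rewrite !tj.
  - by rewrite -(iotaB sc); exact: le_lt_trans (rnorm_iota sw sc _) h1.
  - by rewrite -(iotaB sc); exact: le_lt_trans (rnorm_iota sw sc _) h2.
(* Up to closure: state graph of [dom T], tensor graph of [dom T], tensor graph of D, state graph of
   D. *)
apply: (subset_trans (sub2 _)); apply: closure_min.
apply: (subset_trans cD); apply: closure_min; exact: sub1.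
Qed.

Lemma gram_convex x y (s t : R) : dom T x -> dom T y -> 0 <= s -> 0 <= t -> s + t = 1 ->
  cpos (toC s *: gram T x + toC t *: gram T y - gram T (toC s *: x + toC t *: y)).
Proof.
move=> dx dy s0 t0 st.
have [_ _ dZ _] : submodule (dom T) by case: T_sr.
have -> : toC s *: gram T x + toC t *: gram T y - gram T (toC s *: x + toC t *: y) =
    toC (s * t) *: inner (x - y) (x - y) + toC (s * t) *: inner (T' x - T' y) (T' x - T' y).
  rewrite -!(inner_convex _ _ s0 t0 st) /gram (operD T_sr); [|exact: dZ..].
  by rewrite !(operZ T_sr)// !scalerDr; zmod.
by apply: cposD; apply: cposZ; rewrite ?mulr_ge0//; exact: inner_cpos.
Qed.

Lemma cpos_gram x : cpos (gram T x).
Proof. by apply: cposD; exact: inner_cpos. Qed.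

Lemma module_core_of_state_core :
  (forall w : A -> R[i], state w -> forall (K : hilbert R) (iota : E -> K),
     state_completion w iota -> hilbert_core (state_localization iota T) (iota @` D)) ->
  module_core T D.
Proof.
move=> cores; split=> // x0 dx0 e e0; apply: contrapT => far.
have eE : e = toC (complex.Re e) by rewrite RRe_real// gtr0_real.
have r0 : 0 < complex.Re e by rewrite -ltcR -eE.
move: eE r0; move: (complex.Re e) => r eE r0.
have [D0 DD DZ _] := D_sub.
pose F : set A := [set b | exists y, D y /\ b = gram T (x0 - y)].
have dD y : D y -> dom T (x0 - y) by move=> Dy; apply: (domB T_sr) => //; exact: D_dom.
have [|||||w sw Hw] := @exists_state _ A F (r ^+ 2) (gram T (x0 - 0)).
- by rewrite exprn_gt0.
- by exists 0.
- by move=> _ [y [_ ->]]; exact: cpos_gram.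
- move=> _ [y [Dy ->]]; rewrite leNgt; apply/negP => lt; apply: far; exists y => //.
  rewrite graph_normE eE ltcR -(ltr_pXn2r (n := 2)) ?nnegrE ?sqrtr_ge0 ?(ltW r0)//.
  by rewrite sqr_sqrtr// rnorm_ge0.
- move=> _ _ s t [y1 [Dy1 ->]] [y2 [Dy2 ->]] s0 t0.
  have [st0|stn] := eqVneq (s + t) 0.
    have [-> ->] : s = 0 /\ t = 0 by split; lra.
    exists (gram T (x0 - y1)); first by exists y1.
    by rewrite addr0 !rmorph0 !scale0r addr0 subrr /cpos emb0; exact: csn_pos0 (unorm_cstar A).
  have st : 0 < s + t by rewrite lt_neqAle eq_sym stn addr_ge0.
  pose a := s / (s + t); pose b := t / (s + t).
  have a0 : 0 <= a by rewrite divr_ge0// ltW.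
  have b0 : 0 <= b by rewrite divr_ge0// ltW.
  have ab : a + b = 1 by rewrite /a /b -mulrDl mulfV.
  exists (gram T (x0 - (toC a *: y1 + toC b *: y2))).
    by exists (toC a *: y1 + toC b *: y2); split => //; apply: DD; exact: DZ.
  have -> : x0 - (toC a *: y1 + toC b *: y2) = toC a *: (x0 - y1) + toC b *: (x0 - y2).
    rewrite !scalerBr; have {1}-> : x0 = toC a *: x0 + toC b *: x0.
      by rewrite -scalerDl -rmorphD ab rmorph1 scale1r.
    by zmod.
  have := cposZ (ltW st) (gram_convex (dD _ Dy1) (dD _ Dy2) a0 b0 ab).
  rewrite scalerBr scalerDr !scalerA -!rmorphM.
  by have [-> ->] : (s + t) * a = s /\ (s + t) * b = t
     by rewrite /a /b !mulrA ![(s + t) * _]mulrC !mulfK.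
have [K [iota sc]] := state_completion_exists sw E.
have /(state_coreP T_sr sw sc D_dom) sub := cores w sw K iota sc.
(* Both components within r / 2 give w b_y < r^2 / 2, against the lower bound r^2 supplied by
   [Hw]. *)
have r2 : 0 < r / 2 by lra.
have /closure_pairP/(_ _ r2)[_ [_ [[y [Dy [-> ->]]] h1 h2]]] :
    closure (state_graph T iota D) (iota x0, iota (T' x0)).
  by apply: sub; exists x0.
have := Hw (gram T (x0 - y)) (ex_intro _ y (conj Dy erefl)).
rewrite /gram (stateD sw) -!(rnorm_iota_sq sc) -rmorphD/= (operB T_sr)//; last exact: D_dom.
rewrite !(iotaB sc).
have : rnorm (iota x0 - iota y) ^+ 2 < (r / 2) ^+ 2.
  by rewrite ltr_pXn2r ?nnegrE ?rnorm_ge0// ltW.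
have : rnorm (iota (T' x0) - iota (T' y)) ^+ 2 < (r / 2) ^+ 2.
  by rewrite ltr_pXn2r ?nnegrE ?rnorm_ge0// ltW.
have : 0 < r ^+ 2 by rewrite exprn_gt0.
by rewrite exprMn exprVn; lra.
Qed.

End Equivalence.

Theorem theorem3p3 (R : realType) (A : cstarAlg R) (E : hilbertMod A)
    (T : operator E) (D : set E)
    (T_semiregular : semiregular T) (T_closed : closed_op T)
    (D_sub : submodule D) (D_dom : D `<=` dom T) :
  [<-> module_core T D;
       forall (H : hilbert R) (pi : @representation R A H)
         (K : hilbert R) (t : E -> H -> K),
         interior_tensor pi t ->
         hilbert_core (rep_localization t T) (tensor_span t D);
       forall (w : A -> R[i]), state w ->
         forall (K : hilbert R) (iota : E -> K),
         state_completion w iota ->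
         hilbert_core (state_localization iota T) (iota @` D)].
Proof.
tfae.
- by move=> cD H pi K t it; exact: (rep_core_of_module_core T_semiregular it cD).
- move=> cores w sw K iota sc.
  exact: (state_core_of_rep_core T_semiregular D_sub D_dom cores sw sc).
- exact: (module_core_of_state_core T_semiregular D_sub D_dom).
Qed.
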